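(* Let $\varepsilon\in(0,\varepsilon_0/4]$. Let $\mathcal M[\varepsilon]$ be the $2\times2$ block operator matrix $$\mathcal M[\varepsilon]:=\begin{pmatrix}\mathcal M_{\Omega,\Omega}&\mathcal M_{\Omega,\mathsf P}[\varepsilon]\\ \mathcal M_{\mathsf P,\Omega}[\varepsilon]&\mathcal M_{\mathsf P,\mathsf P}\end{pmatrix}$$ from $\mathfrak E_\Omega\times\mathfrak E_{\mathsf P}$ to $\mathfrak F_\Omega\times\mathfrak F_{\mathsf P}$, whose entries are $$\mathcal M_{\Omega,\Omega}:\mathfrak E_\Omega\to\mathfrak F_\Omega,\ u\mapsto\Delta_x u;\qquad \mathcal M_{\mathsf P,\mathsf P}:\mathfrak E_{\mathsf P}\to\mathfrak F_{\mathsf P},\ U\mapsto\Delta_X U;$$ $$\mathcal M_{\Omega,\mathsf P}[\varepsilon]:\mathfrak E_{\mathsf P}\to\mathfrak F_\Omega,\ U\mapsto[\Delta_x,\varphi](\mathcal H_\varepsilon U);\qquad \mathcal M_{\mathsf P,\Omega}[\varepsilon]:\mathfrak E_\Omega\to\mathfrak F_{\mathsf P},\ u\mapsto[\Delta_X,\Phi](\mathcal H_{1/\varepsilon}u).$$ Let $f\in\mathfrak F_\Omega$ and $F\in\mathfrak F_{\mathsf P}$. If a pair $(u,U)\in\mathfrak E_\Omega\times\mathfrak E_{\mathsf P}$ satisfies $$\mathcal M[\varepsilon]\begin{pmatrix} u \\ U \end{pmatrix}=\begin{pmatrix} f \\ F \end{pmatrix},$$ then the function $w_\varepsilon:=(\mathcal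 H_\varepsilon\Phi)\,u+\varphi\,(\mathcal H_\varepsilon U)$ is a solution of the boundary value problem $$u_\varepsilon\in H^1_0(\Omega_\varepsilon),\qquad \Delta u_\varepsilon=(\mathcal H_\varepsilon\Phi)\,f+\varepsilon^{-2}\varphi\,\mathcal H_\varepsilon F\ \text{ in }\Omega_\varepsilon,$$ and therefore coincides with the unique solution $u_\varepsilon$ of that problem.
   Context: Let $n\ge2$. $\mathbb B(r)$ is the open ball of center $0$ and radius $r$ in $\mathbb R^n$, $\mathbb B^{\complement}(r)=\mathbb R^n\setminus\overline{\mathbb B(r)}$, $\mathbb A(r,r')=\mathbb B^{\complement}(r)\cap\mathbb B(r')$. Generating triple: $\Gamma$ is an infinite open cone in $\mathbb R^n$ with vertex $0$ ($tx\in\Gamma$ for $x\in\Gamma$, $t>0$) such that, with $\hat\Gamma=\Gamma\cap\mathbb S^{n-1}$, the capacity of $\mathbb S^{n-1}\setminus\hat\Gamma$ in $\mathbb S^{n-1}$ is positive (equivalently, the first eigenvalue $\mu_1$ of the positive Dirichlet Laplace–Beltrami operator on $\hat\Gamma$ is $>0$). $\Omega$ is a bounded connected open set with $\Omega\cap\mathbb B(r_0)=\Gamma\cap\mathbb B(r_0)$ for some $r_0>0$. $\mathsf P$ is an unbounded open set with $\mathsf P\cap\mathbb B^{\complement}(R_0)=\Gamma\cap\mathbb B^{\complement}(R_0)$ for some $R_0>0$. Set $\varepsilon_0=r_0/R_0$. For $\varepsilon\in[0,\varepsilon_0]$, $\Omega_\varepsilon$ is defined by: $\Omega_\varepsilon\cap\mathbb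 B^{\complement}(r_0)=\Omega\cap\mathbb B^{\complement}(r_0)$; $\Omega_\varepsilon\cap\overline{\mathbb A(\varepsilon R_0,r_0)}=\Gamma\cap\overline{\mathbb A(\varepsilon R_0,r_0)}$; $\Omega_\varepsilon\cap\mathbb B(\varepsilon R_0)=\varepsilon\mathsf P\cap\mathbb B(\varepsilon R_0)$. Cutoffs: $\Phi,\varphi$ are fixed smooth functions on $\mathbb R^n$ with $\Phi=1$ on $\mathbb B^{\complement}(2R_0)$, $\Phi=0$ on $\mathbb B(R_0)$, $\varphi=1$ on $\mathbb B(r_0/2)$, $\varphi=0$ on $\mathbb B^{\complement}(r_0)$. For $t>0$, $\mathcal H_tU(x)=U(x/t)$. Commutator: $[\Delta,\psi]w=\Delta(\psi w)-\psi\Delta w=2\nabla\psi\cdot\nabla w+(\Delta\psi)w$. Products with cutoffs are extended by zero. Spaces: $H^1_0(\mathcal V)$ is the closure of $C_0^\infty(\mathcal V)$ in $H^1(\mathcal V)$. $H^1_{\mathsf w,0}(\mathsf P)$ is the completion of $C^\infty_0(\mathsf P)$ in the norm $\big(\int_{\mathsf P}\frac{|G(X)|^2}{(1+|X|)^2}dX+\int_{\mathsf P}|\nabla G|^2dX\big)^{1/2}$. $\mathfrak F_\Omega=\{f\in L^2(\Omega): f=0\text{ on }\mathbb B(r_0/2)\}$ and $\mathfrak F_{\mathsf P}=\{F\in L^2(\mathsf P):F=0\text{ on }\mathbb B^{\complement}(2R_0)\}$ with $L^2$ norms. $\mathfrak E_\Omega=\{u\in H^1_0(\Omega):\Delta u\in\mathfrak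 F_\Omega\}$ and $\mathfrak E_{\mathsf P}=\{U\in H^1_{\mathsf w,0}(\mathsf P):\Delta U\in\mathfrak F_{\mathsf P}\}$ with graph norms $\|u\|^2_{\mathfrak E_\Omega}=\|u\|^2_{H^1(\Omega)}+\|\Delta u\|^2_{L^2(\Omega)}$, $\|U\|^2_{\mathfrak E_{\mathsf P}}=\|U\|^2_{H^1_{\mathsf w}(\mathsf P)}+\|\Delta U\|^2_{L^2(\mathsf P)}$. Elements of $\mathfrak F_\Omega$, $\mathfrak F_{\mathsf P}$ are extended by $0$ to $\mathbb R^n$. $\Delta$ is taken in the sense of distributions; $x$ and $X=x/\varepsilon$ denote the slow and rapid variables.
   Formalization: Ω_ε is taken equal to Ω on the sphere |x|=r₀ and to εP on |x|=εR₀ instead of Γ there; the literal definition can be non-open or fill in slits of Ω or εP, making the claim ill-defined or false. Both agree when Ω and P equal Γ on these spheres. *)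

(* Defs.v *)
From HB Require Import structures.
From mathcomp Require Import all_boot all_order all_algebra.
From mathcomp Require Import all_classical all_reals all_analysis.

Set Implicit Arguments.
Unset Strict Implicit.
Unset Printing Implicit Defensive.

Import Order.TTheory GRing.Theory Num.Theory.
Import numFieldNormedType.Exports.

Local Open Scope classical_set_scope.
Local Open Scope ring_scope.

(* 'rV[R]_n is given the sigma-algebra generated by the coordinates (its Borel
   sigma-algebra), and lebesgue_rV R n is the n-fold product of the
   one-dimensional Lebesgue measure. *)
Fact rV_display : measure_display. Proof. exact. Qed.

Section rV_measurable.
Variables (R : realType) (n : nat).

Definition rV_coord (i : 'I_n) (x : 'rV[R]_n) : measurableTypeR R := x ord0 i.

Let rV_set0 : g_sigma_preimage rV_coord set0.
Proof. exact: sigma_algebra0. Qed.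

Let rV_setC A : g_sigma_preimage rV_coord A -> g_sigma_preimage rV_coord (~` A).
Proof. exact: sigma_algebraC. Qed.

Let rV_bigcup (F : (set 'rV[R]_n)^nat) :
  (forall i, g_sigma_preimage rV_coord (F i)) ->
  g_sigma_preimage rV_coord (\bigcup_i F i).
Proof. exact: sigma_algebra_bigcup. Qed.

HB.instance Definition _ := @isMeasurable.Build rV_display 'rV[R]_n
  (g_sigma_preimage rV_coord) rV_set0 rV_setC rV_bigcup.

End rV_measurable.

Section lebesgue_rV.
Variable R : realType.

Lemma measurable_rV_coord n (i : 'I_n) :
  measurable_fun [set: 'rV[R]_n] (@rV_coord R n i).
Proof.
move=> _ Y mY; rewrite setTI; apply: sub_sigma_algebra => /=.
rewrite -bigcup_seq/=; exists i => /=; first by rewrite mem_index_enum.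
by exists Y => //; rewrite setTI.
Qed.

Lemma measurable_fun_rVP d (T : measurableType d) n (f : T -> 'rV[R]_n) :
  measurable_fun [set: T] f <->
  forall i, measurable_fun [set: T] (@rV_coord R n i \o f).
Proof.
split=> [mf i|mf]; first exact: measurableT_comp (measurable_rV_coord i) mf.
pose G := [set A : set 'rV[R]_n | measurable (f @^-1` A)].
suff GS : g_sigma_preimage (@rV_coord R n) `<=` G.
  by move=> _ A mA; rewrite setTI; exact: GS.
apply: smallest_sub.
  split.
  - by rewrite /G/= preimage_set0.
  - by move=> A GA; move: (measurableC GA); rewrite /G/= setTD preimage_setC.
  - by move=> A GA; rewrite /G/= preimage_bigcup; apply: bigcupT_measurable => k; exact: GA.
rewrite -bigcup_seq => A [i _ [B mB <-]]; rewrite /G /= setTI.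
by have := mf i measurableT B mB; rewrite setTI.
Qed.

Definition rV_cons n (p : measurableTypeR R * 'rV[R]_n) : 'rV[R]_n.+1 :=
  \row_(i < n.+1) if unlift ord0 i is Some j then p.2 ord0 j else p.1.

Definition rV_uncons n (x : 'rV[R]_n.+1) : measurableTypeR R * 'rV[R]_n :=
  (x ord0 ord0, \row_(j < n) x ord0 (lift ord0 j)).

Lemma rV_consK n : cancel (@rV_cons n) (@rV_uncons n).
Proof.
case=> a x; rewrite /rV_uncons mxE unlift_none; congr pair.
by apply/rowP => j; rewrite !mxE liftK.
Qed.

Lemma measurable_rV_cons n : measurable_fun setT (@rV_cons n).
Proof.
apply/measurable_fun_rVP => i.
have [j ->|->] := unliftP ord0 i.
- rewrite (_ : _ \o _ = @rV_coord R n j \o snd).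
    exact: measurableT_comp (measurable_rV_coord j) measurable_snd.
  by apply/funext => p /=; rewrite /rV_coord mxE liftK.
- rewrite (_ : _ \o _ = fst); first exact: measurable_fst.
  by apply/funext => p /=; rewrite /rV_coord mxE unlift_none.
Qed.

Lemma measurable_rV_uncons n : measurable_fun setT (@rV_uncons n).
Proof.
apply: measurable_fun_pair; first exact: (measurable_rV_coord ord0).
apply/measurable_fun_rVP => j.
rewrite (_ : _ \o _ = @rV_coord R n.+1 (lift ord0 j)).
  exact: measurable_rV_coord.
by apply/funext => x /=; rewrite /rV_coord mxE.
Qed.

Section step.
Variables (n : nat) (m : {sigma_finite_measure set 'rV[R]_n -> \bar R}).

Let prod_leb : {measure set (measurableTypeR R * 'rV[R]_n)%type -> \bar R} :=
  (@lebesgue_measure R \x m)%E.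

Let prod_leb_sigma_finite : sigma_finite setT prod_leb.
Proof.
have /sigma_finiteP[F [TF ndF Foo]] := sigma_finiteT (@lebesgue_measure R).
have /sigma_finiteP[G [TG ndG Goo]] := sigma_finiteT m.
exists (fun k => F k `*` G k).
  rewrite -setXTT TF TG predeqE => -[x y]; split.
    move=> [/= [i _ Fix] [k _ Gky]]; exists (maxn i k) => //; split.
    - by move: x Fix; exact/subsetPset/ndF/leq_maxl.
    - by move: y Gky; exact/subsetPset/ndG/leq_maxr.
  by move=> [i _ []/= ? ?]; split; exists i.
move=> k; have [? ?] := Foo k; have [? ?] := Goo k.
split; first exact: measurableX.
by rewrite /prod_leb/= product_measure1E// lte_mul_pinfty// ge0_fin_numE.
Qed.

Definition leb_step : set 'rV[R]_n.+1 -> \bar R :=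
  pushforward prod_leb (@rV_cons n).

Let leb_step0 : leb_step set0 = 0%E.
Proof. by rewrite /leb_step /pushforward preimage_set0 measure0. Qed.

Let leb_step_ge0 A : (0 <= leb_step A)%E.
Proof. exact: (measure_ge0 prod_leb). Qed.

Let leb_step_sigma_additive : semi_sigma_additive leb_step.
Proof.
move=> F mF tF mUF; rewrite /leb_step /pushforward preimage_bigcup.
apply: measure_semi_sigma_additive.
- by move=> k; rewrite -[X in measurable X]setTI; exact: measurable_rV_cons.
- apply/trivIsetP => /= i j _ _ ij; rewrite -preimage_setI.
  by move/trivIsetP : tF => /(_ _ _ _ _ ij) ->//; rewrite preimage_set0.
- by rewrite -preimage_bigcup -[X in measurable X]setTI; exact: measurable_rV_cons.
Qed.

HB.instance Definition _ := isMeasure.Build _ _ _ leb_step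
  leb_step0 leb_step_ge0 leb_step_sigma_additive.

Let leb_step_sigma_finite : sigma_finite setT leb_step.
Proof.
have [F FT mF] := prod_leb_sigma_finite.
exists (fun k => @rV_uncons n @^-1` F k).
  by rewrite -preimage_bigcup -FT preimage_setT.
move=> k; have [mFk Fkoo] := mF k; split.
  by rewrite -[X in measurable X]setTI; exact: measurable_rV_uncons.
rewrite /leb_step /pushforward -comp_preimage.
by rewrite (_ : _ \o _ = id) //; apply/funext => p /=; exact: rV_consK.
Qed.

HB.instance Definition _ := @Measure_isSigmaFinite.Build _ _ _ leb_step
  leb_step_sigma_finite.

Definition leb_stepM : {sigma_finite_measure set 'rV[R]_n.+1 -> \bar R} :=
  leb_step.

End step.

Fixpoint lebesgue_rV (n : nat) : {sigma_finite_measure set 'rV[R]_n -> \bar R} :=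
  if n is k.+1 then leb_stepM (lebesgue_rV k)
  else dirac (0 : 'rV[R]_0).

End lebesgue_rV.

Section euclidean.
Variables (R : realType) (n : nat).
Implicit Types (x : 'rV[R]_n) (V K : set 'rV[R]_n) (f psi eta : 'rV[R]_n -> R).

(* The library norm on row vectors is the sup norm; it induces the same
   topology as the Euclidean norm but different balls. *)
Definition enorm x : R := Num.sqrt (\sum_(i < n) x ord0 i ^+ 2).

Definition eball (r : R) : set 'rV[R]_n := [set x | enorm x < r].
Definition eballC (r : R) : set 'rV[R]_n := ~` closure (eball r).
Definition annulus (r r' : R) : set 'rV[R]_n := eballC r `&` eball r'.
Definition usphere : set 'rV[R]_n := [set x | enorm x = 1].

Definition dilset (t : R) V : set 'rV[R]_n := (fun x => t *: x) @` V.
Definition dil (t : R) f : 'rV[R]_n -> R := fun x => f (t^-1 *: x).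

Definition partial (i : 'I_n) f : 'rV[R]_n -> R :=
  fun x => 'D_(delta_mx ord0 i) f x.
Definition laplacian f : 'rV[R]_n -> R :=
  fun x => \sum_(i < n) partial i (partial i f) x.

Definition smooth f : Prop :=
  forall s : seq 'I_n, let g := foldr partial f s in
    continuous g /\ forall i x, derivable g x (delta_mx ord0 i).

Definition test_function V eta : Prop :=
  [/\ smooth eta, compact (closure [set x | eta x != 0])
    & closure [set x | eta x != 0] `<=` V].

End euclidean.

Arguments eball {R n} r.
Arguments eballC {R n} r.
Arguments annulus {R n} r r'.
Arguments usphere {R n}.

Section capacity.
Variables (R : realType) (n : nat).
Implicit Types (K : set 'rV[R]_n) (g v : 'rV[R]_n -> R).

(* The surface measure of A `<=` usphere is n times the volume of the cone
   {t x | x in A, 0 < t < 1}. *)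
Definition sphere_integral g : \bar R :=
  (n%:R%:E * \int[lebesgue_rV R n]_(x in eball 1) (g ((enorm x)^-1 *: x))%:E)%E.

(* At a unit vector x, the tangential gradient of v is
   grad v(x) - (x . grad v(x)) x. *)
Definition tangential_grad_sq v : 'rV[R]_n -> R := fun x =>
  \sum_(i < n) partial i v x ^+ 2 - (\sum_(i < n) x ord0 i * partial i v x) ^+ 2.

(* H^1 capacity in the unit sphere of a compact subset K of it. *)
Definition sphere_capacity K : \bar R :=
  ereal_inf [set sphere_integral (fun x => v x ^+ 2 + tangential_grad_sq v x)
            | v in [set v | smooth v /\ forall x, K x -> 1 <= v x]].

End capacity.

(* Functions on an open set V are represented by total functions on 'rV[R]_n
   whose values outside V are irrelevant; equality is almost everywhere on V. *)
Section sobolev.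
Variables (R : realType) (n : nat).
Local Notation mu := (lebesgue_rV R n).
Implicit Types (V : set 'rV[R]_n) (w u g psi : 'rV[R]_n -> R)
  (Du : 'I_n -> 'rV[R]_n -> R).

Definition loc_integrable V g : Prop :=
  measurable_fun V g /\
  forall K, K `<=` V -> compact K -> mu.-integrable K (EFin \o g).

Definition in_L2 V g : Prop :=
  measurable_fun V g /\ (\int[mu]_(x in V) (g x ^+ 2)%:E < +oo)%E.

Definition is_weak_grad V u Du : Prop :=
  [/\ loc_integrable V u, forall i, loc_integrable V (Du i)
    & forall eta, test_function V eta -> forall i,
      \int[mu]_(x in V) (u x * partial i eta x) =
      - \int[mu]_(x in V) (Du i x * eta x)].

Definition is_weak_laplacian V u g : Prop :=
  [/\ loc_integrable V u, loc_integrable V g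
    & forall eta, test_function V eta ->
      \int[mu]_(x in V) (u x * laplacian eta x) =
      \int[mu]_(x in V) (g x * eta x)].

(* The distributional gradient and Laplacian, whenever they are represented by
   locally integrable functions (these are then unique up to equality a.e.). *)
Definition weak_grad V u : 'I_n -> 'rV[R]_n -> R :=
  xget (fun _ _ => 0) [set Du | is_weak_grad V u Du].
Definition weak_laplacian V u : 'rV[R]_n -> R :=
  xget (fun _ => 0) [set g | is_weak_laplacian V u g].

(* [Delta, psi] u for a function u on V, extended by zero. *)
Definition laplacian_commutator V psi u : 'rV[R]_n -> R :=
  (fun x => 2 * (\sum_(i < n) partial i psi x * weak_grad V u i x)
            + laplacian psi x * u x) \_ V.

Definition H1_norm_sq w V u Du : \bar R :=
  (\int[mu]_(x in V) (w x * u x ^+ 2 + \sum_(i < n) Du i x ^+ 2)%:E)%E.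

(* Closure of the test functions for the weighted H^1 norm. For a weight w that
   is locally bounded from below by positive constants, this also realizes
   their completion, since norm-Cauchy sequences converge in L^2_loc. *)
Definition H1_closure w V u : Prop :=
  exists Du, [/\ is_weak_grad V u Du,
    (H1_norm_sq w V u Du < +oo)%E
    & forall delta : R, 0 < delta -> exists2 eta, test_function V eta &
      (H1_norm_sq w V (fun x => (u x - eta x)%R)
         (fun i x => (Du i x - partial i eta x)%R) < delta%:E)%E].

Definition H10 V u : Prop := H1_closure (fun _ => 1) V u.
Definition H1w0 V u : Prop := H1_closure (fun x => (1 + enorm x) ^- 2) V u.

End sobolev.

Section perforation.
Variables (R : realType) (n : nat).
Local Notation mu := (lebesgue_rV R n).
Implicit Types (Gam Om P : set 'rV[R]_n) (eps : R)
  (Phi phi f u : 'rV[R]_n -> R).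

Record generating_triple Gam Om P (r0 R0 : R) : Prop := GeneratingTriple {
  cone_open : open Gam;
  cone_dil : forall x (t : R), Gam x -> 0 < t -> Gam (t *: x);
  cone_capacity : (0 < sphere_capacity (usphere `\` Gam))%E;
  inner_open : open Om;
  inner_connected : connected Om;
  inner_bounded : bounded_set Om;
  inner_radius : 0 < r0;
  inner_cone : Om `&` eball r0 = Gam `&` eball r0;
  outer_open : open P;
  outer_unbounded : ~ bounded_set P;
  outer_radius : 0 < R0;
  outer_cone : P `&` eballC R0 = Gam `&` eballC R0
}.

Record cutoffs (r0 R0 : R) Phi phi : Prop := Cutoffs {
  cutoff_rapid_smooth : smooth Phi;
  cutoff_rapid1 : forall x, eballC (2 * R0) x -> Phi x = 1;
  cutoff_rapid0 : forall x, eball R0 x -> Phi x = 0;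
  cutoff_slow_smooth : smooth phi;
  cutoff_slow1 : forall x, eball (r0 / 2) x -> phi x = 1;
  cutoff_slow0 : forall x, eballC r0 x -> phi x = 0
}.

(* On the interface sphere of radius r0 (resp. eps * R0) this set is Om
   (resp. eps P), as required for it to be open for every generating triple:
   the cone is only related to Om and P off these spheres. Assigning the spheres
   to the cone instead could fill in slits of Om or of eps P contained in them.
   Both conventions agree when Om and P coincide with the cone up to the spheres
   (perturbed_domain_closed_annulus). *)
Definition perturbed_domain Gam Om P (r0 R0 eps : R) : set 'rV[R]_n :=
  (Om `\` eball r0) `|` (Gam `&` annulus (eps * R0) r0)
  `|` (dilset eps P `&` closure (eball (eps * R0))).

Lemma enormZ (t : R) (x : 'rV[R]_n) : enorm (t *: x) = `|t| * enorm x.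
Proof.
rewrite /enorm -sqrtr_sqr -sqrtrM ?sqr_ge0// mulr_sumr; congr Num.sqrt.
by apply: eq_bigr => i _; rewrite mxE exprMn.
Qed.

Lemma enorm_ge0 (x : 'rV[R]_n) : 0 <= enorm x.
Proof. exact: sqrtr_ge0. Qed.

Lemma enorm_continuous : continuous (@enorm R n).
Proof.
move=> x; apply: (@continuous_comp _ _ _ _ Num.sqrt); last exact: sqrt_continuous.
move: x; apply: (@continuous_big R 'I_n +%R 0 xpredT _ 'rV[R]_n
  (index_enum 'I_n) (fun i (y : 'rV[R]_n) => y ord0 i ^+ 2)) => [|i _ x].
  exact: add_continuous.
apply: (@continuous_comp _ _ _ (fun y : 'rV[R]_n => y ord0 i)
  (fun t : R => t ^+ 2)); first exact: coord_continuous.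
exact: exprn_continuous.
Qed.

Lemma closure_eball (r : R) : 0 < r ->
  closure (@eball R n r) = [set x | enorm x <= r].
Proof.
move=> r_gt0; apply/seteqP; split.
  rewrite closureE; apply: smallest_sub; last by move=> x /ltW.
  apply: (preimage_closed (D := [set t : R | t <= r])); last exact: closed_le.
  by move=> x _; exact: enorm_continuous.
move=> x /= xr B xB.
have /(_ B xB)/nbhs_ballP[d /= d_gt0 dB] : (fun t : R => t *: x) @ (1 : R) --> x.
  rewrite -[X in _ --> X]scale1r.
  exact: cvgZr_tmp cvg_id.
pose t := 1 - Num.min (d / 2) (1 / 2).
have m0 : 0 < Num.min (d / 2) (1 / 2) by rewrite lt_min !divr_gt0.
have m1 : Num.min (d / 2) (1 / 2) < 1.
  by rewrite gt_min; apply/orP; right; rewrite ltr_pdivrMr// mul1r ltr1n.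
exists (t *: x); split; last first.
  apply: dB; rewrite /ball /= /t opprB addrC subrK gtr0_norm//.
  by rewrite gt_min ltr_pdivrMr// ltr_pMr// ltr1n.
rewrite /eball /= enormZ gtr0_norm ?subr_gt0//.
apply: (@le_lt_trans _ _ (t * r)).
  by rewrite ler_wpM2l// subr_ge0 ltW.
by rewrite gtr_pMl// ltrBlDr ltrDl.
Qed.

Lemma eballCE (r : R) : 0 < r -> @eballC R n r = [set x | r < enorm x].
Proof.
move=> r_gt0; rewrite /eballC closure_eball//; apply/seteqP; split => x /=.
  by move/negP; rewrite -ltNge.
by move=> rx; apply/negP; rewrite -ltNge.
Qed.

Lemma sub_closure_annulus (a b : R) : 0 < a ->
  closure (@annulus R n a b) `<=` [set x | a <= enorm x <= b].
Proof.
move=> a_gt0; rewrite closureE; apply: smallest_sub; last first.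
  by move=> x; rewrite /annulus eballCE// => -[/ltW + /ltW]/= => -> ->.
rewrite (_ : [set x | _] = (@enorm R n) @^-1` [set t | a <= t <= b]) //.
apply: preimage_closed; first by move=> x _; exact: enorm_continuous.
rewrite (_ : [set t | _] = [set t | a <= t] `&` [set t | t <= b]).
  by apply: closedI; [exact: closed_ge|exact: closed_le].
by apply/seteqP; split => t /= /andP.
Qed.

Lemma dilsetE eps P x : 0 < eps -> dilset eps P x <-> P (eps^-1 *: x).
Proof.
move=> eps_gt0; split => [[y Py <-]|Px].
  by rewrite scalerA mulVf ?gt_eqF// scale1r.
by exists (eps^-1 *: x) => //; rewrite scalerA divff ?gt_eqF// scale1r.
Qed.

Lemma perturbed_domainE Gam Om P (r0 R0 : R) eps :
    0 < eps -> 0 < R0 -> eps * R0 < r0 ->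
  let D := perturbed_domain Gam Om P r0 R0 eps in
  [/\ D `&` eballC r0 = Om `&` eballC r0,
      D `&` annulus (eps * R0) r0 = Gam `&` annulus (eps * R0) r0
    & D `&` eball (eps * R0) = dilset eps P `&` eball (eps * R0)].
Proof.
move=> eps_gt0 R0_gt0 epsr /=.
have a_gt0 : 0 < eps * R0 by rewrite mulr_gt0.
have r_gt0 : 0 < r0 := lt_trans a_gt0 epsr.
rewrite /perturbed_domain /annulus !eballCE// closure_eball// /eball.
split; apply/seteqP; split => x /=.
- move=> [[[[Ox _]|[_ [_ xr]]]|[_ xa]] rx] //.
  + by rewrite ltNge ltW in xr.
  + by have := lt_le_trans (lt_trans epsr rx) xa; rewrite ltxx.
- move=> [Ox rx]; split => //; left; left; split => //.
  by apply/negP; rewrite -leNgt ltW.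
- move=> [[[[_ /negP rx]|[]//]|[_ xa]] [ax xr]] //.
  by rewrite ltNge xa in ax.
- by move=> [Gx axr]; split => //; left; right.
- move=> [[[[_ /negP rx]|[_ [ax _]]]|[]//] xa].
  + by have := lt_trans xa epsr; rewrite (negPf rx).
  + by rewrite ltNge ltW in ax.
- by move=> [Px xa]; split => //; right; split => //; exact: ltW.
Qed.

Lemma perturbed_domain_closed_annulus Gam Om P (r0 R0 : R) eps :
    0 < eps -> 0 < R0 -> eps * R0 < r0 ->
    (forall x (t : R), Gam x -> 0 < t -> Gam (t *: x)) ->
    (forall x, enorm x = r0 -> Om x <-> Gam x) ->
    (forall x, enorm x = R0 -> P x <-> Gam x) ->
  perturbed_domain Gam Om P r0 R0 eps `&` closure (annulus (eps * R0) r0) =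
  Gam `&` closure (annulus (eps * R0) r0).
Proof.
move=> eps_gt0 R0_gt0 epsr GamZ OmGam PGam.
have a_gt0 : 0 < eps * R0 by rewrite mulr_gt0.
apply/seteqP.
suff E x : eps * R0 <= enorm x <= r0 ->
    perturbed_domain Gam Om P r0 R0 eps x <-> Gam x.
  by split => x [Dx Ax]; split => //; apply/E => //; exact: sub_closure_annulus.
rewrite /perturbed_domain /annulus eballCE// closure_eball// /eball.
move=> /andP[]; rewrite le_eqVlt => /predU1P[ax _|ax].
  have DG : dilset eps P x <-> Gam x.
    rewrite dilsetE// PGam; last first.
      by rewrite enormZ gtr0_norm ?invr_gt0// -ax mulrA mulVf ?mul1r// gt_eqF.
    split => [/GamZ/(_ eps_gt0)|/GamZ]; last by apply; rewrite invr_gt0.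
    by rewrite scalerA divff ?gt_eqF// scale1r.
  split => [[[[_]|[_ []]]|[/DG//]]|/DG Px] /=.
  - by rewrite -ax epsr.
  - by rewrite -ax ltxx.
  - by right; split => //=; rewrite ax.
rewrite le_eqVlt => /predU1P[xr|xr].
  have OG := OmGam x xr.
  split => [[[[/OG//]|[]//]|[_ /=]]|Gx].
  - by rewrite leNgt ax.
  - by left; left; split; [exact/OG|rewrite /= xr ltxx].
split => [[[[_ /=]|[]//]|[_ /=]]|Gx].
- by rewrite xr.
- by rewrite leNgt ax.
- by left; right.
Qed.

Definition F_inner Om (r0 : R) f : Prop :=
  in_L2 Om f /\ {ae mu, forall x, Om x -> eball (r0 / 2) x -> f x = 0}.
Definition F_outer P (R0 : R) f : Prop :=
  in_L2 P f /\ {ae mu, forall x, P x -> eballC (2 * R0) x -> f x = 0}.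

Definition E_inner Om (r0 : R) u : Prop :=
  H10 Om u /\ exists2 g, F_inner Om r0 g & is_weak_laplacian Om u g.
Definition E_outer P (R0 : R) u : Prop :=
  H1w0 P u /\ exists2 g, F_outer P R0 g & is_weak_laplacian P u g.

Definition M_inner_inner Om u : 'rV[R]_n -> R := weak_laplacian Om u.
Definition M_outer_outer P u : 'rV[R]_n -> R := weak_laplacian P u.
Definition M_inner_outer P phi eps u : 'rV[R]_n -> R :=
  laplacian_commutator (dilset eps P) phi (dil eps u).
Definition M_outer_inner Om Phi eps u : 'rV[R]_n -> R :=
  laplacian_commutator (dilset eps^-1 Om) Phi (dil eps^-1 u).

Definition block_operator Om P Phi phi eps
    (p : ('rV[R]_n -> R) * ('rV[R]_n -> R)) :
    ('rV[R]_n -> R) * ('rV[R]_n -> R) :=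
  (M_inner_inner Om p.1 \+ M_inner_outer P phi eps p.2,
   M_outer_inner Om Phi eps p.1 \+ M_outer_outer P p.2).

Definition glued_function Om P Phi phi eps (p : ('rV[R]_n -> R) * ('rV[R]_n -> R)) :
    'rV[R]_n -> R :=
  fun x => dil eps Phi x * (p.1 \_ Om) x + phi x * dil eps (p.2 \_ P) x.

Definition perturbed_rhs Om P Phi phi eps f F : 'rV[R]_n -> R :=
  fun x => dil eps Phi x * (f \_ Om) x
           + eps ^- 2 * (phi x * dil eps (F \_ P) x).

Definition perturbed_solution Gam Om P (r0 R0 : R) Phi phi eps f F u : Prop :=
  let V := perturbed_domain Gam Om P r0 R0 eps in
  H10 V u /\ is_weak_laplacian V u (perturbed_rhs Om P Phi phi eps f F).

End perforation.

(* Main.v *)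
Require Import Defs.
From mathcomp Require Import all_boot all_order all_algebra.
From mathcomp Require Import all_classical all_reals all_analysis.
From mathcomp Require Import measurable_realfun ring lra.

(* Put a = eps R0 and let Phi_eps, U_eps be the dilates of Phi, U. The part of
   Omeps where |x| >= a lies in Om, and the part where |x| <= r0 lies in eps P.
   As Phi_eps = 0 for |x| < a and phi = 0 for |x| > r0, multiplication by
   Phi_eps (by phi) turns test functions on Omeps into test functions on Om (on
   eps P), so that the Leibniz rule holds weakly and, on Omeps,
     Delta w = Phi_eps Delta u + [Delta, Phi_eps] u
               + phi Delta U_eps + [Delta, phi] U_eps.
   Since 4 a <= r0, Phi_eps = 1 on the support of [Delta, phi] U_eps and phi = 1
   on that of [Delta, Phi_eps] u, and the two block equations give the
   right-hand side. The weak gradients selected by xget in the commutators are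
   used as they are, so that uniqueness of weak derivatives plays no role.
   Uniqueness of the solution is the energy identity together with Poincare's
   inequality, which follows from integrating d_0 (x_0 eta^2) over the space. *)

Set Implicit Arguments.
Unset Strict Implicit.
Unset Printing Implicit Defensive.

Import Order.TTheory GRing.Theory Num.Theory.
Import numFieldNormedType.Exports.

Local Open Scope classical_set_scope.
Local Open Scope ring_scope.

(** * Lebesgue measure on row vectors *)

(** The delicate claim is that $w$ lies in $H^1_0(\Omega_\varepsilon)$. On the spheres $|x|=a$ and
    $|x|=r_0$ the three open sets are related by inclusions in one direction only, and the supports
    of the cutoffs may reach these spheres. The available inclusions suffice to transplant test
    functions from [Omeps], as the weak equation requires. Approximating $w$ goes the other way,
    from [Om] or [eps P] to [Omeps], and needs strict room; replacing a cutoff by its dilate of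
    ratio $s$ close to $1$ creates that room at an $H^1$ cost that tends to $0$. The factor $4$
    separates the shells $a<|x|<2a$ and $r_0/2<|x|<r_0$ that carry the commutators. In these open
    shells [Om] and [eps P] both coincide with the cone, so both block equations are available
    there. The power $\varepsilon^{-2}$ comes from $\Delta_x=\varepsilon^{-2}\Delta_X$. For fixed
    $\varepsilon$ the weight is bounded below on $|x|\le r_0$, so truncation by [phi] leads from the
    weighted closure to the ordinary one. *)

Section lebesgue_rV_theory.
Variable (R : realType).

(** For [0 < q] this is an open ball of the sup norm, written coordinatewise so that it is visibly a
    finite intersection of generators of the coordinate sigma-algebra. *)
Definition rV_box n (c : 'rV[R]_n) (q : R) : set 'rV[R]_n :=
  [set x | forall i, `|x ord0 i - c ord0 i| < q].

Lemma measurable_rV_box n (c : 'rV[R]_n) q : measurable (rV_box c q).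
Proof.
rewrite (_ : rV_box c q = \big[setI/setT]_(i < n)
   ((@rV_coord R n i) @^-1` (ball (c ord0 i) q))).
  apply: bigsetI_measurable => i _.
  by have := @measurable_rV_coord R n i measurableT _ (measurable_ball (c ord0
    i) q);
    rewrite setTI.
rewrite -bigcap_seq; apply/seteqP; split => [x bx i _|x bx i].
  by rewrite /= /ball/= distrC; exact: bx.
by have := bx i; rewrite /= mem_index_enum => /(_ isT); rewrite /ball/= distrC.
Qed.

(** Second countability: cubes with rational centre and radius are countably many, which puts every
    open set into the sigma-algebra generated by the coordinates. *)
Lemma open_rV_bigcup n (U : set 'rV[R]_n) : open U ->
  U = \bigcup_(p in [set p : 'rV[rat]_n * rat |
        rV_box (map_mx ratr p.1) (ratr p.2) `<=` U])
      rV_box (map_mx ratr p.1) (ratr p.2).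
Proof.
move=> oU; apply/seteqP; split => [x Ux|x [p /= pU] /pU//].
have /nbhs_ballP[e /= e0 eU] : nbhs x U by exact: open_nbhs_nbhs.
(* The rational centre is within [q] of [x] and the cube has radius [q], so its points are within
   [2 * q < e] of [x]. *)
have [q /[!in_itv]/= /andP[q0 qe]] := rat_in_itvoo (divr_gt0 e0 (ltr0n R 2)).
have /choice[c cP] : forall i, exists c : rat, `|x ord0 i - ratr c| < ratr q.
  move=> i; have : x ord0 i - ratr q < x ord0 i + ratr q.
    by rewrite ltrD2l; lra.
  move=> /rat_in_itvoo[c /[!in_itv]/= /andP[c1 c2]].
  by exists c; rewrite ltr_norml; apply/andP; split; lra.
exists (\row_i c i, q) => /=; last first.
  by move=> i; rewrite !mxE; exact: cP.
move=> y yb; apply: eU; split => // i j; rewrite (ord1 i) /ball/=.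
have := yb j; have := cP j; rewrite !mxE => h1 h2.
have -> : x ord0 j - y ord0 j = (x ord0 j - ratr (c j)) - (y ord0 j - ratr (c
  j)).
  by ring.
by rewrite (le_lt_trans (ler_normB _ _))//; lra.
Qed.

Lemma open_rV_measurable n (U : set 'rV[R]_n) : open U -> measurable U.
Proof.
move=> /open_rV_bigcup ->; rewrite bigcup_mkcond.
apply: countable_bigcupT_measurable; first exact: countableP.
by move=> p; case: ifP => _ //; exact: measurable_rV_box.
Qed.

Lemma closed_rV_measurable n (C : set 'rV[R]_n) : closed C -> measurable C.
Proof.
by move=> /closed_openC/open_rV_measurable/measurableC; rewrite setCK.
Qed.

Lemma compact_rV_measurable n (K : set 'rV[R]_n) : compact K -> measurable K.
Proof.
move=> cK; apply: closed_rV_measurable; apply: compact_closed cK.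
exact: norm_hausdorff.
Qed.

Lemma continuous_rV_measurable n (f : 'rV[R]_n -> R) : continuous f ->
  measurable_fun setT f.
Proof.
move=> cf; apply: (measurability _ (RGenOpens.measurableE R)).
move=> _ [_ [a [b ->] <-]]; rewrite setTI; apply: open_rV_measurable.
by move/continuousP : cf; apply; exact: interval_open.
Qed.

Lemma rV_scale_measurable n (t : R) :
  measurable_fun setT (fun x : 'rV[R]_n => t *: x).
Proof.
apply/measurable_fun_rVP => i.
rewrite (_ : _ \o _ = fun x => t * (@rV_coord R n i x)).
  by apply: measurable_funM => //; exact: measurable_rV_coord.
by apply/funext => x; rewrite /rV_coord /= mxE.
Qed.

(** The pushforward under multiplication by [t], multiplied by [t], gives half-open intervals their
    length, and this determines Lebesgue measure. *)
Lemma lebesgue_measure_scale (t : R) : 0 < t ->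
  forall A, measurable A ->
  lebesgue_measure ((fun x : measurableTypeR R => t
    * x : measurableTypeR R) @^-1` A)
  = (t^-1%:E * lebesgue_measure A)%E.
Proof.
move=> t0 A mA.
have mt : measurable_fun [set: measurableTypeR R]
  (fun x : measurableTypeR R => t * x : measurableTypeR R).
  by apply: measurable_funM.
have t0' := ltW t0.
pose k := NngNum t0'.
rewrite [in RHS](@lebesgue_measure_unique R (mscale k
   (pushforward lebesgue_measure (fun x : measurableTypeR R => t
     * x : measurableTypeR R))))//.
  rewrite /mscale/= /pushforward muleA -EFinM mulVf ?gt_eqF// mul1e//.
move=> _ [[a b]] /= ab <-; rewrite /mscale /pushforward /=.
rewrite /pushforward; set X := _ @^-1` _;
  have -> : X = `]t^-1 * a, t^-1 * b]%classic.
  rewrite /X; apply/seteqP; split => x /=; rewrite !in_itv/= ![t^-1 * _]mulrC.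
    by rewrite ltr_pdivrMr// ler_pdivlMr// ![x * t]mulrC.
  by rewrite ltr_pdivrMr// ler_pdivlMr// ![x * t]mulrC.
rewrite !lebesgue_measure_itv/= !lte_fin ltr_pM2l ?invr_gt0//.
case: ifPn => _; last by rewrite mule0.
by rewrite -EFinD -EFinM -!mulrBr mulrA divff ?gt_eqF// mul1r.
Qed.

(** The induction produces $c=t^{-n}$. The value is left existential because a dilation multiplies
    both sides of a weak identity by the same positive constant. *)
Lemma lebesgue_rV_scale n (t : R) : 0 < t -> exists2 c : R, 0 < c &
  forall A : set 'rV[R]_n, measurable A ->
  lebesgue_rV R n ((fun x : 'rV[R]_n => t *: x) @^-1` A) = (c%:E
    * lebesgue_rV R n A)%E.
Proof.
move=> t0; elim: n => [|n [c c0 IH]].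
  exists 1 => // A mA; rewrite mul1e /= /dirac !indicE/=.
  congr ((nat_of_bool _)%:R%:E); apply/idP/idP; rewrite !inE /=.
    by rewrite scaler0.
  by rewrite scaler0.
exists (t^-1 * c); first by rewrite mulr_gt0// invr_gt0.
move=> A mA.
have mB : measurable (@rV_cons R n @^-1` A).
  by rewrite -[X in measurable X]setTI; exact: measurable_rV_cons.
set B := _ @^-1` A in mB.
have -> : lebesgue_rV R n.+1 A =
  (\int[lebesgue_measure]_s lebesgue_rV R n (xsection B s))%E by [].
(* The slice at [s] of the preimage is the preimage of the slice at [t * s]. The induction
   hypothesis deals with the slice; scaling on the line then deals with [s]. *)
transitivity (\int[@lebesgue_measure R]_s
    (c%:E * lebesgue_rV R n (xsection B (t * s)%R)))%E.
  apply: eq_integral => s _.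
  rewrite -IH; last exact: measurable_xsection.
  congr (lebesgue_rV R n _); apply/seteqP.
  have E y : t *: rV_cons (s, y) = rV_cons (t * s, t *: y).
    apply/rowP => i; have [j ->|->] := unliftP ord0 i.
      by rewrite !mxE liftK /= mxE.
    by rewrite !mxE unlift_none.
  split => y /=; rewrite /xsection /B/= !inE /=.
    by rewrite E.
  by rewrite E.
have mt : measurable_fun [set: measurableTypeR R]
  (fun x : measurableTypeR R => t * x : measurableTypeR R).
  by apply: measurable_funM.
have mx := measurable_fun_xsection (lebesgue_rV R n) mB.
rewrite ge0_integralZl//; last 2 first.
- exact: (measurableT_comp mx mt).
- by rewrite lee_fin ltW.
rewrite -(@ge0_integral_pushforward _ _ _ _ _ _ mt lebesgue_measure setT
  (fun s => lebesgue_rV R n (xsection B s)))//.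
have ti : 0 <= t^-1 by rewrite invr_ge0 ltW.
rewrite (eq_measure_integral (mscale (NngNum ti) lebesgue_measure)); last first.
  by move=> X mX _; exact: lebesgue_measure_scale.
rewrite ge0_integral_mscale//= muleA -EFinM [t^-1 * c]mulrC.
by [].
Qed.

Lemma rV_box0_finite n (r : R) : (lebesgue_rV R n (rV_box 0 r) < +oo)%E.
Proof.
elim: n => [|n IH]; first by rewrite /= /dirac ltry.
change ((@lebesgue_measure R \x lebesgue_rV R n)%E
  (@rV_cons R n @^-1` rV_box 0 r) < +oo)%E.
rewrite (_ : _ @^-1` _ = (ball 0 r : set (measurableTypeR R)) `*` rV_box 0 r).
  rewrite product_measure1E//;
    [|exact: measurable_ball|exact: measurable_rV_box].
  rewrite lte_mul_pinfty// ge0_fin_numE//.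
  suff : (lebesgue_measure (ball (0 : R)%R r) < +oo)%E by [].
  have [r0|r0] := leP 0 r; first by rewrite lebesgue_measure_ball// ltry.
  by rewrite (ball0 _ _).2 ?measure0// ltW.
apply/seteqP; split => [[a x] /= h|[a x] /= [h1 h2] i].
  split => /=; first by have := h ord0; rewrite !mxE unlift_none distrC.
  by move=> i; have := h (lift ord0 i); rewrite !mxE liftK.
have [j ->|->] := unliftP ord0 i; rewrite !mxE ?liftK ?unlift_none/=.
  by have := h2 j; rewrite mxE.
by move: h1; rewrite /ball/= distrC.
Qed.

Lemma bounded_rV_finite n (A : set 'rV[R]_n) : measurable A -> bounded_set A ->
  (lebesgue_rV R n A < +oo)%E.
Proof.
move=> mA [M [_ /(_ (M + 1))]]; rewrite ltrDl ltr01 => /(_ isT) AM.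
apply: le_lt_trans (rV_box0_finite n (M + 2)).
apply: le_measure; rewrite ?inE//; first exact: measurable_rV_box.
move=> x /AM /= xM i; rewrite mxE subr0.
apply: (@le_lt_trans _ _ (M + 1)); last by rewrite ltrD2l ltr1n.
apply: le_trans xM; rewrite [leRHS]/Num.norm/= mx_normrE.
by apply/bigmax_geP; right => /=; exists (ord0, i).
Qed.

Lemma compact_rV_finite n (K : set 'rV[R]_n) : compact K ->
  (lebesgue_rV R n K < +oo)%E.
Proof.
move=> cK; apply: bounded_rV_finite; first exact: compact_rV_measurable.
exact: compact_bounded.
Qed.

End lebesgue_rV_theory.

(** * Smooth functions *)

Section calculus.
Variables (R : realType) (n : nat).
Implicit Types (f g eta chi : 'rV[R]_n -> R) (V W C : set 'rV[R]_n).
Local Notation e_ i := (delta_mx ord0 i : 'rV[R]_n).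

Definition partially_derivable f :=
  continuous f /\ forall i x, derivable f x (e_ i).

(** [smooth] quantifies over words of partial derivatives, which the Leibniz rule does not respect:
    it turns one word into a sum of products. Smoothness up to a finite order is stable under sums
    and products by induction on the order. *)
Fixpoint smooth_upto k f : Prop :=
  partially_derivable f /\
  if k is k'.+1 then forall i, smooth_upto k' (partial i f) else True.

Lemma smooth_uptoP f : smooth f <-> forall k, smooth_upto k f.
Proof.
split.
  move=> + k; elim: k f => [|k IH] f sf; first by split=> //; exact: (sf [::]).
  split; first exact: (sf [::]).
  move=> i; apply: IH => s; have := sf (rcons s i).
  by rewrite foldr_rcons.
move=> + s; elim/last_ind: s f => [|s i IH] f sf.
  by have [] := sf 0%N.
rewrite foldr_rcons; apply: IH => k.
by have [_ /(_ i)] := sf k.+1.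
Qed.

Lemma smooth_continuous f : smooth f -> continuous f.
Proof. by move=> sf; have [] := sf [::]. Qed.

Lemma smooth_derivable f : smooth f -> forall i x, derivable f x (e_ i).
Proof. by move=> sf; have [] := sf [::]. Qed.

Lemma smooth_partial f i : smooth f -> smooth (partial i f).
Proof.
move=> sf; apply/smooth_uptoP => k.
by have /smooth_uptoP/(_ k.+1)[_] := sf; exact.
Qed.

Lemma partialD f g i : (forall x, derivable f x (e_ i)) ->
  (forall x, derivable g x (e_ i)) ->
  partial i (fun x => f x + g x) = fun x => partial i f x + partial i g x.
Proof. by move=> df dg; apply/funext => x; rewrite /partial [LHS]deriveD. Qed.

Lemma partialM f g i : (forall x, derivable f x (e_ i)) ->
  (forall x, derivable g x (e_ i)) ->
  partial i (fun x => f x * g x) =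
  fun x => f x * partial i g x + partial i f x * g x.
Proof.
move=> df dg; apply/funext => x; rewrite /partial [LHS]deriveM//.
by rewrite /GRing.scale/= [g x * _]mulrC.
Qed.

Lemma partial_cst c i : partial i (fun _ : 'rV[R]_n => c) = fun=> 0.
Proof. by apply/funext => x; rewrite /partial derive_cst. Qed.

Lemma smooth_uptoW k f : smooth_upto k.+1 f -> smooth_upto k f.
Proof.
elim: k f => [|k IH] f; first by case.
by move=> [df sf]; split=> // i; apply: IH.
Qed.

Lemma partially_derivable_cst c : partially_derivable (fun _ => c).
Proof. by split; [exact: cst_continuous|move=> i x; exact: derivable_cst]. Qed.

Lemma partially_derivableD f g : partially_derivable f ->
  partially_derivable g -> partially_derivable (fun x => f x + g x).
Proof.
move=> [cf df] [cg dg]; split=> [x|i x]; first exact: (cvgD (cf x) (cg x)).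
exact: derivableD.
Qed.

Lemma partially_derivableM f g : partially_derivable f ->
  partially_derivable g -> partially_derivable (fun x => f x * g x).
Proof.
move=> [cf df] [cg dg]; split=> [x|i x]; first exact: (cvgM (cf x) (cg x)).
exact: derivableM.
Qed.

Lemma smooth_upto_cst k c : smooth_upto k (fun _ => c).
Proof.
elim: k c => [|k IH] c; (split; first exact: partially_derivable_cst) => //.
by move=> i; rewrite partial_cst.
Qed.

Lemma smooth_uptoD k f g : smooth_upto k f -> smooth_upto k g ->
  smooth_upto k (fun x => f x + g x).
Proof.
elim: k f g => [|k IH] f g [pf sf] [pg sg];
  (split; first exact: (partially_derivableD pf pg)) => //.
move=> i; rewrite partialD; [|exact: pf.2|exact: pg.2].
by apply: IH; [exact: sf|exact: sg].
Qed.

Lemma smooth_uptoM k f g : smooth_upto k f -> smooth_upto k g ->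
  smooth_upto k (fun x => f x * g x).
Proof.
elim: k f g => [|k IH] f g sf sg; have [pf sf'] := sf; have [pg sg'] := sg;
  (split; first exact: (partially_derivableM pf pg)) => //.
move=> i; rewrite partialM; [|exact: pf.2|exact: pg.2].
(* Each Leibniz term pairs a derivative, of order [k], with an undifferentiated factor, lowered from
   [k.+1] to [k]. *)
by apply: smooth_uptoD; apply: IH;
  [exact: smooth_uptoW|exact: sg'|exact: sf'|exact: smooth_uptoW].
Qed.

Lemma smoothD f g : smooth f -> smooth g -> smooth (fun x => f x + g x).
Proof.
by move=> /smooth_uptoP sf /smooth_uptoP sg; apply/smooth_uptoP => k;
  exact: smooth_uptoD.
Qed.

Lemma smoothM f g : smooth f -> smooth g -> smooth (fun x => f x * g x).
Proof.
by move=> /smooth_uptoP sf /smooth_uptoP sg; apply/smooth_uptoP => k;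
  exact: smooth_uptoM.
Qed.

Lemma smooth_cst c : smooth (fun _ : 'rV[R]_n => c).
Proof. by apply/smooth_uptoP => k; exact: smooth_upto_cst. Qed.

Lemma smooth_sum (I : Type) (s : seq I) (F : I -> 'rV[R]_n -> R) :
  (forall i, smooth (F i)) -> smooth (fun x => \sum_(i <- s) F i x).
Proof.
move=> sF; elim: s => [|i s IH].
  have -> : (fun x => \sum_(i <- [::]) F i x) = (fun=> 0).
    by apply/funext => x; rewrite big_nil.
  exact: smooth_cst.
have -> : (fun x => \sum_(j <- i :: s) F j x) =
    (fun x => F i x + \sum_(j <- s) F j x).
  by apply/funext => x; rewrite big_cons.
exact: (smoothD (sF i) IH).
Qed.

Lemma smooth_laplacian f : smooth f -> smooth (laplacian f).
Proof. by move=> sf; apply: smooth_sum => i; do 2 apply: smooth_partial. Qed.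

Lemma laplacianM f g : smooth f -> smooth g ->
  laplacian (fun x => f x * g x) = fun x =>
  f x * laplacian g x + 2 * (\sum_(i < n) partial i f x * partial i g x)
  + laplacian f x * g x.
Proof.
move=> sf sg; apply/funext => x;
  rewrite /laplacian mulr_sumr mulr_suml mulr_sumr.
rewrite -!big_split/=; apply: eq_bigr => i _.
rewrite partialM; [|exact: smooth_derivable..].
have df := smooth_derivable (smooth_partial i sf).
have dg := smooth_derivable (smooth_partial i sg).
have df' := smooth_derivable sf; have dg' := smooth_derivable sg.
rewrite partialD; [|by move=> y; apply: derivableM..].
by rewrite (partialM (df' i) (dg i)) (partialM (df i)
  (dg' i)) mulr_natl mulr2n !addrA.
Qed.

(** Only a directional derivative is given, so the chain rule is read off difference quotients: the
    one of [dil t f] at [x] with step [h] is [t^-1] times the one of [f] at [t^-1 *: x] with step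
    [t^-1 * h]. *)
Lemma is_derive_dil t f x v df : 0 < t -> is_derive (t^-1 *: x) v f df ->
  is_derive x v (dil t f) (t^-1 * df).
Proof.
move=> t0 [fav <-].
have s0 : 0 < t^-1 by rewrite invr_gt0.
pose q := fun h : R => h^-1 *: ((f \o shift (t^-1 *: x))
  (h *: v) - f (t^-1 *: x)).
have qc : q @ 0^' --> 'D_v f (t^-1 *: x) by [].
suff H : (fun h => h^-1 *: ((dil t f \o shift x)
  (h *: v) - dil t f x)) @ 0^' -->
   t^-1 * 'D_v f (t^-1 *: x).
  by apply: DeriveDef; [apply/cvg_ex; eexists; exact: H|exact/cvg_lim].
have -> : (fun h : R => h^-1 *: ((dil t f \o shift x) (h *: v) - dil t f x)) =
   (fun h => t^-1 * q (t^-1 * h)).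
  apply/funext => h; rewrite /q /dil /= [in LHS](scalerDr t^-1)
    (scalerA t^-1 h).
  rewrite [in RHS]/GRing.scale/= mulrA; congr (_ * _).
  by rewrite invfM mulrA divff ?gt_eqF// mul1r.
apply: cvgM; first exact: cvg_cst.
apply: cvg_comp qc.
move=> A /= [d d0 dA]; exists (d * t); first by rewrite /= mulr_gt0.
move=> h /= hd h0; apply: dA => /=.
  rewrite !sub0r !normrN in hd *;
    rewrite normrM gtr0_norm// mulrC ltr_pdivrMr//.
by rewrite mulf_neq0// gt_eqF.
Qed.

Lemma partial_dil t f i : 0 < t -> (forall x, derivable f x (e_ i)) ->
  partial i (dil t f) = fun x => t^-1 * dil t (partial i f) x.
Proof.
move=> t0 df; apply/funext => x; rewrite /partial.
have H : is_derive (t^-1 *: x)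
  (e_ i) f ('D_(e_ i) f (t^-1 *: x)) by exact: derivableP.
by have [_ ->] := is_derive_dil t0 H.
Qed.

Lemma continuous_dil t f : continuous f -> continuous (dil t f).
Proof.
move=> cf x; rewrite /dil.
apply: (@continuous_comp _ _ _ (fun x : 'rV[R]_n => t^-1 *: x) f);
  last exact: cf.
exact: scaler_continuous.
Qed.

Lemma partially_derivable_dil t f : 0 < t ->
  partially_derivable f -> partially_derivable (dil t f).
Proof.
move=> t0 [cf df]; split; first exact: continuous_dil.
by move=> i x; have [] := is_derive_dil t0 (derivableP (df i (t^-1 *: x))).
Qed.

Lemma smooth_dil t f : 0 < t -> smooth f -> smooth (dil t f).
Proof.
move=> t0 /smooth_uptoP sf; apply/smooth_uptoP => k; move: (sf k) => {sf}.
elim: k f => [|k IH] f [pf sf]; (split;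
  first exact: (partially_derivable_dil t0 pf)) => //.
move=> i; rewrite partial_dil//; last exact: pf.2.
by apply: smooth_uptoM; [exact: smooth_upto_cst|exact/IH/sf].
Qed.

Lemma laplacian_dil t f : 0 < t -> smooth f ->
  laplacian (dil t f) = fun x => t ^- 2 * dil t (laplacian f) x.
Proof.
move=> t0 sf; apply/funext => x; rewrite /laplacian /dil mulr_sumr.
apply: eq_bigr => i _; rewrite -/(dil t f) partial_dil//;
  last exact: smooth_derivable.
have sd := smooth_dil t0 (smooth_partial i sf).
rewrite (partialM (f := fun=> t^-1)); last 2 first.
  by move=> y; exact: derivable_cst.
  exact: smooth_derivable.
rewrite partial_cst mul0r addr0 partial_dil//;
  last exact/smooth_derivable/smooth_partial.
by rewrite mulrA -expr2 exprVn.
Qed.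

End calculus.

(** * Test functions and local integrability *)

Section test_functions.
Variables (R : realType) (n : nat).
Implicit Types (f g eta chi psi u : 'rV[R]_n -> R) (V W C : set 'rV[R]_n).
Local Notation e_ i := (delta_mx ord0 i : 'rV[R]_n).

Definition tsupp f : set 'rV[R]_n := closure [set x | f x != 0].

(** This is what the integrability of a pairing with a locally integrable function rests on. It
    covers, besides test functions, the products and sums that the Leibniz rule creates. *)
Definition continuous_test V psi :=
  [/\ continuous psi, compact (tsupp psi) & tsupp psi `<=` V].

Lemma tsupp0 f x : ~ tsupp f x -> f x = 0.
Proof.
by move=> fx; apply/eqP/negPn/negP => /= ?; apply: fx; exact: subset_closure.
Qed.

Lemma partial_eq_cst f (c : R) U i : open U -> (forall x, U x -> f x = c) ->
  forall x, U x -> partial i f x = 0.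
Proof.
move=> oU fU x Ux; rewrite /partial (@near_eq_derive _ _ _ f (cst c)).
  exact: derive_cst.
by have := open_nbhs_nbhs (conj oU Ux); apply: filterS => y /fU.
Qed.

Lemma tsupp_subset f g : (forall x, f x = 0 -> g x = 0) ->
  tsupp g `<=` tsupp f.
Proof.
by move=> fg; apply: closure_subset => x /=; apply: contra => /eqP/fg/eqP.
Qed.

Lemma open_tsuppC f : open (~` tsupp f).
Proof. exact/closed_openC/closed_closure. Qed.

Lemma tsupp_partial f i : tsupp (partial i f) `<=` tsupp f.
Proof.
rewrite [X in _ `<=` X](closure_id _).1; last exact: closed_closure.
apply: closure_subset => x /= /eqP px; apply: contrapT => fx; apply: px.
by apply: (partial_eq_cst _ (@open_tsuppC f)) => // y; exact: tsupp0.
Qed.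

Lemma tsupp_laplacian f : tsupp (laplacian f) `<=` tsupp f.
Proof.
rewrite [X in _ `<=` X](closure_id _).1; last exact: closed_closure.
apply: closure_subset => x /= /eqP px; apply: contrapT => fx; apply: px.
rewrite /laplacian big1// => i _.
apply: (partial_eq_cst _ (@open_tsuppC f)) => // y fy.
by apply: (partial_eq_cst _ (@open_tsuppC f)) => // z; exact: tsupp0.
Qed.

Lemma continuous_test_sub V psi f : continuous_test V psi -> continuous f ->
  tsupp f `<=` tsupp psi -> continuous_test V f.
Proof.
move=> [cpsi kpsi psiV] cf fpsi; split => //; last exact: subset_trans psiV.
by apply: subclosed_compact kpsi fpsi; exact: closed_closure.
Qed.

Lemma test_function_continuous V eta :
  test_function V eta -> continuous_test V eta.
Proof. by move=> [/smooth_continuous ? ? ?]; split. Qed.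

Lemma test_function_sub V eta f : test_function V eta -> smooth f ->
  tsupp f `<=` tsupp eta -> test_function V f.
Proof.
move=> te sf fe; have := test_function_continuous te.
by move=> /continuous_test_sub/(_ (smooth_continuous sf) fe)[_ ? ?]; split.
Qed.

Lemma test_function_partial V eta i :
  test_function V eta -> test_function V (partial i eta).
Proof.
move=> te; apply: (test_function_sub te); last exact: tsupp_partial.
by case: te => + _ _; exact: smooth_partial.
Qed.

Lemma test_function_laplacian V eta :
  test_function V eta -> test_function V (laplacian eta).
Proof.
move=> te; apply: (test_function_sub te); last exact: tsupp_laplacian.
by case: te => + _ _; exact: smooth_laplacian.
Qed.

Lemma tsuppMr chi eta : tsupp (fun x => chi x * eta x) `<=` tsupp eta.
Proof. by apply: tsupp_subset => x ->; rewrite mulr0. Qed.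

Lemma tsuppMl C chi eta : closed C -> (forall x, ~ C x -> chi x = 0) ->
  tsupp (fun x => chi x * eta x) `<=` C.
Proof.
move=> cC chi0; rewrite [X in _ `<=` X](closure_id _).1//;
  apply: closure_subset => x /= /eqP cx.
by apply: contrapT => /chi0 c0; apply: cx; rewrite c0 mul0r.
Qed.

Lemma continuous_testM V psi chi : continuous chi -> continuous_test V psi ->
  continuous_test V (fun x => chi x * psi x).
Proof.
move=> cchi tpsi; apply: (continuous_test_sub tpsi); last exact: tsuppMr.
by move=> x; case: tpsi => cpsi _ _; exact: (cvgM (cchi x) (cpsi x)).
Qed.

Lemma continuous_testD V psi eta : continuous_test V psi ->
  continuous_test V eta -> continuous_test V (fun x => psi x + eta x).
Proof.
move=> [cpsi kpsi psiV] [ceta keta etaV].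
have sub : tsupp (fun x => psi x + eta x) `<=` tsupp psi `|` tsupp eta.
  rewrite -closureU; apply: closure_subset => x /=.
  have [->|] := eqVneq (psi x) 0; last by left.
  by rewrite add0r; right.
split; first by move=> x; exact: (cvgD (cpsi x) (ceta x)).
  have ce : closed (tsupp (fun x => psi x + eta x)) by exact: closed_closure.
  exact: (subclosed_compact ce (compactU kpsi keta) sub).
by move=> x /sub[/psiV|/etaV].
Qed.

Lemma continuous_test0 V : continuous_test V (fun=> 0).
Proof.
have -> : continuous_test V (fun=> 0) = continuous_test V (cst 0) by [].
have e : tsupp (cst 0) = set0.
  rewrite /tsupp (_ : [set x | _] = set0) ?closure0//.
  by apply/seteqP; split => x //=; rewrite eqxx.
by split; rewrite ?e//; [exact: cst_continuous|exact: compact0].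
Qed.

Lemma continuous_test_sum V (I : Type) (s : seq I) (F : I -> 'rV[R]_n -> R) :
  (forall i, continuous_test V (F i)) ->
  continuous_test V (fun x => \sum_(i <- s) F i x).
Proof.
move=> tF; elim: s => [|i s IH].
  rewrite (_ : (fun x => _) = (fun=> 0)); first exact: continuous_test0.
  by apply/funext => x; rewrite big_nil.
rewrite (_ : (fun x => _) = (fun x => F i x + \sum_(j <- s) F j x)).
  exact: continuous_testD.
by apply/funext => x; rewrite big_cons.
Qed.

(** Since [C] is closed, it contains the whole topological support of [chi * eta]. That support is
    therefore a compact subset of [V] and of [C], hence of [W]. *)
Lemma test_functionM V C W chi eta : smooth chi -> test_function V eta ->
  closed C -> (forall x, ~ C x -> chi x = 0) -> V `&` C `<=` W ->
  test_function W (fun x => chi x * eta x).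
Proof.
move=> schi te cC chi0 VCW.
have [s k b] : test_function V (fun x => chi x * eta x).
  apply: (test_function_sub te); last exact: tsuppMr.
  by apply: smoothM => //; case: te.
by split=> // x x0; apply: VCW; split;
  [exact: b|exact: (@tsuppMl C chi eta cC chi0 x x0)].
Qed.

Lemma dilset_preimage t V : 0 < t -> dilset t V = (fun x => t^-1 *: x) @^-1` V.
Proof. by move=> t0; apply/seteqP; split => x /(dilsetE _ _ t0). Qed.

Lemma dilK t f : t != 0 -> dil t (dil t^-1 f) = f.
Proof.
by move=> t0; apply/funext => x; rewrite /dil invrK scalerA divff// scale1r.
Qed.

Lemma dilsetK t V : t != 0 -> dilset t (dilset t^-1 V) = V.
Proof.
move=> t0; apply/seteqP; split => [_ [_ [x Vx <-] <-]|x Vx].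
  by rewrite scalerA divff// scale1r.
exists (t^-1 *: x); first by exists x.
by rewrite scalerA divff// scale1r.
Qed.

Lemma open_dilset t V : 0 < t -> open V -> open (dilset t V).
Proof.
move=> t0 oV; rewrite dilset_preimage//.
by apply: open_comp oV => x _; exact: scaler_continuous.
Qed.

Lemma compact_dilset t (K : set 'rV[R]_n) : compact K -> compact (dilset t K).
Proof.
move=> cK; apply: continuous_compact cK; apply: continuous_subspaceT => x.
exact: scaler_continuous.
Qed.

Lemma test_function_dil t V eta : 0 < t -> test_function V eta ->
  test_function (dilset t V) (dil t eta).
Proof.
move=> t0 [seta keta etaV].
have sub : tsupp (dil t eta) `<=` dilset t (tsupp eta).
  move: (@scaler_continuous R 'rV[R]_n t^-1) => ct.
  rewrite dilset_preimage// [X in _ `<=` X](closure_id _).1.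
    by apply: closure_subset => x /= ex; exact: subset_closure.
  by apply: preimage_closed; [move=> x _; exact: ct|exact: closed_closure].
split; first exact: smooth_dil.
  have ce : closed (tsupp (dil t eta)) by exact: closed_closure.
  exact: (subclosed_compact ce (compact_dilset keta) sub).
by move=> x /sub[y /etaV Vy <-]; exists y.
Qed.

End test_functions.

Section local_integrability.
Variables (R : realType) (n : nat).
Local Notation mu := (lebesgue_rV R n).
Implicit Types (f g eta chi psi u : 'rV[R]_n -> R) (V W C : set 'rV[R]_n).

Lemma smooth_measurable V f : smooth f -> measurable_fun V f.
Proof.
by move=> sf; apply: measurable_funTS;
  exact: (continuous_rV_measurable (smooth_continuous sf)).
Qed.

Lemma bounded_continuous_compact psi K : continuous psi -> compact K ->
  [bounded psi x | x in K].
Proof.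
move=> cpsi cK.
have /compact_bounded[M [Mr HM]] : compact (psi @` K).
  by apply: continuous_compact cK; exact: continuous_subspaceT.
by exists M; split=> // y My x Kx /=; apply: (HM y My); exists x.
Qed.

(** On the compact support of [psi] the factor [psi] is bounded and [u] is integrable; off that
    support the product is zero, so the two extensions by zero coincide. *)
Lemma loc_integrable_integrableM V u psi : open V -> loc_integrable V u ->
  continuous_test V psi -> mu.-integrable V (EFin \o (fun x => u x * psi x)).
Proof.
move=> oV [mu_u iu] [cpsi kpsi psiV].
have mV := open_rV_measurable oV; have mK := compact_rV_measurable kpsi.
have iK : mu.-integrable (tsupp psi) (EFin \o (fun x => u x * psi x)).
  apply: (@integrableMl _ _ _ mu _ mK (EFin \o u) psi (iu _ psiV kpsi)).
    by apply: measurable_funTS; exact: continuous_rV_measurable.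
  exact: bounded_continuous_compact.
apply/(integrable_mkcond _ mV); move/(integrable_mkcond _ mK) : iK.
congr (integrable _ _ _); apply/funext => x; rewrite !patchE.
have [/set_mem xK|/negP xK] := boolP (x \in tsupp psi).
  by rewrite ifT// inE; exact: psiV.
by case: ifP => // _; rewrite /= (@tsupp0 _ _ psi x) ?mulr0// => ?; apply: xK;
  rewrite inE.
Qed.

Lemma loc_integrableD V u f : open V -> loc_integrable V u ->
  loc_integrable V f -> loc_integrable V (fun x => u x + f x).
Proof.
move=> oV [mu_u iu] [mf iff]; split; first exact: measurable_funD.
move=> K KV cK; have mK := compact_rV_measurable cK.
exact: (integrableD mK (iu K KV cK) (iff K KV cK)).
Qed.

Lemma loc_integrableM V u chi : open V -> continuous chi ->
  loc_integrable V u -> loc_integrable V (fun x => chi x * u x).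
Proof.
move=> oV cchi [mu_u iu]; split.
  apply: measurable_funM => //; apply: measurable_funTS.
  exact: continuous_rV_measurable.
move=> K KV cK; have mK := compact_rV_measurable cK.
apply: (integrableMr mK _ _ (iu K KV cK));
  last exact: bounded_continuous_compact.
by apply: measurable_funTS; exact: continuous_rV_measurable.
Qed.

Lemma loc_integrableZ V u c : open V -> loc_integrable V u ->
  loc_integrable V (fun x => c * u x).
Proof. by move=> oV; apply: loc_integrableM => //; exact: cst_continuous. Qed.

Lemma loc_integrable0 V : open V -> loc_integrable V (fun=> 0).
Proof. by move=> oV; split=> [|K KV cK];
  [exact: measurable_cst|exact: integrable0]. Qed.

Lemma loc_integrable_sum V (I : Type) (s : seq I) (F : I -> 'rV[R]_n -> R) :
  open V -> (forall i, loc_integrable V (F i)) ->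
  loc_integrable V (fun x => \sum_(i <- s) F i x).
Proof.
move=> oV iF; elim: s => [|i s IH].
  rewrite (_ : (fun x => _) = (fun=> 0)); first exact: loc_integrable0.
  by apply/funext => x; rewrite big_nil.
rewrite (_ : (fun x => _) = (fun x => F i x + \sum_(j <- s) F j x)).
  exact: loc_integrableD.
by apply/funext => x; rewrite big_cons.
Qed.

Lemma loc_integrable_ae V u f : open V -> ae_eq mu V u f ->
  measurable_fun V f -> loc_integrable V u -> loc_integrable V f.
Proof.
move=> oV uf mf [mu_u iu]; split=> // K KV cK.
have mK := compact_rV_measurable cK.
have /integrableP[_ iuK] := iu K KV cK.
have mV := open_rV_measurable oV.
apply/integrableP; split.
  by apply/measurable_EFinP; exact: measurable_funS mf.
rewrite (_ : (\int[mu]_(x in K) _)%E = (\int[mu]_(x in K) `|(EFin \o u)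
  x|)%E)//.
apply: ge0_ae_eq_integral => //.
- by do 2 apply: measurableT_comp => //; exact: measurable_funS mf.
- by do 2 apply: measurableT_comp => //; exact: measurable_funS mu_u.
- move: uf; apply: filterS => x uf Kx /=; rewrite uf//; exact: KV.
Qed.

(** Compact sets have finite measure and [|f| <= 1 + f ^+ 2]. *)
Lemma in_L2_loc_integrable V f : open V -> in_L2 V f -> loc_integrable V f.
Proof.
move=> oV [mf f2]; split=> // K KV cK.
have mK := compact_rV_measurable cK; have mV := open_rV_measurable oV.
have mfK : measurable_fun K f by exact: measurable_funS mf.
apply: (@le_integrable _ _ _ mu _ mK _ (EFin \o (fun x => 1 + f x ^+ 2))).
- exact/measurable_EFinP.
- move=> x Kx; rewrite /= lee_fin [leRHS]ger0_norm;
    last by rewrite addr_ge0// sqr_ge0.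
  have := sqr_ge0 (`|f x| - 1);
    have : `|f x| ^+ 2 = f x ^+ 2 by exact: real_normK (num_real _).
  have := sqr_ge0 (f x); lra.
apply: (@integrableD _ _ _ mu K mK (EFin \o cst 1) (fun x => (f x ^+ 2)%:E)).
  apply: measurable_bounded_integrable => //; first exact: compact_rV_finite.
  by apply: bounded_continuous_compact => //; exact: cst_continuous.
apply/integrableP; split; first by apply/measurable_EFinP;
  exact: measurable_funX.
under eq_integral do rewrite /= ger0_norm ?sqr_ge0//.
apply: le_lt_trans f2; apply: ge0_subset_integral => //.
  by apply/measurable_EFinP; exact: measurable_funX.
by move=> x _; rewrite lee_fin sqr_ge0.
Qed.

(** For [K] compact in [V], the set [K] intersected with [C] is compact and lies in [W], where
    [chi * u] is integrable; on the rest of [K] the integrand vanishes. *)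
Lemma loc_integrable_cutoff V W C u chi : open V -> open W -> closed C ->
  continuous chi -> (forall x, ~ C x -> chi x = 0) -> V `&` C `<=` W ->
  loc_integrable W u -> loc_integrable V ((fun x => chi x * u x) \_ W).
Proof.
move=> oV oW cC cchi chi0 VCW iu.
have mV := open_rV_measurable oV; have mW := open_rV_measurable oW.
have [mcu icu] := loc_integrableM oW cchi iu.
split.
  by apply: measurable_funTS; apply/(measurable_restrictT _ mW).
move=> K KV cK.
have cKC : compact (K `&` C) by apply: compact_closedI.
have KCW : K `&` C `<=` W by move=> x [/KV Vx Cx]; exact: VCW.
have mK := compact_rV_measurable cK; have mKC := compact_rV_measurable cKC.
have := icu _ KCW cKC.
move/(integrable_mkcond _ mKC) => i; apply/(integrable_mkcond _ mK).
move: i; congr (integrable _ _ _); apply/funext => x; rewrite !patchE.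
have [/set_mem[Kx Cx]|/negP xKC] := boolP (x \in K `&` C).
  by rewrite ifT ?inE//= patchE ifT// inE; apply: KCW.
case: ifP => // /set_mem Kx; rewrite /= patchE; case: ifP => // _.
by rewrite chi0 ?mul0r// => Cx; apply: xKC; rewrite inE.
Qed.

End local_integrability.

(** * Weak derivatives *)

Section weak_derivatives.
Variables (R : realType) (n : nat).
Local Notation mu := (lebesgue_rV R n).
Implicit Types (f g eta chi psi u v : 'rV[R]_n -> R) (V W C : set 'rV[R]_n)
  (Du Dv : 'I_n -> 'rV[R]_n -> R).

Lemma Rintegral_eq_restrict V W f g :
  (forall x, (f \_ V) x = (g \_ W) x) ->
  \int[mu]_(x in V) f x = \int[mu]_(x in W) g x.
Proof.
by move=> fg; rewrite Rintegral_mkcond [RHS]Rintegral_mkcond; congr Rintegral;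
  exact/funext.
Qed.

Lemma pairingD V u v psi : open V -> loc_integrable V u -> loc_integrable V v ->
  continuous_test V psi ->
  \int[mu]_(x in V) ((u x + v x) * psi x) =
  \int[mu]_(x in V) (u x * psi x) + \int[mu]_(x in V) (v x * psi x).
Proof.
move=> oV iu iv tpsi; have mV := open_rV_measurable oV.
rewrite -RintegralD//; [|exact: loc_integrable_integrableM..].
by congr Rintegral; apply/funext => x; rewrite mulrDl.
Qed.

Lemma pairingDr V u psi eta : open V -> loc_integrable V u ->
  continuous_test V psi -> continuous_test V eta ->
  \int[mu]_(x in V) (u x * (psi x + eta x)) =
  \int[mu]_(x in V) (u x * psi x) + \int[mu]_(x in V) (u x * eta x).
Proof.
move=> oV iu tpsi teta; have mV := open_rV_measurable oV.
rewrite -RintegralD//; [|exact: loc_integrable_integrableM..].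
by congr Rintegral; apply/funext => x; rewrite mulrDr.
Qed.

Lemma pairingZ V u psi c : open V -> loc_integrable V u ->
  continuous_test V psi ->
  \int[mu]_(x in V) ((c * u x) * psi x) = c * \int[mu]_(x in V) (u x * psi x).
Proof.
move=> oV iu tpsi; have mV := open_rV_measurable oV.
rewrite -RintegralZl//; last exact: loc_integrable_integrableM.
by congr Rintegral; apply/funext => x; rewrite mulrA.
Qed.

Lemma pairingZr V u psi c : open V -> loc_integrable V u ->
  continuous_test V psi ->
  \int[mu]_(x in V) (u x * (c * psi x)) = c * \int[mu]_(x in V) (u x * psi x).
Proof.
move=> oV iu tpsi; rewrite -pairingZ//.
by congr Rintegral; apply/funext => x; rewrite mulrCA mulrA.
Qed.

Lemma pairing_sum V (I : Type) (s : seq I) (F : I -> 'rV[R]_n -> R) psi :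
  open V -> (forall i, loc_integrable V (F i)) -> continuous_test V psi ->
  \int[mu]_(x in V) ((\sum_(i <- s) F i x) * psi x) =
  \sum_(i <- s) \int[mu]_(x in V) (F i x * psi x).
Proof.
move=> oV iF tpsi; elim: s => [|i s IH].
  rewrite big_nil -[RHS](mul0r (\int[mu]_(x in V) (0 * psi x))) -pairingZ//.
    by congr Rintegral; apply/funext => x; rewrite big_nil !mul0r.
  exact: loc_integrable0.
rewrite big_cons -IH -pairingD//; last exact: loc_integrable_sum.
by congr Rintegral; apply/funext => x; rewrite big_cons.
Qed.

Lemma pairing_sumr V u (I : Type) (s : seq I) (F : I -> 'rV[R]_n -> R) :
  open V -> loc_integrable V u -> (forall i, continuous_test V (F i)) ->
  \int[mu]_(x in V) (u x * \sum_(i <- s) F i x) =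
  \sum_(i <- s) \int[mu]_(x in V) (u x * F i x).
Proof.
move=> oV iu tF; elim: s => [|i s IH].
  rewrite big_nil; under eq_Rintegral do rewrite big_nil mulr0.
  by rewrite /Rintegral integral0.
rewrite big_cons -IH -pairingDr//; last exact: continuous_test_sum.
by congr Rintegral; apply/funext => x; rewrite big_cons.
Qed.

Lemma pairing_ae V u v psi : open V -> ae_eq mu V u v -> measurable_fun V u ->
  measurable_fun V v -> continuous psi ->
  \int[mu]_(x in V) (u x * psi x) = \int[mu]_(x in V) (v x * psi x).
Proof.
move=> oV uv mu_u mv cpsi; have mV := open_rV_measurable oV.
have mpsi : measurable_fun V psi.
  by apply: measurable_funTS; exact: continuous_rV_measurable.
congr fine; apply: ae_eq_integral => //.
- by apply/measurable_EFinP; exact: measurable_funM.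
- by apply/measurable_EFinP; exact: measurable_funM.
- by move: uv; apply: filterS => x uv /uv ->.
Qed.

Lemma is_weak_gradD V u v Du Dv c : open V -> is_weak_grad V u Du ->
  is_weak_grad V v Dv ->
  is_weak_grad V (fun x => u x + c * v x) (fun i x => Du i x + c * Dv i x).
Proof.
move=> oV [iu iDu uDu] [iv iDv vDv]; split.
- by apply: loc_integrableD => //; exact: loc_integrableZ.
- by move=> i; apply: loc_integrableD => //; exact: loc_integrableZ.
- move=> eta teta i; have tc := test_function_continuous teta.
  have tp := test_function_continuous (test_function_partial i teta).
  rewrite !pairingD//; [|exact: loc_integrableZ..].
  by rewrite !pairingZ// uDu// vDv// mulrN -opprD.
Qed.

Lemma is_weak_laplacianD V u v f g c : open V -> is_weak_laplacian V u f ->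
  is_weak_laplacian V v g ->
  is_weak_laplacian V (fun x => u x + c * v x) (fun x => f x + c * g x).
Proof.
move=> oV [iu iDu uDu] [iv iDv vDv]; split.
- by apply: loc_integrableD => //; exact: loc_integrableZ.
- by apply: loc_integrableD => //; exact: loc_integrableZ.
- move=> eta teta; have tc := test_function_continuous teta.
  have tp := test_function_continuous (test_function_laplacian teta).
  rewrite !pairingD//; [|exact: loc_integrableZ..].
  by rewrite !pairingZ// uDu// vDv.
Qed.

Lemma is_weak_laplacian_ae V u f g : open V -> ae_eq mu V f g ->
  measurable_fun V g -> is_weak_laplacian V u f -> is_weak_laplacian V u g.
Proof.
move=> oV fg mg [iu iff uf].
split => //; first exact: loc_integrable_ae iff.
move=> eta teta; rewrite uf//; apply: pairing_ae => //; first by case: iff.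
by have [] := test_function_continuous teta.
Qed.

Section cutoff.
Variables (V W C : set 'rV[R]_n) (chi : 'rV[R]_n -> R).
Hypotheses (oV : open V) (oW : open W) (cC : closed C) (schi : smooth chi)
  (chi0 : forall x, ~ C x -> chi x = 0) (VCW : V `&` C `<=` W).

Lemma partial_cutoff0 i x : ~ C x -> partial i chi x = 0.
Proof. by move: x; apply: (partial_eq_cst (c := 0)) => //;
  exact: closed_openC. Qed.

Lemma laplacian_cutoff0 x : ~ C x -> laplacian chi x = 0.
Proof.
move=> Cx; rewrite /laplacian big1// => i _.
move: x Cx; apply: (partial_eq_cst (c := 0)); first exact: closed_openC.
by move=> x Cx; exact: partial_cutoff0.
Qed.

(** This moves the cutoff from the function onto the test function and at the same time the domain
    from [V] to [W]: off [W] the extension is zero, off [V] the test function is. *)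
Let restrict_pairing u psi (h : 'rV[R]_n -> R) :
  (forall x, psi x != 0 -> V x) -> (forall x, ~ C x -> h x = 0) ->
  \int[mu]_(x in V) (((fun y => h y * u y) \_ W) x * psi x) =
  \int[mu]_(x in W) (u x * (h x * psi x)).
Proof.
move=> psiV h0; apply: Rintegral_eq_restrict => x; rewrite !patchE.
have [Vx|Vx] := boolP (x \in V); have [Wx|Wx] := boolP (x \in W) => //.
- by rewrite mulrCA mulrA.
- by rewrite mul0r.
- have [->|/psiV ?] := eqVneq (psi x) 0; first by rewrite !mulr0.
  by move: Vx; rewrite notin_setE.
Qed.

Let test_support eta : test_function V eta -> forall x, eta x != 0 -> V x.
Proof. by move=> [_ _ eV] x ex; apply: eV; exact: subset_closure. Qed.

(** The weak gradient on [W] is tested with [chi * eta], and the product rule for the smooth factors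
    is rearranged. *)
Lemma is_weak_grad_cutoff u Du : is_weak_grad W u Du ->
  is_weak_grad V ((fun x => chi x * u x) \_ W)
    (fun i => (fun x => chi x * Du i x + partial i chi x * u x) \_ W).
Proof.
move=> [iu iDu uDu].
have cchi := smooth_continuous schi.
have iDchi i : loc_integrable V ((fun x => partial i chi x * u x) \_ W).
  apply: (loc_integrable_cutoff oV oW cC) => //; last exact: partial_cutoff0.
  exact/smooth_continuous/smooth_partial.
have ichiD i : loc_integrable V ((fun x => chi x * Du i x) \_ W).
  exact: (loc_integrable_cutoff oV oW cC).
have DE i : (fun x => chi x * Du i x + partial i chi x * u x) \_ W =
    (fun x => ((fun x => chi x * Du i x) \_ W) x +
              ((fun x => partial i chi x * u x) \_ W) x).
  by apply/funext => x; rewrite !patchE; case: ifP => //; rewrite addr0.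
split; first exact: (loc_integrable_cutoff oV oW cC).
  by move=> i; rewrite DE; exact: loc_integrableD.
move=> eta teta i; rewrite DE pairingD//; last exact: test_function_continuous.
rewrite (restrict_pairing _ (test_support (test_function_partial i teta)) chi0).
rewrite (restrict_pairing _ (test_support teta) chi0).
rewrite (restrict_pairing _ (test_support teta) (partial_cutoff0 i)).
have tchi : test_function W (fun x => chi x
  * eta x) by exact: (test_functionM schi teta cC).
have tDchi : test_function W (fun x => partial i chi x * eta x).
  by apply: (test_functionM (smooth_partial i schi) teta cC) => //;
    exact: partial_cutoff0.
have seta : smooth eta by case: teta.
have tchiD : test_function W (fun x => chi x * partial i eta x).
  exact: (test_functionM schi (test_function_partial i teta) cC).
have := uDu _ tchi i; rewrite partialM; [|exact: smooth_derivable..].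
rewrite pairingDr//; [|exact: test_function_continuous..].
by move/eqP; rewrite -subr_eq0 opprK => /eqP h; apply/eqP; rewrite -subr_eq0;
  apply/eqP; rewrite -{}h; ring.
Qed.

(** Testing with [chi * eta] leaves the cross term $2\int u\,\nabla\chi\cdot\nabla\eta$, which still
    differentiates [eta]. A further integration by parts through the weak gradient [Du] removes it
    and reverses the sign of the term with $\Delta\chi$. *)
Lemma is_weak_laplacian_cutoff u Du g : is_weak_grad W u Du ->
  is_weak_laplacian W u g ->
  is_weak_laplacian V ((fun x => chi x * u x) \_ W)
    ((fun x => chi x * g x + (2 * (\sum_(i < n) partial i chi x * Du i x)
                              + laplacian chi x * u x)) \_ W).
Proof.
move=> [iu iDu uDu] [_ ig ug].
have cchi := smooth_continuous schi.
have cD i := smooth_continuous (smooth_partial i schi).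
have cL := smooth_continuous (smooth_laplacian schi).
have iD i : loc_integrable V ((fun x => partial i chi x * Du i x) \_ W).
  by apply: (loc_integrable_cutoff oV oW cC) => //; exact: partial_cutoff0.
have iL : loc_integrable V ((fun x => laplacian chi x * u x) \_ W).
  by apply: (loc_integrable_cutoff oV oW cC) => //; exact: laplacian_cutoff0.
have ichig : loc_integrable V ((fun x => chi x * g x) \_ W).
  exact: (loc_integrable_cutoff oV oW cC).
have E : (fun x => chi x * g x + (2 * (\sum_(i < n) partial i chi x * Du i x)
                              + laplacian chi x * u x)) \_ W =
  fun x => ((fun x => chi x * g x) \_ W) x +
   (2 * (\sum_(i < n) ((fun x => partial i chi x * Du i x) \_ W) x) +
     ((fun x => laplacian chi x * u x) \_ W) x).
  apply/funext => x; rewrite !patchE; case: ifPn => // xW.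
    by under [in RHS]eq_bigr do rewrite patchE xW.
  under eq_bigr do rewrite patchE (negbTE xW).
  by rewrite sumr_const mul0rn mulr0 !addr0.
have iS : loc_integrable V (fun x => \sum_(i < n)
  ((fun x => partial i chi x * Du i x) \_ W) x).
  exact: loc_integrable_sum.
have i2S := loc_integrableZ 2 oV iS.
rewrite E; split; first exact: (loc_integrable_cutoff oV oW cC).
  by do 2 apply: loc_integrableD => //.
move=> eta teta; have tc := test_function_continuous teta.
have seta : smooth eta by case: teta.
rewrite pairingD//; last exact: loc_integrableD.
rewrite pairingD// pairingZ// pairing_sum//.
have te := test_support teta.
rewrite (restrict_pairing _ (test_support (test_function_laplacian teta)) chi0).
rewrite (restrict_pairing _ te chi0) (restrict_pairing _ te laplacian_cutoff0).
under eq_bigr => i _ do rewrite (restrict_pairing _ te (partial_cutoff0 i)).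
have tchi : test_function W (fun x => chi x
  * eta x) by exact: (test_functionM schi teta cC).
have tDchi i : test_function W (fun x => partial i chi x * eta x).
  by apply: (test_functionM (smooth_partial i schi) teta cC) => //;
    exact: partial_cutoff0.
have tLchi : test_function W (fun x => laplacian chi x * eta x).
  by apply: (test_functionM (smooth_laplacian schi) teta cC) => //;
    exact: laplacian_cutoff0.
have tchiL : test_function W (fun x => chi x * laplacian eta x).
  exact: (test_functionM schi (test_function_laplacian teta) cC).
have tDD i : test_function W (fun x => partial i chi x * partial i eta x).
  apply: (test_functionM (smooth_partial i schi)
    (test_function_partial i teta) cC) => //.
  exact: partial_cutoff0.
have tDDc i : test_function W (fun x => partial i (partial i chi) x * eta x).
  apply: (test_functionM (smooth_partial i (smooth_partial i schi)) teta cC) =>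
    //.
  by apply: (partial_eq_cst (c := 0));
    [exact: closed_openC|exact: partial_cutoff0].
(* Each component of [Du] is tested with [partial i chi * eta]; summing the product rule over [i]
   yields $\nabla\chi\cdot\nabla\eta+\eta\,\Delta\chi$. *)
have h2 : \int[mu]_(x in W) (u x * \sum_(i < n)
  (partial i chi x * partial i eta x))
     + \int[mu]_(x in W) (u x * (laplacian chi x * eta x)) =
    - \sum_(i < n) \int[mu]_(x in W) (Du i x * (partial i chi x * eta x)).
  rewrite -sumrN.
  under eq_bigr => i _.
    rewrite -uDu// partialM; last 2 first.
    - exact/smooth_derivable/smooth_partial.
    - exact: smooth_derivable.
    rewrite pairingDr//; [|exact: test_function_continuous..].
    over.
  rewrite big_split/= -!pairing_sumr//; [|move=> i;
    exact: test_function_continuous..].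
  congr (_ + _); congr Rintegral; apply/funext => x; congr (_ * _).
  by rewrite /laplacian mulr_suml.
have := ug _ tchi; rewrite laplacianM//.
rewrite pairingDr//; last 2 first.
- apply: continuous_testD; first exact: test_function_continuous.
  apply: continuous_testM; first exact: cst_continuous.
  by apply: continuous_test_sum => i; exact: test_function_continuous.
- exact: test_function_continuous.
have tS : continuous_test W
    (fun x => \sum_(i < n) (partial i chi x * partial i eta x)).
  by apply: continuous_test_sum => i; exact: test_function_continuous.
rewrite pairingDr//; last 2 first.
- exact: test_function_continuous.
- by apply: continuous_testM => //; exact: cst_continuous.
rewrite pairingZr// => h1.
set a := Rintegral _ _ _ in h1 *.
move: h1 h2.
set b := \int[mu]_(x in W) (u x * (\sum_(i < n) _)).
set d := \int[mu]_(x in W) (u x * (laplacian chi x * eta x)).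
set e := \sum_(i < n) _; set G := Rintegral _ _ _ => h1 h2.
by move: h1 h2; clear; lra.
Qed.

End cutoff.
End weak_derivatives.

(** * Dilations *)

Section dilation.
Variables (R : realType) (n : nat).
Local Notation mu := (lebesgue_rV R n).
Implicit Types (f g eta chi psi u v : 'rV[R]_n -> R) (V W C D : set 'rV[R]_n)
  (Du Dv : 'I_n -> 'rV[R]_n -> R).

Lemma measurable_dilset t D : 0 < t -> measurable D -> measurable (dilset t D).
Proof.
move=> t0 mD; rewrite dilset_preimage// -[X in measurable X]setTI.
exact: rV_scale_measurable.
Qed.

Lemma measurable_fun_dil d (T : measurableType d) t D (f : 'rV[R]_n -> T) :
  0 < t -> measurable D -> measurable_fun D f ->
  measurable_fun (dilset t D) (fun x => f (t^-1 *: x)).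
Proof.
move=> t0 mD mf; apply: (measurable_comp mD _ mf).
  by move=> _ [_ [y Dy <-] <-] ; rewrite scalerA mulVf ?gt_eqF// scale1r.
by apply: measurable_funTS; exact: rV_scale_measurable.
Qed.

(** [c] is the Jacobian $t^n$. It is chosen before [D] and [f], so one constant serves all integrals
    that occur in an identity. *)
Lemma ge0_integral_dilset t : 0 < t -> exists2 c : R, 0 < c &
  forall D (f : 'rV[R]_n -> \bar R), measurable D -> measurable_fun D f ->
    (forall x, D x -> 0 <= f x)%E ->
  (\int[mu]_(x in dilset t D) f (t^-1 *: x)%R = c%:E * \int[mu]_(x in D) f x)%E.
Proof.
move=> t0; have ti0 : 0 < t^-1 by rewrite invr_gt0.
have [c c0 cP] := @lebesgue_rV_scale R n _ ti0.
exists c => // D f mD mf f0; have c0' := ltW c0.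
rewrite dilset_preimage//.
rewrite -(@ge0_integral_pushforward _ _ _ _ _ _ (@rV_scale_measurable R n t^-1)
  mu D f)//; last first.
  by move=> x /set_mem; exact: f0.
rewrite (eq_measure_integral (mscale (NngNum c0') mu)).
- by rewrite ge0_integral_mscale.
- exact: rV_scale_measurable.
- by move=> ? X mX _; exact: cP.
Qed.

Lemma integral_dilset t : 0 < t -> exists2 c : R, 0 < c &
  (forall D (f : 'rV[R]_n -> \bar R), measurable D -> measurable_fun D f ->
    (forall x, D x -> 0 <= f x)%E ->
  (\int[mu]_(x in dilset t D) f (t^-1 *: x)%R = c%:E * \int[mu]_(x in D) f x)%E)
  /\ forall D f, measurable D -> mu.-integrable D (EFin \o f) ->
    mu.-integrable (dilset t D) (EFin \o dil t f) /\
    \int[mu]_(x in dilset t D) dil t f x = c * \int[mu]_(x in D) f x.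
Proof.
move=> t0; have [c c0 cP] := ge0_integral_dilset t0.
exists c => //; split=> // D f mD iD.
have mf := measurable_int _ iD.
have mdf : measurable_fun (dilset t D) (EFin \o dil t f).
  exact: (measurable_fun_dil t0 mD mf).
have mdD := measurable_dilset t0 mD.
have iDil : mu.-integrable (dilset t D) (EFin \o dil t f).
  apply/integrableP; split => //.
  rewrite (cP D (fun x => `|(EFin \o f) x|%E))//.
    by apply: lte_mul_pinfty; rewrite ?lee_fin ?ltW//; case/integrableP : iD.
  exact: measurableT_comp.
split => //; rewrite /Rintegral.
have -> : (\int[mu]_(x in dilset t D) (dil t f x)%:E =
    c%:E * \int[mu]_(x in D) (f x)%:E)%E.
  rewrite integralE [in RHS]integralE.
  have E1 : (\int[mu]_(x in dilset t D) (EFin \o f)^\+ (t^-1 *: x)%R =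
      c%:E * \int[mu]_(x in D) (EFin \o f)^\+ x)%E.
    by apply: cP => //; exact: measurable_funepos.
  have E2 : (\int[mu]_(x in dilset t D) (EFin \o f)^\- (t^-1 *: x)%R =
      c%:E * \int[mu]_(x in D) (EFin \o f)^\- x)%E.
    by apply: cP => //; exact: measurable_funeneg.
  transitivity (c%:E * \int[mu]_(x in D) (EFin \o f)^\+ x -
      c%:E * \int[mu]_(x in D) (EFin \o f)^\- x)%E.
    by congr (_ - _)%E; [rewrite -E1|rewrite -E2]; apply: eq_integral => x _;
      rewrite ?funeposE ?funenegE.
  by rewrite -muleBr ?integrable_add_def.
by rewrite fineM//; exact: integrable_fin_num.
Qed.

Lemma loc_integrable_dil t W u : 0 < t -> open W -> loc_integrable W u ->
  loc_integrable (dilset t W) (dil t u).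
Proof.
move=> t0 oW [mu_u iu]; have mW := open_rV_measurable oW.
split; first exact: measurable_fun_dil.
move=> K KW cK; have [c _ [_ /(_ (dilset t^-1 K) u)]] := integral_dilset t0.
have cK' : compact (dilset t^-1 K) := compact_dilset cK.
rewrite dilsetK ?gt_eqF// => /(_ (compact_rV_measurable cK')) [|//].
apply: iu => // _ [x /KW [y Wy <-] <-].
by rewrite scalerA mulVf ?gt_eqF// scale1r.
Qed.

(** Thanks to this, weak identities on a dilated set are checked against dilates of test functions
    only, where a change of variables applies. *)
Lemma dil_testP t W eta : 0 < t -> test_function (dilset t W) eta ->
  exists2 theta, test_function W theta & eta = dil t theta.
Proof.
move=> t0 teta; exists (dil t^-1 eta); last by rewrite dilK// gt_eqF.
have ti0 : 0 < t^-1 by rewrite invr_gt0.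
have := test_function_dil ti0 teta.
by rewrite -[X in dilset _ (dilset X _)]invrK dilsetK ?invr_eq0 ?gt_eqF.
Qed.

Lemma pairing_dil t : 0 < t -> exists2 c : R, 0 < c &
  forall W u psi, open W -> loc_integrable W u -> continuous_test W psi ->
  \int[mu]_(x in dilset t W) (dil t u x * dil t psi x) =
  c * \int[mu]_(x in W) (u x * psi x).
Proof.
move=> t0; have [c c0 [_ cP]] := integral_dilset t0.
exists c => // W u psi oW iu tpsi.
have [] // := cP W (fun x => u x * psi x).
  exact: open_rV_measurable.
exact: loc_integrable_integrableM.
Qed.

Lemma is_weak_grad_dil t W u Du : 0 < t -> open W -> is_weak_grad W u Du ->
  is_weak_grad (dilset t W) (dil t u) (fun i x => t^-1 * dil t (Du i) x).
Proof.
move=> t0 oW [iu iDu uDu].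
have odW := open_dilset t0 oW.
have iduD i : loc_integrable (dilset t W) (dil t (Du i)).
  exact: loc_integrable_dil.
split; first exact: loc_integrable_dil.
  by move=> i; exact: loc_integrableZ.
move=> _ /(dil_testP t0)[theta ttheta ->] i.
have sth : smooth theta by case: ttheta.
have tc := test_function_continuous ttheta.
have tp := test_function_continuous (test_function_partial i ttheta).
have tdc := test_function_continuous (test_function_dil t0 ttheta).
have tdp := test_function_continuous (test_function_dil t0
  (test_function_partial i ttheta)).
rewrite partial_dil//; last exact: smooth_derivable.
rewrite pairingZ// pairingZr//; last exact: loc_integrable_dil.
have [c c0 cP] := pairing_dil t0.
by rewrite !cP// uDu// !mulrN.
Qed.

Lemma is_weak_laplacian_dil t W u g : 0 < t -> open W ->
  is_weak_laplacian W u g ->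
  is_weak_laplacian (dilset t W) (dil t u) (fun x => t ^- 2 * dil t g x).
Proof.
move=> t0 oW [iu ig ug].
have odW := open_dilset t0 oW.
have idu : loc_integrable (dilset t W) (dil t u) by exact: loc_integrable_dil.
have idg : loc_integrable (dilset t W) (dil t g) by exact: loc_integrable_dil.
split=> //; first exact: loc_integrableZ.
move=> _ /(dil_testP t0)[theta ttheta ->].
have sth : smooth theta by case: ttheta.
have tc := test_function_continuous ttheta.
have tp := test_function_continuous (test_function_laplacian ttheta).
have tdc := test_function_continuous (test_function_dil t0 ttheta).
have tdp := test_function_continuous (test_function_dil t0
  (test_function_laplacian ttheta)).
rewrite laplacian_dil// pairingZ// pairingZr//.
have [c c0 cP] := pairing_dil t0.
by rewrite !cP// ug.
Qed.

Lemma ae_dil t (Q : 'rV[R]_n -> Prop) : 0 < t ->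
  {ae mu, forall x, Q x} -> {ae mu, forall x, Q (t^-1 *: x)}.
Proof.
move=> t0 [N [mN N0 QN]]; have ti0 : 0 < t^-1 by rewrite invr_gt0.
exists ((fun x => t^-1 *: x) @^-1` N); split.
- by rewrite -[X in measurable X]setTI; exact: rV_scale_measurable.
- have [c c0 ->//] := @lebesgue_rV_scale R n _ ti0.
  by rewrite N0 mule0.
- by move=> x /= Qx; exact: QN.
Qed.

End dilation.

(** * Closures of test functions *)

Section H1_estimates.
Variables (R : realType) (n : nat).
Local Notation mu := (lebesgue_rV R n).
Implicit Types (f g h eta chi psi u v w : 'rV[R]_n -> R)
  (V W C D : set 'rV[R]_n)
  (Du Dv : 'I_n -> 'rV[R]_n -> R).

Definition H1_density w u Du : 'rV[R]_n -> R :=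
  fun x => w x * u x ^+ 2 + \sum_(i < n) Du i x ^+ 2.

Lemma H1_density_ge0 w u Du x : 0 <= w x -> 0 <= H1_density w u Du x.
Proof.
move=> w0; rewrite addr_ge0//; first by rewrite mulr_ge0// sqr_ge0.
by apply: sumr_ge0 => i _; exact: sqr_ge0.
Qed.

Lemma measurable_H1_density V w u Du : measurable_fun V w ->
  measurable_fun V u -> (forall i, measurable_fun V (Du i)) ->
  measurable_fun V (H1_density w u Du).
Proof.
move=> mw mu' mDu; apply: measurable_funD.
  by apply: measurable_funM => //; exact: measurable_funX.
by apply: measurable_sum => i; exact: measurable_funX.
Qed.

(** The integrals stay in the extended reals, so that the inequality can also serve to deduce that
    its left-hand side is finite. *)
Lemma ge0_le_integral_combination V f g h (a b : R) : measurable V ->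
  measurable_fun V h -> measurable_fun V f -> measurable_fun V g ->
  (forall x, V x -> 0 <= h x) ->
  (forall x, V x -> 0 <= f x) -> (forall x, V x -> 0 <= g x) -> 0 <= a ->
    0 <= b ->
  (forall x, V x -> h x <= a * f x + b * g x) ->
  (\int[mu]_(x in V) (h x)%:E <=
    a%:E * \int[mu]_(x in V) (f x)%:E + b%:E * \int[mu]_(x in V) (g x)%:E)%E.
Proof.
move=> mV mh mf mg h0 f0 g0 a0 b0 hfg.
have mf' : measurable_fun V (EFin \o f) by exact/measurable_EFinP.
have mg' : measurable_fun V (EFin \o g) by exact/measurable_EFinP.
have Ef : (\int[mu]_(x in V) (a%:E * (f x)%:E) = a%:E * \int[mu]_(x in V)
  (f x)%:E)%E.
  by apply: ge0_integralZl => // x Vx; rewrite lee_fin f0.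
have Eg : (\int[mu]_(x in V) (b%:E * (g x)%:E) = b%:E * \int[mu]_(x in V)
  (g x)%:E)%E.
  by apply: ge0_integralZl => // x Vx; rewrite lee_fin g0.
rewrite -Ef -Eg.
rewrite -ge0_integralD//.
- apply: ge0_le_integral => //.
  + exact/measurable_EFinP.
  + by apply: emeasurable_funD; exact: measurable_funeM.
- by move=> x Vx; rewrite mule_ge0// lee_fin// f0.
- exact: measurable_funeM.
- by move=> x Vx; rewrite mule_ge0// lee_fin// g0.
- exact: measurable_funeM.
Qed.

Lemma sqrDl_le (a b : R) : (a + b) ^+ 2 <= 2 * a ^+ 2 + 2 * b ^+ 2.
Proof. have := sqr_ge0 (a - b); rewrite sqrrB sqrrD; lra. Qed.

Lemma H1_densityD w u v Du Dv x : 0 <= w x ->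
  H1_density w (fun x => u x + v x) (fun i x => Du i x + Dv i x) x <=
  2 * H1_density w u Du x + 2 * H1_density w v Dv x.
Proof.
move=> w0; rewrite /H1_density !mulrDr addrACA lerD//.
  rewrite ![2 * (w x * _)]mulrCA -mulrDr ler_wpM2l//; exact: sqrDl_le.
by rewrite !mulr_sumr -big_split ler_sum// => i _; exact: sqrDl_le.
Qed.

Lemma H1_densityZ w u Du c x :
  H1_density w (fun x => c * u x) (fun i x => c * Du i x) x =
  c ^+ 2 * H1_density w u Du x.
Proof.
rewrite /H1_density mulrDr exprMn mulrCA mulr_sumr; congr (_ + _).
by apply: eq_bigr => i _; rewrite exprMn.
Qed.

Lemma test_functionD V eta theta c : test_function V eta ->
  test_function V theta -> test_function V (fun x => eta x + c * theta x).
Proof.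
move=> te tt; have [se _ _] := te; have [st _ _] := tt.
have ce := test_function_continuous te; have ct := test_function_continuous tt.
have cct : continuous_test V (fun x => c * theta x).
  by apply: continuous_testM => //; exact: cst_continuous.
have [_ k s] := continuous_testD ce cct; split; [|exact: k|exact: s].
exact: (smoothD se (smoothM (smooth_cst c) st)).
Qed.

Lemma H1_closureD V u v c : open V -> H1_closure (fun=> 1) V u ->
  H1_closure (fun=> 1) V v -> H1_closure (fun=> 1) V (fun x => u x + c * v x).
Proof.
move=> oV [Du [gu nu au]] [Dv [gv nv av]]; have mV := open_rV_measurable oV.
have [[mu_u _] mDu' _] := gu; have [[mv _] mDv' _] := gv.
have mDu i : measurable_fun V (Du i) by have [] := mDu' i.
have mDv i : measurable_fun V (Dv i) by have [] := mDv' i.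
exists (fun i x => Du i x + c * Dv i x).
pose N (a : 'rV[R]_n -> R) Da := H1_norm_sq (fun=> 1) V a Da.
(* The natural coefficient [2 * c ^+ 2] is enlarged to [2 * (1 + c ^+ 2)], which can be divided by
   even when [c = 0]. The tolerances chosen below then give two errors of [delta / 2] each. *)
have key (a b : 'rV[R]_n -> R)
  (Da Db : 'I_n -> 'rV[R]_n -> R) : measurable_fun V a -> measurable_fun V b ->
    (forall i, measurable_fun V (Da i)) ->
      (forall i, measurable_fun V (Db i)) ->
  (N (fun x => (a x + c * b x)%R) (fun i x => (Da i x + c * Db i x)%R)
   <= 2%:E * N a Da + (2 * (1 + c ^+ 2))%:E * N b Db)%E.
  move=> ma mb mDa mDb; pose d a Da := H1_density (fun=> 1) a Da.
  apply: (@ge0_le_integral_combination V (d a Da) (d b Db)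
    (d (fun x => a x + c * b x) (fun i x => Da i x + c * Db i x))) => //.
  - apply: measurable_H1_density => //.
      by apply: measurable_funD => //; exact: measurable_funM.
    by move=> i; apply: measurable_funD => //; exact: measurable_funM.
  - exact: measurable_H1_density.
  - exact: measurable_H1_density.
  - by move=> x _; exact: H1_density_ge0.
  - by move=> x _; exact: H1_density_ge0.
  - by move=> x _; exact: H1_density_ge0.
  - by rewrite mulr_ge0// addr_ge0// sqr_ge0.
  - move=> x _; rewrite -mulrA.
    have : c ^+ 2 * H1_density (fun=> 1) b Db x <= (1
      + c ^+ 2) * H1_density (fun=> 1) b Db x.
      by rewrite ler_wpM2r ?lerDr// H1_density_ge0.
    rewrite -H1_densityZ => h;
      apply: le_trans (lerD (lexx _) (ler_wpM2l _ h)) => //.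
    by apply: (@H1_densityD (fun=> 1) a (fun x => c * b x) Da (fun i x => c
      * Db i x)).
split; first exact: is_weak_gradD.
  apply: le_lt_trans (key _ _ _ _ mu_u mv mDu mDv) _.
  by apply: lte_add_pinfty; apply: lte_mul_pinfty;
    rewrite ?lee_fin ?mulr_ge0// addr_ge0// sqr_ge0.
move=> delta d0.
have d4 : 0 < delta / 4 by rewrite divr_gt0.
have d4' : 0 < delta / (4 * (1 + c ^+ 2)).
  by rewrite divr_gt0// mulr_gt0// ltr_pwDl// sqr_ge0.
have [eta teta ne] := au _ d4; have [theta ttheta nt] := av _ d4'.
exists (fun x => eta x + c * theta x); first exact: test_functionD.
have [seta _ _] := teta; have [stheta _ _] := ttheta.
have me : measurable_fun V eta by exact: smooth_measurable.
have mt : measurable_fun V theta by exact: smooth_measurable.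
have mDe i : measurable_fun V (partial i eta).
  exact: (smooth_measurable (smooth_partial i seta)).
have mDt i : measurable_fun V (partial i theta).
  exact: (smooth_measurable (smooth_partial i stheta)).
have -> : (fun x => u x + c * v x - (eta x + c * theta x)) =
   (fun x => (u x - eta x) + c * (v x - theta x)) by apply/funext => x; ring.
have -> : (fun i x => Du i x + c * Dv i x - partial i (fun x => eta x
  + c * theta x) x) =
   (fun i x => (Du i x - partial i eta x) + c * (Dv i x - partial i theta x)).
  apply/funext => i; apply/funext => x.
  rewrite partialD; last 2 first.
  - exact: smooth_derivable.
  - exact: (smooth_derivable (smoothM (smooth_cst c) stheta)).
  rewrite (partialM (f := fun=> c)); last 2 first.
  - by move=> y; exact: derivable_cst.
  - exact: smooth_derivable.
  by rewrite partial_cst; ring.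
apply: le_lt_trans (key _ _ _ _ _ _ _ _) _.
- exact: measurable_funB.
- exact: measurable_funB.
- by move=> i; exact: measurable_funB.
- by move=> i; exact: measurable_funB.
have -> : delta%:E = ((2 * (delta / 4))%:E + (2 * (1
  + c ^+ 2))%:E * (delta / (4 * (1 + c ^+ 2)))%:E)%E.
  rewrite -EFinM -EFinD; congr EFin.
  by have : 1 + c ^+ 2 != 0; [rewrite gt_eqF// ltr_pwDl// sqr_ge0|move=> ?;
    field].
have c1 : 0 < 2 * (1 + c ^+ 2) by rewrite mulr_gt0// ltr_pwDl// sqr_ge0.
by apply: lteD; [rewrite EFinM|]; rewrite lte_pmul2l.
Qed.

End H1_estimates.

(** * Dilations acting on closures of test functions *)

Section H1_closure_operations.
Variables (R : realType) (n : nat).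
Local Notation mu := (lebesgue_rV R n).
Implicit Types (f g h eta chi psi u v w : 'rV[R]_n -> R)
  (V W C D : set 'rV[R]_n)
  (Du Dv : 'I_n -> 'rV[R]_n -> R).

Lemma ge0_integral_patch_le V W f : measurable V -> measurable W ->
  measurable_fun W f -> (forall x, W x -> 0 <= f x) ->
  (\int[mu]_(x in V) ((f \_ W) x)%:E <= \int[mu]_(x in W) (f x)%:E)%E.
Proof.
move=> mV mW mf f0.
have mfW : measurable_fun setT (EFin \o (f \_ W)).
  by apply/measurable_EFinP; apply/(measurable_restrictT _ mW).
have fW0 x : 0 <= (f \_ W) x.
  by rewrite patchE; case: ifP => // /set_mem/f0.
apply: (@le_trans _ _ (\int[mu]_x ((f \_ W) x)%:E)%E).
  apply: ge0_subset_integral => //.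
  by move=> x _; rewrite lee_fin.
rewrite [in leRHS]integral_mkcond le_eqVlt; apply/orP; left; apply/eqP.
by apply: eq_integral => x _; rewrite !patchE; case: ifP.
Qed.

Lemma H1_closure_dil t w W u : 0 < t -> open W -> measurable_fun W w ->
  (forall x, W x -> 0 <= w x) -> H1_closure w W u ->
  H1_closure (dil t w) (dilset t W) (dil t u).
Proof.
move=> t0 oW mw w0 [Du [gu nu au]]; have mW := open_rV_measurable oW.
have [[mu_u _] mDu' _] := gu.
have mDu i : measurable_fun W (Du i) by have [] := mDu' i.
exists (fun i x => t^-1 * dil t (Du i) x).
have [c c0 cP] := @ge0_integral_dilset R n _ t0.
(* The zeroth-order part of the density is carried over unchanged and the gradient part picks up
   [t ^- 2]; [k] dominates both factors. *)
pose k := 1 + t ^- 2.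
have k0 : 0 < k by rewrite ltr_pwDl// invr_ge0 sqr_ge0.
have key (a : 'rV[R]_n -> R) (Da : 'I_n -> 'rV[R]_n -> R) :
    measurable_fun W a -> (forall i, measurable_fun W (Da i)) ->
    (H1_norm_sq (dil t w) (dilset t W) (dil t a)
      (fun i x => (t^-1 * dil t (Da i) x)%R)
    <= (c * k)%:E * H1_norm_sq w W a Da)%E.
  move=> ma mDa.
  pose d := H1_density w a Da.
  have md : measurable_fun W d by exact: measurable_H1_density.
  have d0 x : W x -> 0 <= d x by move=> /w0; exact: H1_density_ge0.
  have mdW := measurable_dilset t0 mW.
  have Wd x : dilset t W x -> W (t^-1 *: x) by move=> /(dilsetE _ _ t0).
  have -> : ((c * k)%:E * H1_norm_sq w W a Da =
      k%:E * \int[mu]_(x in dilset t W) (dil t d x)%:E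
      + 0%:E * \int[mu]_(x in dilset t W) (dil t d x)%:E)%E.
    rewrite mul0e adde0 (cP W (EFin \o d))//; last exact/measurable_EFinP.
    by rewrite muleA -EFinM mulrC.
  have mdd : measurable_fun (dilset t W)
    (dil t d) by exact: (measurable_fun_dil t0 mW md).
  apply: (@ge0_le_integral_combination _ _ (dilset t W) (dil t d) (dil t d)
    (H1_density (dil t w) (dil t a) (fun i x => t^-1 * dil t (Da i) x))) => //.
  - apply: measurable_H1_density.
    + exact: (measurable_fun_dil t0 mW mw).
    + exact: (measurable_fun_dil t0 mW ma).
    + by move=> i; apply: measurable_funM => //;
        exact: (measurable_fun_dil t0 mW (mDa i)).
  - by move=> x /Wd /w0 wx; exact: H1_density_ge0.
  - by move=> x /Wd /d0.
  - by move=> x /Wd /d0.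
  - exact: ltW.
  - move=> x /Wd Wx; rewrite mul0r addr0 /H1_density.
    rewrite /dil /d /H1_density mulrDr; apply: lerD.
      apply: ler_peMl; last by rewrite /k lerDl invr_ge0 sqr_ge0.
      by rewrite mulr_ge0 ?sqr_ge0 ?w0.
    rewrite mulr_sumr ler_sum// => i _;
      rewrite exprMn exprVn ler_wpM2r ?sqr_ge0//.
    by rewrite /k lerDr.
split; first exact: is_weak_grad_dil.
  apply: le_lt_trans (key _ _ mu_u mDu) _.
  by apply: lte_mul_pinfty; rewrite ?lee_fin ?ltW ?mulr_gt0.
move=> delta d0.
have ck : 0 < c * k by rewrite mulr_gt0.
have [eta teta ne] := au _ (divr_gt0 d0 ck).
have [seta _ _] := teta.
exists (dil t eta); first exact: test_function_dil.
have -> : (fun i x => t^-1 * dil t (Du i) x - partial i (dil t eta) x) =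
   (fun i x => t^-1 * dil t (fun y => Du i y - partial i eta y) x).
  apply/funext => i; apply/funext => x; rewrite partial_dil; last 2 first => //.
  - exact: smooth_derivable.
  by rewrite /dil mulrBr.
apply: le_lt_trans (key (fun x => u x - eta x)
  (fun i x => Du i x - partial i eta x) _ _) _.
- by apply: measurable_funB => //; exact: smooth_measurable.
- by move=> i; apply: measurable_funB => //;
    exact: (smooth_measurable (smooth_partial i seta)).
rewrite -[X in (_ < X)%E](_ : ((c * k)%:E * (delta / (c * k))%:E)%E = _).
  by rewrite lte_pmul2l.
by rewrite -EFinM mulrCA divff ?mulr1// gt_eqF.
Qed.

(** Joint continuity in [(x, s)] at [s = 1] becomes uniform in [x] through the near-covering form of
    compactness. The power [k] is [0] for a cutoff and [1] for its partial derivatives, which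
    acquire a factor [s^-1] under dilation. *)
Lemma dil_uniform_near f (K : set 'rV[R]_n) (k : nat) (e : R) :
  continuous f -> compact K -> 0 < e ->
  \forall s \near (1 : R), forall x, K x ->
    `|f x - s^-1 ^+ k * dil s f x| < e.
Proof.
move=> cf cK e0.
have := @compact_near_coveringP _ K; move=> [/(_ cK) + _].
move=> /(_ R (nbhs (1:R)) (fun s x => `|f x - s^-1 ^+ k * dil s f x| < e)).
apply=> x Kx.
have fst_c : (fun z : 'rV[R]_n * R => z.1) @ (x, (1:R)) --> x by exact: cvg_fst.
have snd_c : (fun z : 'rV[R]_n * R => z.2) @ (x,
  (1:R)) --> (1:R) by exact: cvg_snd.
have inv_c : (fun z : 'rV[R]_n * R => z.2^-1) @ (x, (1:R)) --> (1:R)^-1.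
  by apply: cvgV => //; exact: oner_neq0.
have scal : (fun z : 'rV[R]_n * R => z.2^-1 *: z.1) @ (x,
  (1:R)) --> (1:R)^-1 *: x.
  exact: cvgZ.
rewrite invr1 scale1r in scal inv_c.
have c1 : (fun z : 'rV[R]_n * R => f z.1) @ (x, (1:R)) --> f x.
  exact: (cvg_comp _ _ fst_c (cf x)).
have c2 : (fun z : 'rV[R]_n * R => f (z.2^-1 *: z.1)) @ (x, (1:R)) --> f x.
  exact: (cvg_comp _ _ scal (cf x)).
have c3 : (fun z : 'rV[R]_n * R => z.2^-1 ^+ k) @ (x, (1:R)) --> (1:R) ^+ k.
  exact: (cvg_comp _ _ inv_c (@exprn_continuous _ k 1)).
have c4 := cvgB c1 (cvgM c3 c2).
rewrite expr1n mul1r subrr in c4.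
have /cvgrPdist_lt/(_ e e0) : (fun z : 'rV[R]_n * R =>
    f z.1 - z.2^-1 ^+ k * f (z.2^-1 *: z.1)) @ (x,
      (1:R)) --> (0 : R) by exact: c4.
by apply: filterS => -[y s] /=; rewrite sub0r normrN.
Qed.

End H1_closure_operations.

(** * Cutoffs mapping one closure of test functions into another *)

Section H1_closure_cutoff.
Variables (R : realType) (n : nat).
Local Notation mu := (lebesgue_rV R n).
Implicit Types (f g h eta chi psi u v w : 'rV[R]_n -> R)
  (V W C D K : set 'rV[R]_n)
  (Du Dv : 'I_n -> 'rV[R]_n -> R).

Lemma continuous_compact_bound f K : continuous f -> compact K ->
  exists2 B, 0 < B & forall x, K x -> `|f x| <= B.
Proof.
move=> cf cK; have [M [_ HM]] := bounded_continuous_compact cf cK.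
exists (`|M| + 1); first by rewrite ltr_wpDl.
move=> x Kx; apply: HM => //.
by rewrite (le_lt_trans (ler_norm M))// ltrDl.
Qed.

Lemma finite_uniform_bound (I : finType) (f : I -> 'rV[R]_n -> R) K :
  (forall i, exists2 B, 0 < B & forall x, K x -> `|f i x| <= B) ->
  exists2 B, 0 < B & forall i x, K x -> `|f i x| <= B.
Proof.
move=> H; have /choice[B BP] : forall i, exists B, 0 < B /\ forall x, K x ->
  `|f i x| <= B.
  by move=> i; have [B ? ?] := H i; exists B.
exists (1 + \sum_i B i).
  by rewrite ltr_pwDl// sumr_ge0// => i _; have [/ltW] := BP i.
move=> i x Kx; have [_ /(_ x Kx)] := BP i.
move=> /le_trans; apply; rewrite (bigD1 i)//= addrCA lerDl addr_ge0//.
by rewrite sumr_ge0// => j _; have [/ltW] := BP j.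
Qed.

(** As [s] tends to [1], the dilated cutoff and its gradient converge uniformly on the support of
    [eta], and everything vanishes off this compact set of finite measure. *)
Lemma H1_norm_sq_cutoff_dil V W chi eta delta : measurable V -> smooth chi ->
  test_function W eta -> 0 < delta ->
  \forall s \near (1 : R), 0 < s ->
  (H1_norm_sq (fun=> 1%R) V
    (fun x => (chi x * eta x - dil s chi x * eta x)%R)
    (fun i x => (partial i (fun y => chi y * eta y) x
                 - partial i (fun y => dil s chi y * eta y) x)%R) < delta%:E)%E.
Proof.
move=> mV schi teta d0; have [seta keta _] := teta.
set K := closure _ in keta.
have mK := compact_rV_measurable keta.
have [B1 B10 B1P] := continuous_compact_bound (smooth_continuous seta) keta.
have [B2 B20 B2P] := @finite_uniform_bound _ (fun i => partial i eta) K
  (fun i => continuous_compact_bound (smooth_continuous (smooth_partial i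
    seta)) keta).
pose B := B1 + B2.
have B0 : 0 < B by rewrite addr_gt0.
have mKfin : mu K \is a fin_num by rewrite ge0_fin_numE// compact_rV_finite.
pose m := fine (mu K); have m0 : 0 <= m by rewrite fine_ge0.
(* If cutoff and gradient are within [e], the value contributes at most [(e * B) ^+ 2] and each of
   the [n] derivatives at most [(2 * e * B) ^+ 2], over a set of measure [m]. Using [m + 1] keeps
   [A] positive, and the choice of [e] makes the total at most [delta / 2]. *)
pose A := B ^+ 2 * (1 + 4 * n%:R) * (m + 1).
have n0 : 0 < 1 + 4 * n%:R :> R by rewrite ltr_pwDl// mulr_ge0.
have A0 : 0 < A by rewrite !mulr_gt0// ?exprn_gt0// ltr_wpDl.
pose e := Num.sqrt (delta / (2 * A)).
have e0 : 0 < e by rewrite sqrtr_gt0 divr_gt0// mulr_gt0.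
have e2 : e ^+ 2 = delta / (2
  * A) by rewrite sqr_sqrtr// divr_ge0// ltW// mulr_gt0.
have near0 := dil_uniform_near 0 (smooth_continuous schi) keta e0.
have near1 : \forall s \near (1 : R), forall i x, K x ->
    `|partial i chi x - s^-1 ^+ 1 * dil s (partial i chi) x| < e.
  apply: (filter_forall (nbhs_filter (1 : R))) => i.
  exact: (dil_uniform_near 1 (smooth_continuous (smooth_partial i schi)) keta
    e0).
near=> s => s0.
have h0 x : K x -> `|chi x - dil s chi x| <= e.
  move=> Kx; apply: ltW; rewrite -[X in _ - X]mul1r -(expr0 s^-1).
  by move: x Kx; near: s.
have h1 i x : K x -> `|partial i chi x - partial i (dil s chi) x| <= e.
  move=> Kx; apply: ltW; rewrite partial_dil//; last exact: smooth_derivable.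
  rewrite -[X in X * dil s _ _]expr1.
  by move: i x Kx; near: s.
have sd := smooth_dil s0 schi.
have Peta (c : 'rV[R]_n -> R) i x : smooth c ->
  partial i (fun y => c y * eta y) x =
    c x * partial i eta x + partial i c x * eta x.
  by move=> sc; rewrite partialM//; exact: smooth_derivable.
pose d := H1_density (fun=> 1)
  (fun x => (chi x * eta x - dil s chi x * eta x)%R)
    (fun i x => (partial i (fun y => chi y * eta y) x
                 - partial i (fun y => dil s chi y * eta y) x)%R).
pose c := e ^+ 2 * (B ^+ 2 * (1 + 4 * n%:R)).
have c0 : 0 <= c by rewrite !mulr_ge0 ?sqr_ge0// ltW.
have dc x : d x <= ((fun=> c) \_ K) x.
  rewrite patchE; case: ifPn => [/set_mem Kx|xK].
    have b1 : `|eta x| <= B by rewrite (le_trans (B1P x Kx))// lerDl ltW.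
    have b2 i : `|partial i eta x| <= B by rewrite (le_trans (B2P i x Kx))//
      lerDr ltW.
    rewrite /d /H1_density mul1r /c mulrA mulrDr mulr1; apply: lerD.
      rewrite -mulrBl exprMn; apply: ler_pM; rewrite ?sqr_ge0//.
        by rewrite -[X in X <= _]real_normK ?num_real// lerXn2r ?nnegrE// ?h0//
          ltW.
      by rewrite -[X in X <= _]real_normK ?num_real// lerXn2r ?nnegrE// ltW.
    apply: (@le_trans _ _ (\sum_(i < n) (4 * (e ^+ 2 * B ^+ 2)))); last first.
      rewrite sumr_const card_ord -mulr_natr.
      by rewrite le_eqVlt; apply/orP; left; apply/eqP; ring.
    apply: ler_sum => i _; rewrite !Peta//.
    rewrite (_ : _ - _ = (chi x - dil s chi x) * partial i eta x +
       (partial i chi x - partial i (dil s chi) x) * eta x); last by ring.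
    have E (a b : R) : `|a| <= e -> `|b| <= B -> `|a * b| <= e * B.
      by move=> ? ?; rewrite normrM ler_pM.
    rewrite -exprMn -real_normK ?num_real//.
    rewrite (_ : 4 * (e * B) ^+ 2 = (e * B + e * B) ^+ 2); last by ring.
    apply: lerXn2r; rewrite ?nnegrE//.
      by rewrite addr_ge0// mulr_ge0// ltW.
    by rewrite (le_trans (ler_normD _ _))// lerD// E// ?h0// ?h1.
  have xK' : ~ K x by move=> Kx; move: xK; rewrite notin_setE.
  have ex : eta x = 0 by exact: tsupp0.
  have px i : partial i eta x = 0.
    by apply: (partial_eq_cst _ (@open_tsuppC _ _ eta)) => // y; exact: tsupp0.
  rewrite /d /H1_density ex !mulr0 subrr expr0n/= mulr0 add0r big1// => i _.
  by rewrite !Peta// ex px !mulr0 !addr0 subrr expr0n.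
have md : measurable_fun V d.
  apply: measurable_H1_density => //.
    apply: measurable_funB; apply: smooth_measurable;
      first exact: (smoothM schi seta).
    exact: (smoothM sd seta).
  move=> i; apply: measurable_funB; apply: smooth_measurable.
    exact: (smooth_partial i (smoothM schi seta)).
  exact: (smooth_partial i (smoothM sd seta)).
have d_ge0 x : 0 <= d x by exact: H1_density_ge0.
have mcK : measurable_fun setT ((fun=> c) \_ K).
  exact: ((measurable_restrictT _ mK).1 (measurable_cst c)).
apply: (@le_lt_trans _ _ (\int[mu]_(x in V) (((fun=> c) \_ K) x)%:E)%E).
  apply: ge0_le_integral => //.
  - by move=> x _; rewrite lee_fin; exact: d_ge0.
  - exact/measurable_EFinP.
  - by apply/measurable_EFinP; exact: (measurable_funTS mcK).
  - by move=> x _; rewrite lee_fin; exact: dc.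
apply: (@le_lt_trans _ _ (\int[mu]_(x in K) c%:E)%E).
  by apply: ge0_integral_patch_le.
rewrite (_ : (\int[mu]_(x in K) c%:E)%E = (c * m)%:E) ?lte_fin; last first.
  by rewrite integral_cst// [in RHS]EFinM [in RHS]fineK.
apply: (@le_lt_trans _ _ (e ^+ 2 * A)).
  rewrite /c /A -[_ * _ * m]mulrA; apply: ler_wpM2l; first exact: sqr_ge0.
  apply: ler_wpM2l; last by rewrite lerDl.
  by rewrite mulr_ge0 ?sqr_ge0// ltW.
have E (a b : R) : b != 0 -> a / (2 * b) * b = a / 2 by move=> ?; field.
by rewrite e2 E ?gt_eqF// ltr_pdivrMr// ltr_pMr// ltr1n.
Unshelve. all: end_near.
Qed.

(* The support of chi may touch the boundary of V, so that chi eta need not be a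
   test function on V; the support of a slight dilate of chi is moved into V. *)
Lemma H1_closure_cutoff V W C w u chi (m M : R) : open V -> open W ->
  closed C ->
  smooth chi -> (forall x, ~ C x -> chi x = 0) -> V `&` C `<=` W ->
  measurable_fun W w -> (forall x, W x -> 0 <= w x) ->
  0 < m -> (forall x, W x -> C x -> m <= w x) ->
  0 <= M -> (forall x, W x -> C x -> `|chi x| <= M) ->
  (forall i x, W x -> C x -> `|partial i chi x| <= M) ->
  (forall e : R, 0 < e -> exists s, [/\ `|1 - s| < e, 0 < s & forall eta,
    test_function W eta -> test_function V (fun x => dil s chi x * eta x)]) ->
  H1_closure w W u -> H1_closure (fun=> 1) V ((fun x => chi x * u x) \_ W).
Proof.
move=> oV oW cC schi chi0 VCW mw w0 m0 mP M0 chiM DchiM tdil [Du [gu nu au]].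
have mV := open_rV_measurable oV; have mW := open_rV_measurable oW.
have [[mu_u _] mDu' _] := gu.
have mDu i : measurable_fun W (Du i) by have [] := mDu' i.
have Dchi0 i x : ~ C x -> partial i chi x = 0 by exact: partial_cutoff0.
pose T (a : 'rV[R]_n -> R) := (fun x => chi x * a x) \_ W.
pose DT (a : 'rV[R]_n -> R) (Da : 'I_n -> 'rV[R]_n -> R) i :=
  (fun x => chi x * Da i x + partial i chi x * a x) \_ W.
(* $(\chi a)^2+\sum_i(\chi D_ia+a\,\partial_i\chi)^2\le(1+2n)M^2a^2+2M^2|Da|^2$, and $a^2\le wa^2/m$
   on [C]. The sum of both coefficients bounds the density of the product by [k] times the weighted
   density. *)
pose k := (1 + 2 * n%:R) * (M ^+ 2 / m) + 2 * M ^+ 2.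
have k0 : 0 <= k.
  by rewrite addr_ge0 ?mulr_ge0 ?addr_ge0 ?invr_ge0 ?sqr_ge0 ?mulr_ge0// ltW.
have mT a : measurable_fun W a -> measurable_fun V (T a).
  move=> ma; apply: measurable_funTS; apply/(measurable_restrictT _ mW).
  by apply: measurable_funM => //; exact: smooth_measurable.
have mDT a Da : measurable_fun W a -> (forall i, measurable_fun W (Da i)) ->
    forall i, measurable_fun V (DT a Da i).
  move=> ma mDa i; apply: measurable_funTS; apply/(measurable_restrictT _ mW).
  apply: measurable_funD; apply: measurable_funM => //;
    first exact: smooth_measurable.
  exact: (smooth_measurable (smooth_partial i schi)).
have pointwise a Da x : H1_density (fun=> 1) (T a) (DT a Da) x <=
    k * (H1_density w a Da \_ W) x.
  rewrite /H1_density mul1r /T /DT.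
  have [/set_mem Wx|xW] := boolP (x \in W); last first.
    rewrite !patchE (negbTE xW) expr0n/= mulr0 add0r big1// => i _.
    by rewrite patchE (negbTE xW) expr0n.
  have E f : (f \_ W) x = f x by rewrite patchE ifT// inE.
  rewrite !E; under eq_bigr do rewrite E.
  have [Cx|Cx] := pselect (C x); last first.
    rewrite chi0// mul0r expr0n/= add0r big1 => [|i _]; last first.
      by rewrite Dchi0// !mul0r addr0 expr0n.
    by rewrite mulr_ge0//; exact: (H1_density_ge0 _ _ (w0 x Wx)).
  have sqM (b : R) : `|b| <= M -> b ^+ 2 <= M ^+ 2.
    by move=> bM; rewrite -real_normK ?num_real// lerXn2r ?nnegrE.
  set S := \sum_(i < n) Da i x ^+ 2.
  have S0 : 0 <= S by apply: sumr_ge0 => i _; exact: sqr_ge0.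
  have h1 : (chi x * a x) ^+ 2 <= M ^+ 2 * a x ^+ 2.
    by rewrite exprMn ler_wpM2r ?sqr_ge0// sqM// chiM.
  have h2 : \sum_(i < n) (chi x * Da i x + partial i chi x * a x) ^+ 2 <=
      2 * M ^+ 2 * S + 2 * n%:R * (M ^+ 2 * a x ^+ 2).
    apply: (@le_trans _ _ (\sum_(i < n)
       (2 * M ^+ 2 * Da i x ^+ 2 + 2 * (M ^+ 2 * a x ^+ 2)))).
      apply: ler_sum => i _; apply: le_trans (sqrDl_le _ _) _.
      rewrite !exprMn -mulrA; apply: lerD; (apply: ler_wpM2l => //);
        (apply: ler_wpM2r; first exact: sqr_ge0); apply: sqM.
        exact: chiM.
      exact: DchiM.
    rewrite big_split/= -mulr_sumr sumr_const card_ord lerD2l.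
    by rewrite le_eqVlt -mulr_natr; apply/orP; left; apply/eqP; ring.
  have h3 : M ^+ 2 * a x ^+ 2 <= M ^+ 2 / m * (w x * a x ^+ 2).
    rewrite -mulrA; apply: ler_wpM2l; first exact: sqr_ge0.
    rewrite mulrA; apply: ler_peMl; first exact: sqr_ge0.
    by rewrite ler_pdivlMl// mulr1 mP.
  have h4 : 0 <= M ^+ 2 / m * S by rewrite mulr_ge0// divr_ge0 ?sqr_ge0// ltW.
  have h5 : 0 <= w x * a x ^+ 2 by rewrite mulr_ge0 ?sqr_ge0 ?w0.
  have n0 : 0 <= n%:R :> R by [].
  have h6 : 0 <= n%:R * (M ^+ 2 / m * S) by exact: mulr_ge0.
  have h7 : n%:R * (M ^+ 2 * a x ^+ 2) <= n%:R * (M ^+ 2 / m * (w x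
    * a x ^+ 2)).
    exact: ler_wpM2l.
  have h8 : 0 <= M ^+ 2 * (w x * a x ^+ 2) by rewrite mulr_ge0 ?sqr_ge0.
  have -> : k * (w x * a x ^+ 2 + S) = M ^+ 2 / m * (w x * a x ^+ 2)
    + 2 * (n%:R * (M ^+ 2 / m * (w x * a x ^+ 2)))
    + 2 * (M ^+ 2 * (w x * a x ^+ 2)) + M ^+ 2 / m * S
    + 2 * (n%:R * (M ^+ 2 / m * S)) + 2 * M ^+ 2 * S by rewrite /k; ring.
  lra.
(* The slots [b], [Db] are for the error made by dilating the cutoff, while [a], [Da] are for the
   approximation error on [W]. With [b = 0] the same estimate gives finiteness of the norm. *)
have key a Da b Db : measurable_fun W a ->
  (forall i, measurable_fun W (Da i)) ->
    measurable_fun V b -> (forall i, measurable_fun V (Db i)) ->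
    (H1_norm_sq (fun=> 1%R) V (fun x => (T a x + b x)%R)
      (fun i x => (DT a Da i x + Db i x)%R)
    <= (2 * k)%:E * H1_norm_sq w W a Da
      + 2%:E * H1_norm_sq (fun=> 1%R) V b Db)%E.
  move=> ma mDa mb mDb.
  have md : measurable_fun W (H1_density w a Da) by exact:
    measurable_H1_density.
  have d0 x : W x -> 0 <= H1_density w a Da x by move=> /w0;
    exact: H1_density_ge0.
  have mdW : measurable_fun V (H1_density w a Da \_ W).
    by apply: measurable_funTS; apply/(measurable_restrictT _ mW).
  have d2k : 0 <= 2 * k by rewrite mulr_ge0.
  apply: (@le_trans _ _ ((2 * k)%:E * \int[mu]_(x in V)
    ((H1_density w a Da \_ W) x)%:E
       + 2%:E * H1_norm_sq (fun=> 1%R) V b Db)%E); last first.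
    by apply: leeD2r; apply: lee_wpmul2l => //; exact: ge0_integral_patch_le.
  apply: (@ge0_le_integral_combination _ _ V _ (H1_density (fun=> 1) b Db)
    (H1_density (fun=> 1) (fun x => T a x + b x)
      (fun i x => DT a Da i x + Db i x))) => //.
  - apply: measurable_H1_density => //.
      by apply: measurable_funD => //; exact: mT.
    by move=> i; apply: measurable_funD => //; exact: mDT.
  - exact: measurable_H1_density.
  - by move=> x _; exact: H1_density_ge0.
  - by move=> x _; rewrite patchE; case: ifP => // /set_mem/d0.
  - by move=> x _; exact: H1_density_ge0.
  - move=> x _; apply: le_trans (H1_densityD _ _ _ _ _) _ => //.
    by rewrite lerD2r -mulrA ler_wpM2l.
exists (DT u Du); split.
- exact: (is_weak_grad_cutoff oV oW cC).
- have := key u Du (fun=> 0) (fun _ _ => 0) mu_u mDu (measurable_cst _)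
    (fun _ => measurable_cst _).
  rewrite [X in (_ <= _ + _ * X)%E](_ : _ = 0%E); last first.
    apply: integral0_eq => x _.
    by rewrite expr0n/= mulr0 add0r big1// => i _; rewrite expr0n.
  rewrite mule0 adde0 => h.
  have : ((2 * k)%:E * H1_norm_sq w W u Du < +oo)%E.
    by apply: lte_mul_pinfty => //; rewrite lee_fin mulr_ge0.
  apply: le_lt_trans; apply: le_trans h; rewrite le_eqVlt; apply/orP; left;
    apply/eqP.
  congr H1_norm_sq; first by apply/funext => x; rewrite addr0.
  by apply/funext => i; apply/funext => x; rewrite addr0.
move=> delta d0.
(* [k + 1] replaces [k], which may be zero. Both errors in [key] are then bounded by [delta / 2],
   one of them strictly through this tolerance and the other through [delta / 4]. *)
have k10 : 0 < 2 * (k + 1) by rewrite mulr_gt0// ltr_wpDl.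
have d1 : 0 < delta / 2 / (2 * (k + 1)) by rewrite !divr_gt0.
have [eta teta neta] := au _ d1.
have [seta _ _] := teta.
have d4 : 0 < delta / 4 by rewrite divr_gt0.
have /nbhs_ballP[e /= e0 eP] := H1_norm_sq_cutoff_dil mV schi teta d4.
have [s [se s0 ts]] := tdil e e0.
have nbound := eP s se s0.
have sd := smooth_dil s0 schi.
exists (fun x => dil s chi x * eta x); first exact: ts.
(* [T] and [DT] are zero off [W] by convention. The two decompositions below remain valid there
   because [eta] and its partial derivatives vanish off [W]. *)
have eta0 x : x \notin W -> eta x = 0.
  move=> xW; apply: (@tsupp0 _ _ eta) => xs; have [_ _ /(_ x xs) Wx] := teta.
  by move: xW; rewrite notin_setE.
have Deta0 i x : x \notin W -> partial i eta x = 0.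
  move=> xW; apply: (@tsupp0 _ _ (partial i eta)) => xs.
  have [_ _ /(_ x xs) Wx] := test_function_partial i teta.
  by move: xW; rewrite notin_setE.
have -> : (fun x => ((fun x => chi x * u x) \_ W) x - dil s chi x * eta x) =
  (fun x => T (fun y => u y - eta y) x + (chi x * eta x - dil s chi x * eta x)).
  apply/funext => x; rewrite /T !patchE; case: ifPn => [_|/eta0 ->];
    first by ring.
  by rewrite !mulr0 subrr addr0.
have -> : (fun i x => DT u Du i x - partial i (fun x => dil s chi x
  * eta x) x) =
  (fun i x => DT (fun y => u y - eta y)
    (fun i y => Du i y - partial i eta y) i x +
    (partial i (fun y => chi y * eta y) x - partial i (fun y => dil s chi y
      * eta y) x)).
  apply/funext => i; apply/funext => x.
  have dchi := smooth_derivable schi; have deta := smooth_derivable seta.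
  rewrite (partialM (dchi i) (deta i)).
  rewrite /DT !patchE; case: ifPn => [_|xW]; first by ring.
  by rewrite (eta0 _ xW) (Deta0 _ _ xW); ring.
apply: le_lt_trans (key _ _ _ _ _ _ _ _) _.
- by apply: measurable_funB => //; exact: smooth_measurable.
- by move=> i; apply: measurable_funB => //;
    exact: (smooth_measurable (smooth_partial i seta)).
- apply: measurable_funB; apply: smooth_measurable;
    first exact: (smoothM schi seta).
  exact: (smoothM sd seta).
- move=> i; apply: measurable_funB; apply: smooth_measurable.
    exact: (smooth_partial i (smoothM schi seta)).
  exact: (smooth_partial i (smoothM sd seta)).
have -> : delta%:E = ((2 * (k + 1))%:E * (delta / 2 / (2 * (k + 1)))%:E
  + 2%:E * (delta / 4)%:E)%E.
  rewrite -!EFinM -EFinD; congr EFin.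
  have : k + 1 != 0 by rewrite gt_eqF// ltr_wpDl.
  by move=> ?; field.
apply: lteD; last by rewrite lte_pmul2l.
apply: (@le_lt_trans _ _ ((2 * (k + 1))%:E *
   H1_norm_sq w W (fun y => (u y - eta y)%R)
     (fun i y => (Du i y - partial i eta y)%R))%E).
  apply: lee_wpmul2r; last by rewrite lee_fin; lra.
  by apply: integral_ge0 => x /w0 wx; rewrite lee_fin;
    exact: (@H1_density_ge0 _ _ w (fun y => u y - eta y)
    (fun i y => Du i y - partial i eta y) x wx).
by rewrite lte_pmul2l.
Qed.

End H1_closure_cutoff.

(** * Poincare inequality and uniqueness *)

Section line_integral.
Variables (R : realType) (n : nat).
Implicit Types (g : 'rV[R]_n -> R).

Lemma is_derive_line g (c v : 'rV[R]_n) (t : R) :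
  derivable g (c + t *: v) v ->
  is_derive t (1 : R) (fun s : R => g (c + s *: v)) ('D_v g (c + t *: v)).
Proof.
move=> dg; have E : (fun h : R => h^-1 *: (((fun s : R => g (c
  + s *: v)) \o shift t) (h *: (1 : R))
      - g (c + t *: v))) =
   (fun h : R => h^-1 *: ((g \o shift (c + t *: v)) (h *: v) - g (c + t *: v))).
  apply/funext => h /=; congr (_ *: (g _ - _)).
  by rewrite scalerDl addrCA /GRing.scale/= mulr1.
by apply: DeriveDef; [rewrite /derivable E|rewrite /derive E].
Qed.

Lemma continuous_line (c v : 'rV[R]_n) : continuous (fun s : R => c + s *: v).
Proof. by move=> s; apply: cvgD; [exact: cvg_cst|exact: scalel_continuous]. Qed.

Lemma integral_derivative_line0 g (c v : 'rV[R]_n) (M : R) :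
  continuous g -> (forall x, derivable g x v) ->
    continuous (fun x => 'D_v g x) ->
  (forall t, M < `|t| -> g (c + t *: v) = 0) ->
  (\int[@lebesgue_measure R]_t ('D_v g (c + t *: v))%:E = 0)%E.
Proof.
move=> cg dg cDg g0.
(* The strict bound [M < M'] makes the function vanish at the end points as well, and [0 < M'] makes
   the interval of integration nondegenerate. *)
have [M' M'0 MM'] : exists2 M' : R, 0 < M' & M < M'.
  exists (`|M| + 1); first by rewrite ltr_wpDl.
  by rewrite (le_lt_trans (ler_norm M))// ltrDl.
pose F (s : R) : R := g (c + s *: v); pose f (s : R) : R := 'D_v g (c + s *: v).
have dF s : is_derive s (1 : R) F (f s) by exact: is_derive_line.
have cF : continuous F.
  by move=> s; apply: (@continuous_comp _ _ _ (fun s : R => c + s *: v) g);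
    [exact: continuous_line|exact: cg].
have cf : continuous f.
  by move=> s; apply: (@continuous_comp _ _ _ (fun s : R => c + s *: v)
    (fun x => 'D_v g x));
    [exact: continuous_line|exact: cDg].
have F0 s : M' <= `|s| -> F s = 0 by move=> sM; apply: g0;
  exact: lt_le_trans sM.
have f0 s : M' < `|s| -> f s = 0.
  move=> sM; have [_ <-] := dF s.
  rewrite (@near_eq_derive _ _ _ F (cst 0)) ?derive_cst//.
  have : (fun r : R => `|r|) @ s --> `|s| by exact: norm_continuous.
  move=> /cvgr_gt/(_ M' sM); apply: filterS => r /ltW; exact: F0.
have := @continuous_FTC2 R f F (- M') M'.
move=> /(_ _ _ _ _).
have -> : (\int[@lebesgue_measure R]_t (f t)%:E =
    \int[@lebesgue_measure R]_(t in `[(- M')%R, M']) (f t)%:E)%E.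
  rewrite [RHS]integral_mkcond; apply: eq_integral => s _; rewrite patchE.
  case: ifPn => // sM; rewrite f0//.
  by move: sM; rewrite notin_setE/= in_itv/= => /negP;
    rewrite -ler_norml -ltNge.
move=> ->.
- by rewrite !F0 ?normrN ?ler_norm// subee.
- by rewrite (lt_trans _ M'0)// oppr_lt0.
- exact: continuous_subspaceT.
- split => [s _||].
  + by have [] := dF s.
  + by apply: cvg_at_right_filter; exact: cF.
  + by apply: cvg_at_left_filter; exact: cF.
- by move=> s _; rewrite derive1E; have [_ ->] := dF s.
Qed.

End line_integral.

Section integral_partial0.
Variables (R : realType) (n : nat).
Local Notation mu := (lebesgue_rV R n.+1).
Local Notation e0 := (delta_mx ord0 ord0 : 'rV[R]_n.+1).
Implicit Types (g : 'rV[R]_n.+1 -> R).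

Lemma continuous_test_integrable V g : continuous_test V g ->
  mu.-integrable setT (EFin \o g).
Proof.
move=> [cg kg _]; have tg : continuous_test setT g by split.
have iT : loc_integrable setT (cst 1 : 'rV[R]_n.+1 -> R).
  split=> // K _ cK; apply: measurable_bounded_integrable => //.
  - exact: compact_rV_measurable.
  - exact: compact_rV_finite.
  - by apply: bounded_continuous_compact => //; exact: cst_continuous.
have := loc_integrable_integrableM openT iT tg.
by congr (integrable _ _ _); apply/funext => x; rewrite /= mul1r.
Qed.

(** The measure is built by splitting off coordinate [0], so Fubini reduces the claim to lines
    parallel to [e0], on each of which the fundamental theorem of calculus applies to a compactly
    supported function. *)
Lemma integral_partial0 g : continuous g ->
  (forall x, derivable g x e0) -> continuous (partial ord0 g) ->
  compact (tsupp g) -> \int[mu]_x partial ord0 g x = 0.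
Proof.
move=> cg dg cDg kg.
have tDg : continuous_test setT (partial ord0 g).
  split => //; have ce : closed (tsupp (partial ord0 g)) by exact:
    closed_closure.
  exact: (subclosed_compact ce kg (@tsupp_partial _ _ g ord0)).
have mDg := continuous_rV_measurable cDg.
have /integrableP[_ iDg] := continuous_test_integrable tDg.
pose h := EFin \o partial ord0 g.
have mh : measurable_fun setT h by exact/measurable_EFinP.
pose prod := (@lebesgue_measure R \x lebesgue_rV R n)%E.
have mcons := @measurable_rV_cons R n.
have iprod : prod.-integrable setT (h \o @rV_cons R n).
  apply/integrableP; split; first exact: measurableT_comp.
  move: iDg; rewrite -(@ge0_integral_pushforward _ _ _ _ _ _ mcons prod setT
    (abse \o h))//.
    exact: measurableT_comp.
  by move=> x _; exact: abse_ge0.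
suff E : (\int[mu]_x h x = 0)%E by exact: (congr1 fine E).
have -> : (\int[mu]_x h x = \int[prod]_p h (rV_cons p))%E.
  exact: (@integral_pushforward _ _ _ _ _ _ mcons prod setT h mh iprod).
rewrite -integral21_prod_meas1//; apply: integral0_eq => y _ /=.
have [M [_ HM]] := compact_bounded kg.
pose c : 'rV[R]_n.+1 := rV_cons (0, y).
have cons_line t : rV_cons (t, y) = c + t *: e0.
  apply/rowP => i; rewrite /c !mxE; have [j ->|->] := unliftP ord0 i.
    by rewrite lift_eqF andbF mulr0 addr0.
  by rewrite !eqxx mulr1 add0r.
transitivity (\int[@lebesgue_measure R]_t ('D_e0 g (c + t *: e0))%:E)%E.
  by apply: eq_integral => t _; rewrite /h/= cons_line.
apply: (@integral_derivative_line0 _ _ g c e0 (M + 1)) => // t tM.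
apply: tsupp0 => /(HM (M + 1)); rewrite ltrDl ltr01 => /(_ isT) /= h1.
suff h2 : `|t| <= `|c + t *: e0|.
  by have := lt_le_trans tM (le_trans h2 h1); rewrite ltxx.
rewrite -cons_line [leRHS]/Num.norm/= mx_normrE.
apply/bigmax_geP; right => /=; exists (ord0, ord0) => //.
by rewrite !mxE unlift_none.
Qed.

End integral_partial0.

(** * Poincare inequality, energy estimate and uniqueness for the Dirichlet problem *)

Section uniqueness.
Variables (R : realType) (n : nat).
Local Notation mu := (lebesgue_rV R n.+1).
Local Notation e0 := (delta_mx ord0 ord0 : 'rV[R]_n.+1).
Implicit Types (f g h eta u v z : 'rV[R]_n.+1 -> R) (V K : set 'rV[R]_n.+1).

Lemma is_derive_coord (x : 'rV[R]_n.+1) :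
  is_derive x e0 (fun y : 'rV[R]_n.+1 => y ord0 ord0) 1.
Proof.
suff H : (fun h : R => h^-1 *: (((fun y : 'rV[R]_n.+1 => y ord0 ord0) \o shift
  x) (h *: e0)
    - x ord0 ord0)) @ 0^' --> (1 : R).
  by apply: DeriveDef; [apply/cvg_ex; eexists; exact: H|exact/cvg_lim].
apply: cvg_near_cst; near=> h.
have h0 : h != 0 by near: h; exact: nbhs_dnbhs_neq.
by rewrite /= !mxE !eqxx mulr1 addrK /GRing.scale/= mulVf.
Unshelve. all: by end_near. Qed.

Lemma poincare_test V eta (d : R) : test_function V eta ->
  (forall x, V x -> `|x ord0 ord0| <= d) ->
  \int[mu]_x (eta x ^+ 2) <= 4 * d ^+ 2 * \int[mu]_x (partial ord0 eta x ^+ 2).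
Proof.
move=> teta Vd; have [seta keta etaV] := teta.
pose q := fun y : 'rV[R]_n.+1 => y ord0 ord0.
have cq : continuous q by exact: coord_continuous.
have dq x : derivable q x e0 by have [] := is_derive_coord x.
have Dq : partial ord0 q = fun=> 1.
  by apply/funext => x; have [_] := is_derive_coord x.
have deta x : derivable eta x e0 by exact: smooth_derivable.
have ceta := smooth_continuous seta.
have cDeta := smooth_continuous (smooth_partial ord0 seta).
pose g x := q x * (eta x * eta x).
have dee x : derivable (fun x => eta x * eta x) x e0 by exact: derivableM.
have dg x : derivable g x e0 by exact: derivableM.
have Dg : partial ord0 g = fun x => q x * (2 * (eta x
  * partial ord0 eta x)) + eta x * eta x.
  apply/funext => x; rewrite (partialM dq dee) Dq (partialM deta deta); ring.
have tc := test_function_continuous teta.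
have tD := test_function_continuous (test_function_partial ord0 teta).
have t2 : continuous_test V (fun x => eta x * eta x) by exact: continuous_testM.
have tg : continuous_test V g by exact: continuous_testM.
have tDD : continuous_test V (fun x => partial ord0 eta x * partial ord0 eta x).
  exact: continuous_testM.
have tqD : continuous_test V (fun x => q x * (2 * (eta x
  * partial ord0 eta x))).
  apply: continuous_testM => //; apply: continuous_testM;
    first exact: cst_continuous.
  exact: continuous_testM.
have cDg : continuous (partial ord0 g).
  by rewrite Dg; have [] := continuous_testD tqD t2.
have [_ kg _] := tg.
have cg : continuous g by case: tg.
have I0 := integral_partial0 cg dg cDg kg.
have i2 : mu.-integrable setT (EFin \o (fun x => eta x ^+ 2)).
  have := continuous_test_integrable t2.
  by congr (integrable _ _ _); apply/funext => x; rewrite /= expr2.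
have iDD : mu.-integrable setT (EFin \o (fun x => partial ord0 eta x ^+ 2)).
  have := continuous_test_integrable tDD.
  by congr (integrable _ _ _); apply/funext => x; rewrite /= expr2.
have iDg : mu.-integrable setT (EFin \o partial ord0 g).
  by rewrite Dg; exact: (continuous_test_integrable (continuous_testD tqD t2)).
have ilhs : mu.-integrable setT (EFin \o (fun x => 2^-1 * eta x ^+ 2)).
  by have := integrableZl measurableT 2^-1 i2.
have iDD2 : mu.-integrable setT (EFin \o (fun x => 2 * d ^+ 2
  * partial ord0 eta x ^+ 2)).
  by have := integrableZl measurableT (2 * d ^+ 2) iDD.
have irhs : mu.-integrable setT (EFin \o (fun x => partial ord0 g x
  + 2 * d ^+ 2 * partial ord0 eta x ^+ 2)).
  by have := integrableD measurableT iDg iDD2.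
have : \int[mu]_x (2^-1 * eta x ^+ 2) <=
    \int[mu]_x (partial ord0 g x + 2 * d ^+ 2 * partial ord0 eta x ^+ 2).
  apply: le_Rintegral => // x _; rewrite Dg.
  have [Vx|Vx] := pselect (V x); last first.
    have ex : eta x = 0 by apply: tsupp0 => /etaV.
    have Dex : partial ord0 eta x = 0.
      by apply: (@tsupp0 _ _ (partial ord0 eta)) => /tsupp_partial/etaV.
    by rewrite ex Dex !expr0n/= !mulr0 addr0.
  have h1 : (q x * partial ord0 eta x) ^+ 2 <= d ^+ 2 * partial ord0 eta x ^+ 2.
    rewrite exprMn ler_wpM2r ?sqr_ge0// -[X in X <= _]real_normK ?num_real//.
    rewrite lerXn2r ?nnegrE ?Vd//; exact: le_trans (normr_ge0 _) (Vd _ Vx).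
  (* Completing the square pointwise replaces Cauchy-Schwarz: half of this square equals
     $\partial_0g+2q^2(\partial_0\eta)^2-\eta^2/2$. Integrating, with $\int\partial_0g=0$ and
     $|q|\le d$, produces the constant $4d^2$. *)
  have := sqr_ge0 (eta x + 2 * (q x * partial ord0 eta x)).
  rewrite sqrrD exprMn; nra.
rewrite RintegralZl// RintegralD// I0 add0r RintegralZl//; lra.
Qed.

Lemma Rintegral_sum V (I : Type) (s : seq I) (F : I -> 'rV[R]_n.+1 -> R) :
  measurable V -> (forall i, mu.-integrable V (EFin \o F i)) ->
  mu.-integrable V (EFin \o (fun x => \sum_(i <- s) F i x)) /\
  \int[mu]_(x in V) (\sum_(i <- s) F i x) = \sum_(i <- s) \int[mu]_(x in V) F i
    x.
Proof.
move=> mV iF; elim: s => [|i s [IH1 IH2]].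
  have -> : (fun x : 'rV[R]_n.+1 => \sum_(i <- [::]) F i x) = cst 0.
    by apply/funext => x; rewrite big_nil.
  rewrite big_nil; split; first exact: integrable0.
  by rewrite /Rintegral integral0.
have -> : (fun x => \sum_(j <- i :: s) F j x) =
    (fun x => F i x + \sum_(j <- s) F j x).
  by apply/funext => x; rewrite big_cons.
by rewrite big_cons -IH2 -RintegralD//; split => //;
  have := integrableD mV (iF i) IH1.
Qed.

(** [z] itself cannot be used as a test function, so the energy argument is run on its
    approximations [eta]: their gradients are small because they are orthogonal to [Dz], Poincare
    makes [eta] small in $L^2$, and hence [z] is. *)
Lemma H10_harmonic_eq0 V z (d : R) : open V ->
  (forall x, V x -> `|x ord0 ord0| <= d) -> H10 V z ->
  is_weak_laplacian V z (fun=> 0) -> ae_eq mu V z (fun=> 0).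
Proof.
move=> oV Vd [Dz [gz _ az]] [_ _ lz]; have mV := open_rV_measurable oV.
have [[mz iz] iDz zDz] := gz.
have mDz i : measurable_fun V (Dz i) by have [] := iDz i.
(* The [i]-th component of the weak gradient is tested with [partial i eta]; the sum is the pairing
   of [z] with [laplacian eta], which vanishes. *)
have energy eta : test_function V eta ->
    mu.-integrable V (EFin \o (fun x => \sum_(i < n.+1)
      (Dz i x * partial i eta x))) /\
    \int[mu]_(x in V) (\sum_(i < n.+1) (Dz i x * partial i eta x)) = 0.
  move=> teta.
  have tDD i := test_function_continuous (test_function_partial i
    (test_function_partial i teta)).
  have ii i := loc_integrable_integrableM oV (iDz i)
    (test_function_continuous (test_function_partial i teta)).
  have [i1 i2] := Rintegral_sum (index_enum 'I_n.+1) mV ii.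
  split; first exact: i1.
  rewrite i2; apply: oppr_inj; rewrite oppr0 -sumrN.
  under eq_bigr => i _ do rewrite -(zDz _ (test_function_partial i teta)).
  rewrite -pairing_sumr//.
  transitivity (\int[mu]_(x in V) (z x * laplacian eta x)) => //.
  rewrite lz//; under eq_Rintegral do rewrite mul0r.
  by rewrite /Rintegral integral0.
pose N (a : 'rV[R]_n.+1 -> R) Da := H1_norm_sq (fun=> 1) V a Da.
have density_ge0 (a : 'rV[R]_n.+1 -> R) Da x : 0 <= H1_density (fun=> 1) a Da x.
  exact: H1_density_ge0.
(* Expanding $|Dz-\nabla\eta|^2\ge|\nabla\eta|^2-2\,Dz\cdot\nabla\eta$ and integrating, the mixed
   term disappears by [energy]. *)
have small eta delta : test_function V eta ->
    (N (fun x => (z x - eta x)%R)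
      (fun i x => (Dz i x - partial i eta x)%R) < delta%:E)%E ->
    \int[mu]_x (partial ord0 eta x ^+ 2) <= delta.
  move=> teta; rewrite /N.
  set dz := H1_density (fun=> 1) (fun x => z x - eta x)
    (fun i x => Dz i x - partial i eta x).
  have seta : smooth eta by case: teta.
  have mdz : measurable_fun V dz.
    apply: measurable_H1_density => //.
      by apply: measurable_funB => //; exact: smooth_measurable.
    by move=> i; apply: measurable_funB => //;
      exact: (smooth_measurable (smooth_partial i seta)).
  rewrite -[H1_norm_sq _ _ _ _]/(\int[mu]_(x in V) (dz x)%:E)%E => ndz.
  have idz : mu.-integrable V (EFin \o dz).
    apply/integrableP; split; first exact/measurable_EFinP.
    rewrite (_ : (\int[mu]_(x in V) _)%E = (\int[mu]_(x in V) (dz x)%:E)%E).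
      by rewrite (lt_trans ndz)// ltry.
    by apply: eq_integral => x _; rewrite /= (ger0_norm (density_ge0 _ _ x)).
  have rdz : \int[mu]_(x in V) dz x <= delta.
    by rewrite -lee_fin fineK ?ltW//; exact: integrable_fin_num.
  have [iP P0] := energy _ teta.
  pose S x := \sum_(i < n.+1) partial i eta x * partial i eta x.
  have tDD i : continuous_test V (fun x => partial i eta x * partial i eta x).
    have [cD _ _] := test_function_continuous (test_function_partial i teta).
    exact: (continuous_testM cD (test_function_continuous
      (test_function_partial i teta))).
  have tS : continuous_test V S by exact: continuous_test_sum.
  have iS : mu.-integrable V (EFin \o S).
    exact: (integrableS measurableT mV (@subsetT _ _)
      (continuous_test_integrable tS)).
  pose P x := \sum_(i < n.+1) (Dz i x * partial i eta x).
  have i2P : mu.-integrable V (EFin \o (fun x => - 2 * P x)).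
    by have := integrableZl mV (- 2) iP.
  have iSP : mu.-integrable V (EFin \o (fun x => S x + - 2 * P x)).
    by have := integrableD mV iS i2P.
  have : \int[mu]_(x in V) (S x + - 2 * P x) <= \int[mu]_(x in V) dz x.
    apply: le_Rintegral => // x Vx; rewrite /dz /H1_density mul1r.
    rewrite /S /P mulr_sumr -big_split/=.
    apply: (@le_trans _ _ (\sum_(i < n.+1) (Dz i x - partial i eta x) ^+ 2)).
      by apply: ler_sum => i _; rewrite sqrrB; have := sqr_ge0 (Dz i x); lra.
    by rewrite lerDr sqr_ge0.
  rewrite RintegralD// RintegralZl// P0 mulr0 addr0 => Sdz.
  apply: le_trans (le_trans Sdz rdz).
  have -> : \int[mu]_x (partial ord0 eta x ^+ 2) =
      \int[mu]_(x in V) (partial ord0 eta x * partial ord0 eta x).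
    apply: Rintegral_eq_restrict => x; rewrite !patchE in_setT expr2.
    case: ifPn => //; rewrite notin_setE => Vx.
    have -> : partial ord0 eta x = 0; last by rewrite mulr0.
    apply: (@tsupp0 _ _ (partial ord0 eta)).
    by move=> /tsupp_partial; case: teta => _ _ eV /eV.
  apply: le_Rintegral => //.
    exact: (integrableS measurableT mV (@subsetT _ _)
      (continuous_test_integrable (tDD ord0))).
  move=> x _; rewrite /S (bigD1 ord0)//= lerDl sumr_ge0// => i _.
  by rewrite -expr2 sqr_ge0.
(* $z^2\le2(z-\eta)^2+2\eta^2$, where the integrals of $(z-\eta)^2$ and $\eta^2$ are at most [delta]
   and [4 * d ^+ 2 * delta]. *)
suff small2 delta : 0 < delta ->
    (\int[mu]_(x in V) (z x ^+ 2)%:E <= ((2 + 8 * d ^+ 2) * delta)%:E)%E.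
  have C0 : 0 < 2 + 8 * d ^+ 2 by rewrite ltr_wpDr// mulr_ge0// sqr_ge0.
  have z0 : (\int[mu]_(x in V) (z x ^+ 2)%:E = 0)%E.
    apply/eqP; rewrite eq_le integral_ge0 ?andbT; last first.
      by move=> x _; rewrite lee_fin sqr_ge0.
    apply/lee_addgt0Pr => e e0; rewrite add0e.
    have := small2 _ (divr_gt0 e0 C0).
    by rewrite mulrC divfK// gt_eqF.
  have mz2 : measurable_fun V (fun x => (z x ^+ 2)%:E).
    by apply/measurable_EFinP; exact: measurable_funX.
  have [+ _] := ae_eq_integral_abs mu mV mz2.
  have -> : (\int[mu]_(x in V) `|(z x ^+ 2)%:E| = 0)%E.
    rewrite -z0; apply: eq_integral => x _.
    by rewrite gee0_abs// lee_fin sqr_ge0.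
  move=> /(_ erefl); apply: filterS => x h Vx.
  by have := h Vx => -[] /eqP; rewrite sqrf_eq0 => /eqP.
move=> d0; have [eta teta neta] := az _ d0.
have h1 := small _ _ teta neta.
have h2 := poincare_test teta Vd.
have seta : smooth eta by case: teta.
have me := @smooth_measurable _ _ V _ seta.
have t2 : continuous_test V (fun x => eta x * eta x).
  exact: (continuous_testM (smooth_continuous seta)
    (test_function_continuous teta)).
have ie : mu.-integrable setT (EFin \o (fun x => eta x ^+ 2)).
  have := continuous_test_integrable t2.
  by congr (integrable _ _ _); apply/funext => x; rewrite /= expr2.
have h3 : (\int[mu]_(x in V) (eta x ^+ 2)%:E <= (4 * d ^+ 2 * delta)%:E)%E.
  apply: (@le_trans _ _ (\int[mu]_x (eta x ^+ 2)%:E)%E).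
    apply: ge0_subset_integral => //.
      by apply/measurable_EFinP; apply: measurable_funX;
        exact: smooth_measurable.
    by move=> x _; rewrite lee_fin sqr_ge0.
  rewrite -[X in (X <= _)%E]fineK; last exact: integrable_fin_num.
  by rewrite lee_fin (le_trans h2)// ler_wpM2l// mulr_ge0// sqr_ge0.
have h4 : (\int[mu]_(x in V) ((z x - eta x) ^+ 2)%:E <= delta%:E)%E.
  apply: le_trans (ltW neta); apply: ge0_le_integral => //.
  - by move=> x _; rewrite lee_fin sqr_ge0.
  - by apply/measurable_EFinP; apply: measurable_funX; exact: measurable_funB.
  - apply/measurable_EFinP; apply: measurable_H1_density => //.
      exact: measurable_funB.
    by move=> i; apply: measurable_funB => //;
      exact: (smooth_measurable (smooth_partial i seta)).
  - move=> x _; rewrite lee_fin mul1r lerDl sumr_ge0// => i _; exact: sqr_ge0.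
have h5 : (\int[mu]_(x in V) (z x ^+ 2)%:E <=
    2%:E * \int[mu]_(x in V) ((z x - eta x) ^+ 2)%:E
   + 2%:E * \int[mu]_(x in V) (eta x ^+ 2)%:E)%E.
  apply: ge0_le_integral_combination => //.
  - exact: measurable_funX.
  - by apply: measurable_funX; exact: measurable_funB.
  - exact: measurable_funX.
  - by move=> x _; exact: sqr_ge0.
  - by move=> x _; exact: sqr_ge0.
  - by move=> x _; exact: sqr_ge0.
  - by move=> x _; have := sqrDl_le (z x - eta x) (eta x); rewrite subrK.
apply: le_trans h5 _.
have -> : ((2 + 8 * d ^+ 2) * delta)%:E =
   (2%:E * delta%:E + 2%:E * (4 * d ^+ 2 * delta)%:E)%E.
  by rewrite -!EFinM -EFinD; congr EFin; ring.
by apply: leeD; apply: lee_wpmul2l.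
Qed.

End uniqueness.

(** * Euclidean balls *)

Section euclidean_balls.
Variables (R : realType) (n : nat).
Implicit Types (x : 'rV[R]_n) (h chi : 'rV[R]_n -> R) (D : set 'rV[R]_n)
  (r : R).

Lemma closed_enorm_le r : closed [set x : 'rV[R]_n | enorm x <= r].
Proof.
apply: (preimage_closed (D := [set t : R | t <= r])); last exact: closed_le.
by move=> x _; exact: enorm_continuous.
Qed.

Lemma closed_enorm_ge r : closed [set x : 'rV[R]_n | r <= enorm x].
Proof.
apply: (preimage_closed (D := [set t : R | r <= t])); last exact: closed_ge.
by move=> x _; exact: enorm_continuous.
Qed.

Lemma open_enorm_lt r : open [set x : 'rV[R]_n | enorm x < r].
Proof.
apply: (@open_comp _ _ (@enorm R n) [set t : R | t < r]); last exact: open_lt.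
by move=> x _; exact: enorm_continuous.
Qed.

Lemma open_enorm_gt r : open [set x : 'rV[R]_n | r < enorm x].
Proof.
apply: (@open_comp _ _ (@enorm R n) [set t : R | r < t]); last exact: open_gt.
by move=> x _; exact: enorm_continuous.
Qed.

Lemma coord_le_enorm x i : `|x ord0 i| <= enorm x.
Proof.
rewrite /enorm -sqrtr_sqr ler_wsqrtr// (bigD1 i)//= lerDl sumr_ge0// => j _.
exact: sqr_ge0.
Qed.

Lemma norm_le_enorm x : `|x| <= enorm x.
Proof.
rewrite [leLHS]/Num.norm/= mx_normrE; apply: bigmax_le; first exact: enorm_ge0.
by move=> [i j] _ /=; rewrite (ord1 i); exact: coord_le_enorm.
Qed.

Lemma compact_enorm_le r : compact [set x : 'rV[R]_n | enorm x <= r].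
Proof.
apply: bounded_closed_compact; last exact: closed_enorm_le.
exists r; split; first exact: num_real.
by move=> M rM x /= xr;
  rewrite (le_trans (norm_le_enorm x))// (le_trans xr)// ltW.
Qed.

Lemma open_radial D x : open D -> D x -> exists2 d : R, 0 < d &
  forall t, `|1 - t| < d -> D (t *: x).
Proof.
move=> oD Dx; have : (fun t : R => t *: x) @ (1 : R) --> (1 : R) *: x.
  exact: scalel_continuous.
rewrite scale1r => /(_ D (open_nbhs_nbhs (conj oD Dx)))/nbhs_ballP[d /= d0 dD].
by exists d => // t td; exact: dD.
Qed.

Lemma open_radial_gt D x : open D -> D x -> exists2 t : R, 1 < t & D (t *: x).
Proof.
move=> oD /(open_radial oD)[d d0 dD]; exists (1 + d / 2).
  by rewrite ltrDl divr_gt0.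
by apply: dD; rewrite opprD addNKr normrN gtr0_norm ?divr_gt0// ltr_pdivrMr//
  ltr_pMr// ltr1n.
Qed.

Lemma open_radial_lt D x : open D -> D x ->
  exists t : R, [/\ 0 < t, t < 1 & D (t *: x)].
Proof.
move=> oD /(open_radial oD)[d d0 dD].
pose m := Num.min (d / 2) (1 / 2).
have m0 : 0 < m by rewrite lt_min !divr_gt0.
have m1 : m < 1 by rewrite gt_min; apply/orP; right;
  rewrite ltr_pdivrMr// mul1r ltr1n.
exists (1 - m); split; rewrite ?subr_gt0 ?ltrBlDr ?ltrDl//.
apply: dD; rewrite opprB addrC subrK gtr0_norm// gt_min.
by rewrite ltr_pdivrMr// ltr_pMr// ltr1n.
Qed.

(** A nonzero value on the sphere would persist at [t *: x] for some [t < 1], hence inside the open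
    ball. *)
Lemma continuous_eq0_ball h r : continuous h -> 0 < r ->
  (forall x, enorm x < r -> h x = 0) -> forall x, enorm x <= r -> h x = 0.
Proof.
move=> ch r0 h0 x xr; apply/eqP/negPn/negP => hx.
have oD : open [set y | h y != 0].
  apply: (@open_comp _ _ h [set t : R | t != 0]); last exact: open_neq.
  by move=> y _; exact: ch.
have [t [t0 t1 /= ht]] := open_radial_lt oD hx.
move/eqP : ht; apply; apply: h0; rewrite enormZ gtr0_norm//.
by rewrite (le_lt_trans (ler_wpM2l (ltW t0) xr))// gtr_pMl.
Qed.

Lemma continuous_eq0_ballC h r : continuous h -> 0 < r ->
  (forall x, r < enorm x -> h x = 0) -> forall x, r <= enorm x -> h x = 0.
Proof.
move=> ch r0 h0 x xr; apply/eqP/negPn/negP => hx.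
have oD : open [set y | h y != 0].
  apply: (@open_comp _ _ h [set t : R | t != 0]); last exact: open_neq.
  by move=> y _; exact: ch.
have [t t1 /= ht] := open_radial_gt oD hx.
have t0 : 0 < t by exact: lt_trans t1.
move/eqP : ht; apply; apply: h0; rewrite enormZ gtr0_norm//.
by rewrite (lt_le_trans _ (ler_wpM2l (ltW t0) xr))// ltr_pMl.
Qed.

Lemma laplacian_eq_cst h (c : R) D : open D -> (forall x, D x -> h x = c) ->
  forall x, D x -> laplacian h x = 0.
Proof.
move=> oD hD x Dx; rewrite /laplacian big1// => i _.
by apply: (partial_eq_cst _ oD) (Dx) => y Dy; exact: (partial_eq_cst _ oD hD).
Qed.

(** Including the bounding sphere matters: [Om] and [eps P] may disagree on the interface spheres,
    so the derivatives of the cutoffs have to vanish there too. *)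
Lemma smooth_cst_ball chi r c : smooth chi -> 0 < r ->
  (forall x, enorm x < r -> chi x = c) -> forall x, enorm x <= r ->
  (forall i, partial i chi x = 0) /\ laplacian chi x = 0.
Proof.
move=> schi r0 chic x xr; split.
  move=> i; move: x xr; apply: continuous_eq0_ball => //.
    exact: (smooth_continuous (smooth_partial i schi)).
  exact: (partial_eq_cst i (@open_enorm_lt r) chic).
move: x xr; apply: continuous_eq0_ball => //.
  exact: (smooth_continuous (smooth_laplacian schi)).
exact: (laplacian_eq_cst (@open_enorm_lt r) chic).
Qed.

Lemma smooth_cst_ballC chi r c : smooth chi -> 0 < r ->
  (forall x, r < enorm x -> chi x = c) -> forall x, r <= enorm x ->
  (forall i, partial i chi x = 0) /\ laplacian chi x = 0.
Proof.
move=> schi r0 chic x xr; split.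
  move=> i; move: x xr; apply: continuous_eq0_ballC => //.
    exact: (smooth_continuous (smooth_partial i schi)).
  exact: (partial_eq_cst i (@open_enorm_gt r) chic).
move: x xr; apply: continuous_eq0_ballC => //.
  exact: (smooth_continuous (smooth_laplacian schi)).
exact: (laplacian_eq_cst (@open_enorm_gt r) chic).
Qed.

Lemma smooth_bounded_on_compact chi (K : set 'rV[R]_n) : smooth chi ->
  compact K ->
  exists2 M, 0 <= M & (forall x, K x -> `|chi x| <= M) /\
    (forall i x, K x -> `|partial i chi x| <= M).
Proof.
move=> schi cK.
have [B1 B10 B1P] := continuous_compact_bound (smooth_continuous schi) cK.
have [B2 B20 B2P] := @finite_uniform_bound _ _ _ (fun i => partial i chi) K
  (fun i => continuous_compact_bound (smooth_continuous (smooth_partial i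
    schi)) cK).
exists (B1 + B2); first by rewrite addr_ge0// ltW.
split=> [x Kx|i x Kx]; first by rewrite (le_trans (B1P x Kx))// lerDl ltW.
by rewrite (le_trans (B2P i x Kx))// lerDr ltW.
Qed.

End euclidean_balls.

(** * Perturbed domain *)

Section perturbed_domain_geometry.
Variables (R : realType) (n : nat) (Gam Om P : set 'rV[R]_n) (r0 R0 eps : R).
Hypotheses (hG : generating_triple Gam Om P r0 R0) (eps0 : 0 < eps)
  (epsle : eps <= r0 / R0 / 4).
Implicit Types (x : 'rV[R]_n) (b r : R).
Local Notation V := (perturbed_domain Gam Om P r0 R0 eps).

Let R00 : 0 < R0 := outer_radius hG.
Let r00 : 0 < r0 := inner_radius hG.

Lemma core_radius_gt0 : 0 < eps * R0.
Proof. exact: mulr_gt0. Qed.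

Lemma core_radius_le : 4 * (eps * R0) <= r0.
Proof.
move: epsle; rewrite ler_pdivlMr// ler_pdivlMr// => h.
by rewrite mulrA [4 * eps]mulrC.
Qed.

Let a0 := core_radius_gt0.
Let a4 := core_radius_le.

Lemma core_radius_lt : eps * R0 < r0.
Proof. by move: a0 a4; lra. Qed.

Lemma cone_scale x (t : R) : 0 < t -> Gam (t *: x) <-> Gam x.
Proof.
move=> t0; split=> [|Gx]; last exact: (cone_dil hG).
have ti0 : 0 < t^-1 by rewrite invr_gt0.
by move=> /(cone_dil hG)/(_ ti0); rewrite scalerA mulVf ?gt_eqF// scale1r.
Qed.

Lemma inner_coneE x : enorm x < r0 -> Om x <-> Gam x.
Proof.
move=> xr; have /seteqP[OG GO] := inner_cone hG.
split=> [Ox|Gx]; first by have [] := OG x (conj Ox xr).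
by have [] := GO x (conj Gx xr).
Qed.

Lemma outer_coneE x : R0 < enorm x -> P x <-> Gam x.
Proof.
move=> xr; have := outer_cone hG; rewrite eballCE// => /seteqP[PG GP].
split=> [Px|Gx]; first by have [] := PG x (conj Px xr).
by have [] := GP x (conj Gx xr).
Qed.

(* Openness extends the inclusions to the interface spheres: a point of Om (of
   P) on the sphere can be moved radially to where Om (P) is conical. *)
Lemma inner_cone_closed x : Om x -> enorm x <= r0 -> Gam x.
Proof.
move=> Ox xr; have [t [t0 t1 Ot]] := open_radial_lt (inner_open hG) Ox.
apply/(cone_scale _ t0)/inner_coneE => //.
rewrite enormZ gtr0_norm// (le_lt_trans (ler_wpM2l (ltW t0) xr))//.
by rewrite gtr_pMl.
Qed.

Lemma outer_cone_closed x : P x -> R0 <= enorm x -> Gam x.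
Proof.
move=> Px xr; have [t t1 Pt] := open_radial_gt (outer_open hG) Px.
have t0 : 0 < t by exact: lt_trans t1.
apply/(cone_scale _ t0)/outer_coneE => //.
rewrite enormZ gtr0_norm// (lt_le_trans _ (ler_wpM2l (ltW t0) xr))//.
by rewrite ltr_pMl.
Qed.

Lemma enorm_rapid x : enorm (eps^-1 *: x) = eps^-1 * enorm x.
Proof. by rewrite enormZ gtr0_norm// invr_gt0. Qed.

Lemma rapid_gt r x : (r < enorm (eps^-1 *: x)) = (eps * r < enorm x).
Proof. by rewrite enorm_rapid ltr_pdivlMl. Qed.

Lemma rapid_lt r x : (enorm (eps^-1 *: x) < r) = (enorm x < eps * r).
Proof. by rewrite enorm_rapid ltr_pdivrMl. Qed.

Lemma rapid_ge r x : (r <= enorm (eps^-1 *: x)) = (eps * r <= enorm x).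
Proof. by rewrite enorm_rapid ler_pdivlMl. Qed.

(** The two pieces overlap in the open annulus, where both are the cone. This form no longer
    involves a convention on the spheres and makes openness evident. *)
Lemma perturbed_domainP x :
  V x <-> (Om x /\ eps * R0 < enorm x) \/ (P (eps^-1 *: x) /\ enorm x < r0).
Proof.
have ei0 : 0 < eps^-1 by rewrite invr_gt0.
have ar := core_radius_lt.
rewrite /perturbed_domain /annulus eballCE// closure_eball// /eball.
split=> [[[[Ox /negP]|[Gx [/= ax xr]]]|[/(dilsetE _ _ eps0) Px /= xa]]|].
- by rewrite -leNgt => rx; left; split => //; exact: lt_le_trans rx.
- by left; split => //; exact/inner_coneE.
- by right; split => //; exact: le_lt_trans ar.
move=> [[Ox ax]|[Px xr]].
  have [rx|xr] := leP r0 (enorm x).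
    by left; left; split => //; apply/negP; rewrite -leNgt.
  by left; right; split => //; exact/inner_coneE.
have [xa|ax] := leP (enorm x) (eps * R0).
  by right; split => //; exact/dilsetE.
left; right; split => //; apply/(cone_scale _ ei0)/outer_coneE => //.
by rewrite rapid_gt.
Qed.

Lemma open_perturbed_domain : open V.
Proof.
rewrite (_ : V = (Om `&` [set x | eps * R0 < enorm x]) `|`
    (dilset eps P `&` [set x | enorm x < r0])).
  apply: openU; apply: openI.
  - exact: inner_open hG.
  - exact: open_enorm_gt.
  - exact: open_dilset (outer_open hG).
  - exact: open_enorm_lt.
apply/seteqP; split=> x.
  by move=> /perturbed_domainP[[? ?]|[? ?]]; [left|right; split=> //;
    exact/dilsetE].
by move=> [[Ox ax]|[/(dilsetE _ _ eps0) Px xr]]; apply/perturbed_domainP;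
  [left|right].
Qed.

(** On the sphere of radius [eps * R0] membership in the domain means membership in [eps P], and
    [outer_cone_closed] puts such points into the cone, hence into [Om]. *)
Lemma perturbed_domain_inner :
  V `&` [set x | eps * R0 <= enorm x] `<=` Om.
Proof.
have ei0 : 0 < eps^-1 by rewrite invr_gt0.
move=> x [/perturbed_domainP[[]//|[Px xr]] /= ax].
by apply/inner_coneE/(cone_scale _ ei0)/(outer_cone_closed Px) => //;
  rewrite rapid_ge.
Qed.

Lemma perturbed_domain_outer :
  V `&` [set x | enorm x <= r0] `<=` dilset eps P.
Proof.
have ei0 : 0 < eps^-1 by rewrite invr_gt0.
move=> x [/perturbed_domainP[[Ox ax]|[Px _]] /= xr]; apply/dilsetE => //.
apply/outer_coneE; first by rewrite rapid_gt.
by apply/(cone_scale _ ei0); exact: inner_cone_closed.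
Qed.

(** The radius [b] is strictly larger than [eps * R0]: on that sphere a point of [Om] may be missing
    from [eps P]. This is why the approximating cutoff is dilated outwards. *)
Lemma inner_perturbed_domain b : eps * R0 < b ->
  Om `&` [set x | b <= enorm x] `<=` V.
Proof.
by move=> ab x [Ox /= bx]; apply/perturbed_domainP; left; split => //;
  exact: lt_le_trans bx.
Qed.

Lemma outer_perturbed_domain b : b < r0 ->
  dilset eps P `&` [set x | enorm x <= b] `<=` V.
Proof.
move=> br x [/(dilsetE _ _ eps0) Px /= xb]; apply/perturbed_domainP.
by right; split => //; exact: le_lt_trans br.
Qed.

Lemma matching_region x : eps * R0 < enorm x -> enorm x < r0 ->
  Om x <-> P (eps^-1 *: x).
Proof.
have ei0 : 0 < eps^-1 by rewrite invr_gt0.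
move=> ax xr; rewrite outer_coneE ?rapid_gt//.
by rewrite (cone_scale _ ei0); exact: inner_coneE.
Qed.

End perturbed_domain_geometry.

(** * Glued solution *)

(** Every term contains a derivative of [chi], so the bound holds for whichever gradient [weak_grad]
    selects. The strict inequalities keep the support inside the open shell. *)
Lemma laplacian_commutator_support (R : realType) (n : nat)
    (W : set 'rV[R]_n) (chi w : 'rV[R]_n -> R) (r1 r2 c1 c2 : R) :
  smooth chi -> 0 < r1 -> 0 < r2 ->
  (forall x, enorm x < r1 -> chi x = c1) ->
  (forall x, r2 < enorm x -> chi x = c2) ->
  forall x, laplacian_commutator W chi w x != 0 ->
  [/\ W x, r1 < enorm x & enorm x < r2].
Proof.
move=> schi r10 r20 chi1 chi2 x; rewrite /laplacian_commutator patchE.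
case: ifPn => [/set_mem Wx h|]; last by rewrite eqxx.
have vanish : (forall i, partial i chi x = 0) /\ laplacian chi x = 0 ->
    2 * (\sum_(i < n) partial i chi x * weak_grad W w i x)
      + laplacian chi x * w x = 0.
  move=> [D0 ->]; rewrite mul0r addr0 big1 ?mulr0// => i _.
  by rewrite D0 mul0r.
split=> //; rewrite ltNge; apply/negP => hr; move/eqP : h; apply; apply: vanish.
- exact: (smooth_cst_ball schi r10 chi1).
- exact: (smooth_cst_ballC schi r20 chi2).
Qed.

Section glued_solution.
Variables (R : realType) (n : nat) (Gam Om P : set 'rV[R]_n) (r0 R0 : R)
  (Phi phi : 'rV[R]_n -> R) (eps : R) (f F u U : 'rV[R]_n -> R).
Hypotheses (hG : generating_triple Gam Om P r0 R0) (hc : cutoffs r0 R0 Phi phi)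
  (eps0 : 0 < eps) (epsle : eps <= r0 / R0 / 4)
  (hf : F_inner Om r0 f) (hF : F_outer P R0 F)
  (hu : E_inner Om r0 u) (hU : E_outer P R0 U)
  (eqf : ae_eq (lebesgue_rV R n) Om (block_operator Om P Phi phi eps (u,
    U)).1 f)
  (eqF : ae_eq (lebesgue_rV R n) P (block_operator Om P Phi phi eps (u,
    U)).2 F).
Local Notation mu := (lebesgue_rV R n).
Local Notation V := (perturbed_domain Gam Om P r0 R0 eps).
Local Notation chi := (dil eps Phi).
Local Notation w := (glued_function Om P Phi phi eps (u, U)).
Local Notation rhs := (perturbed_rhs Om P Phi phi eps f F).

Let R00 : 0 < R0 := outer_radius hG.
Let r00 : 0 < r0 := inner_radius hG.
Let a0 : 0 < eps * R0 := core_radius_gt0 hG eps0.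
Let a4 : 4 * (eps * R0) <= r0 := core_radius_le hG epsle.
Let oV : open V := open_perturbed_domain hG eps0 epsle.
Let oOm : open Om := inner_open hG.
Let oP : open P := outer_open hG.
Let oeP : open (dilset eps P) := open_dilset eps0 oP.
Let sPhi : smooth Phi := cutoff_rapid_smooth hc.
Let sphi : smooth phi := cutoff_slow_smooth hc.
Let schi : smooth chi := smooth_dil eps0 sPhi.

Let PhiE0 x : enorm x < R0 -> Phi x = 0.
Proof. exact: (cutoff_rapid0 hc). Qed.

Let PhiE1 x : 2 * R0 < enorm x -> Phi x = 1.
Proof. by move=> h; apply: (cutoff_rapid1 hc); rewrite eballCE// mulr_gt0. Qed.

Let phiE1 x : enorm x < r0 / 2 -> phi x = 1.
Proof. exact: (cutoff_slow1 hc). Qed.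

Let phiE0 x : r0 < enorm x -> phi x = 0.
Proof. by move=> h; apply: (cutoff_slow0 hc); rewrite eballCE. Qed.

Let chi0 x : ~ (eps * R0 <= enorm x) -> chi x = 0.
Proof. by move=> /negP; rewrite -ltNge => ?; apply: PhiE0;
  rewrite rapid_lt. Qed.

Let phi0 x : ~ (enorm x <= r0) -> phi x = 0.
Proof. by move=> /negP; rewrite -ltNge; exact: phiE0. Qed.

Let VC1 : V `&` [set x | eps * R0 <= enorm x] `<=` Om.
Proof. exact: perturbed_domain_inner. Qed.

Let VC2 : V `&` [set x | enorm x <= r0] `<=` dilset eps P.
Proof. exact: perturbed_domain_outer. Qed.

Let cC1 : closed [set x : 'rV[R]_n | eps * R0 <= enorm x] :=
  @closed_enorm_ge R n _.
Let cC2 : closed [set x : 'rV[R]_n | enorm x <= r0] := @closed_enorm_le R n _.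

(** The factor [1] matches the form [u + c * v] of the linearity lemmas. *)
Let wE : w = fun x => ((fun x => chi x * u x) \_ Om) x +
   1 * ((fun x => phi x * dil eps U x) \_ (dilset eps P)) x.
Proof.
apply/funext => x; rewrite /glued_function /= mul1r /dil !patchE.
have -> : (eps^-1 *: x \in P) = (x \in dilset eps P).
  by apply/idP/idP; rewrite !inE => /(dilsetE _ _ eps0).
by do 2 case: ifP => _; rewrite ?mulr0.
Qed.

Let rhsE : rhs = fun x => ((fun x => chi x * f x) \_ Om) x +
   eps ^- 2 * ((fun x => phi x * dil eps F x) \_ (dilset eps P)) x.
Proof.
apply/funext => x; rewrite /perturbed_rhs /= /dil !patchE.
have -> : (eps^-1 *: x \in P) = (x \in dilset eps P).
  by apply/idP/idP; rewrite !inE => /(dilsetE _ _ eps0).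
by do 2 case: ifP => _; rewrite ?mulr0.
Qed.

Let H10_inner : H10 V ((fun x => chi x * u x) \_ Om).
Proof.
have [Hu _] := hu.
have [M0 [_ OM]] := inner_bounded hG.
have kB : compact [set x : 'rV[R]_n | `|x| <= M0 + 1].
  apply: bounded_closed_compact.
    exists (M0 + 1); split; first exact: num_real.
    by move=> M MM x /= /le_trans; apply; exact: ltW.
  apply: (preimage_closed (D := [set t : R | t <= M0 + 1]));
    last exact: closed_le.
  by move=> x _; exact: norm_continuous.
have OB x : Om x -> `|x| <= M0 + 1 by move=> Ox; apply: OM Ox; rewrite ltrDl.
have [M M00 [chiM DchiM]] := smooth_bounded_on_compact schi kB.
apply: (@H1_closure_cutoff _ _ V Om _ (fun=> 1) u chi 1 M oV oOm cC1 schi chi0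
  VC1) => //.
- by move=> x Ox _; exact/chiM/OB.
- by move=> i x Ox _; exact/DchiM/OB.
(* With [s > 1] the dilated cutoff vanishes for [enorm x < s * (eps * R0)], and the part of [Om]
   beyond this radius lies in the perturbed domain. *)
- move=> e e0; exists (1 + e / 2).
  have s1 : 1 < 1 + e / 2 by rewrite ltrDl divr_gt0.
  split.
  + by rewrite opprD addNKr normrN gtr0_norm ?divr_gt0// ltr_pdivrMr//
      ltr_pMr// ltr1n.
  + exact: lt_trans s1.
  + have s0 : 0 < 1 + e / 2 by exact: lt_trans s1.
    set s := 1 + e / 2 in s1 s0 *.
    move=> eta teta; apply: (test_functionM (smooth_dil s0 schi) teta
      (@closed_enorm_ge R n (s * (eps * R0)))).
    * move=> x /= /negP; rewrite -ltNge => xs; rewrite {1}/dil;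
        apply: chi0 => /=.
      by apply/negP; rewrite -ltNge rapid_lt.
    * by apply: inner_perturbed_domain => //; rewrite ltr_pMl.
Qed.

Let H10_outer : H10 V ((fun x => phi x * dil eps U x) \_ (dilset eps P)).
Proof.
have [HU _] := hU.
have mwt : measurable_fun P (fun x : 'rV[R]_n => (1 + enorm x) ^- 2).
  apply: measurable_funTS; apply: continuous_rV_measurable => x.
  have p0 : 0 < 1 + enorm x by rewrite ltr_wpDr// enorm_ge0.
  have n0 : (1 + enorm x) ^+ 2 != 0 by rewrite gt_eqF// exprn_gt0.
  have c1 : (fun y : 'rV[R]_n => 1 + enorm y) @ x --> 1 + enorm x.
    exact: (cvgD (cvg_cst _) (@enorm_continuous R n x)).
  exact: (cvgV n0 (cvg_comp _ _ c1 (@exprn_continuous _ 2 _))).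
have wt0 (x : 'rV[R]_n) : 0 <= (1 + enorm x) ^- 2 by rewrite invr_ge0 sqr_ge0.
have HdU := H1_closure_dil eps0 oP mwt (fun x _ => wt0 x) HU.
have [M M00 [phiM DphiM]] :=
  smooth_bounded_on_compact sphi (@compact_enorm_le R n r0).
(* Where [enorm x <= r0], the rapid variable has norm at most [r0 / eps], so [m] bounds the dilated
   weight from below. *)
pose m := (1 + r0 / eps) ^- 2.
have b0 : 0 < 1 + r0 / eps by rewrite ltr_wpDr// divr_ge0// ltW.
have m0 : 0 < m by rewrite invr_gt0 exprn_gt0.
have mP := open_rV_measurable oP.
apply: (@H1_closure_cutoff _ _ V _ _ _ _ phi m M oV oeP cC2 sphi phi0 VC2 _ _
  m0 _ M00 _ _ _ HdU).
- exact: (measurable_fun_dil eps0 mP mwt).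
- by move=> x _; exact: wt0.
- move=> x _ /= xr; rewrite /dil /m lef_pV2 ?posrE ?exprn_gt0//; last first.
    by rewrite ltr_wpDr// enorm_ge0.
  apply: lerXn2r; rewrite ?nnegrE.
  + by rewrite addr_ge0// enorm_ge0.
  + exact: ltW.
  + by rewrite lerD2l enorm_rapid// mulrC ler_pM2r// invr_gt0.
- by move=> x _; exact: phiM.
- by move=> i x _; exact: DphiM.
(* Here the ratio is below [1], which shrinks the support of [phi] into a ball of radius smaller
   than [r0]. The minimum with [1 / 2] keeps the ratio positive. *)
- move=> e e0; pose mm := Num.min (e / 2) (1 / 2).
  have mm0 : 0 < mm by rewrite lt_min !divr_gt0.
  have mm1 : mm < 1.
    by rewrite gt_min; apply/orP; right; rewrite ltr_pdivrMr// mul1r ltr1n.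
  have mme : mm < e.
    by rewrite gt_min; apply/orP; left; rewrite ltr_pdivrMr// ltr_pMr// ltr1n.
  have s0 : 0 < 1 - mm by rewrite subr_gt0.
  exists (1 - mm); split; [by rewrite opprB addrC subrK gtr0_norm|exact: s0|].
  move=> eta teta; apply: (test_functionM (smooth_dil s0 sphi) teta
      (@closed_enorm_le R n ((1 - mm) * r0))).
  + move=> x /= /negP; rewrite -ltNge => xs; rewrite /dil; apply: phi0 => /=.
    by apply/negP; rewrite -ltNge rapid_gt.
  + by apply: outer_perturbed_domain => //; rewrite gtr_pMl// ltrBlDr ltrDl.
Qed.

Let H10_glued : H10 V w.
Proof. by rewrite wE; exact: (H1_closureD 1 oV H10_inner H10_outer). Qed.

Local Notation g0 := (weak_laplacian Om u).
Local Notation gP := (weak_laplacian P U).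
Local Notation G := (weak_grad (dilset eps^-1 Om) (dil eps^-1 u)).
Local Notation GP := (weak_grad (dilset eps P) (dil eps U)).
Local Notation C1 := (laplacian_commutator (dilset eps^-1 Om) Phi (dil eps^-1
  u)).
Local Notation C2 := (laplacian_commutator (dilset eps P) phi (dil eps U)).

Let eps_neq0 : eps != 0.
Proof. by rewrite gt_eqF. Qed.

Let lap_g0 : is_weak_laplacian Om u g0.
Proof. by have [_ [g _ Hg]] := hu; exact: (xgetPex _ (ex_intro _ g Hg)). Qed.

Let lap_gP : is_weak_laplacian P U gP.
Proof. by have [_ [g _ Hg]] := hU; exact: (xgetPex _ (ex_intro _ g Hg)). Qed.

Let grad_GP : is_weak_grad (dilset eps P) (dil eps U) GP.
Proof.
have [[DU [HDU _ _]] _] := hU.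
exact: (xgetPex _ (ex_intro _ _ (is_weak_grad_dil eps0 oP HDU))).
Qed.

Let grad_G : is_weak_grad (dilset eps^-1 Om) (dil eps^-1 u) G.
Proof.
have [[Du [HDu _ _]] _] := hu; have ei0 : 0 < eps^-1 by rewrite invr_gt0.
exact: (xgetPex _ (ex_intro _ _ (is_weak_grad_dil ei0 oOm HDu))).
Qed.

(** The commutator in the rapid variable contains the gradient selected for [dil eps^-1 u]. Dilating
    that very gradient back gives a weak gradient of [u] for which the commutators match
    pointwise. *)
Let grad_u : is_weak_grad Om u (fun i x => eps^-1 * dil eps (G i) x).
Proof.
have ei0 : 0 < eps^-1 by rewrite invr_gt0.
have := is_weak_grad_dil eps0 (open_dilset ei0 oOm) grad_G.
by rewrite dilsetK// dilK.
Qed.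

(** In the first-order term, [dil eps Phi] and [grad_u] supply one factor [eps^-1] each; in the
    zeroth-order term both come from the Laplacian of [dil eps Phi]. The commutator thus becomes
    [eps ^- 2] times the dilated rapid one. *)
Let lap_inner : is_weak_laplacian V ((fun x => chi x * u x) \_ Om)
  (fun x => ((fun x => chi x * g0 x) \_ Om) x + eps ^- 2 * dil eps C1 x).
Proof.
have := is_weak_laplacian_cutoff oV oOm cC1 schi chi0 VC1 grad_u lap_g0.
congr is_weak_laplacian; apply/funext => x.
rewrite /laplacian_commutator !patchE [X in _ = _ + _ * X]/dil patchE.
have -> : (eps^-1 *: x \in dilset eps^-1 Om) = (x \in Om).
  apply/idP/idP; rewrite !inE.
    by move=> [y Oy /(scalerI _)]; rewrite invr_eq0 => /(_ eps_neq0) <-.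
  by exists x.
case: ifP => _; last by rewrite mulr0 addr0.
congr (_ + _); rewrite mulrDr; congr (_ + _).
  rewrite mulrCA; congr (_ * _); rewrite mulr_sumr; apply: eq_bigr => i _.
  rewrite partial_dil//; last exact: smooth_derivable.
  by rewrite /dil mulrACA -expr2 exprVn.
rewrite laplacian_dil// /dil invrK scalerA divff// scale1r mulrA//.
Qed.

Let lap_outer : is_weak_laplacian V ((fun x => phi x
  * dil eps U x) \_ (dilset eps P))
  (fun x => ((fun x => eps ^- 2 * (phi x
    * dil eps gP x)) \_ (dilset eps P)) x + C2 x).
Proof.
have := is_weak_laplacian_cutoff oV oeP cC2 sphi phi0 VC2 grad_GP
  (is_weak_laplacian_dil eps0 oP lap_gP).
congr is_weak_laplacian; apply/funext => x.
rewrite /laplacian_commutator !patchE; case: ifP => _; last by rewrite addr0.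
by rewrite mulrCA.
Qed.

(** Almost everywhere equality does not transfer measurability for a sigma-algebra that is not
    completed, so the measurability of the right-hand side is derived from [f] and [F]. *)
Let measurable_rhs : measurable_fun V rhs.
Proof.
have [hf2 _] := hf; have [hF2 _] := hF.
have cchi := smooth_continuous schi; have cphi := smooth_continuous sphi.
have [m1 _] := loc_integrable_cutoff oV oOm cC1 cchi chi0 VC1
  (in_L2_loc_integrable oOm hf2).
have [m2 _] := loc_integrable_cutoff oV oeP cC2 cphi phi0 VC2
  (loc_integrable_dil eps0 oP (in_L2_loc_integrable oP hF2)).
by rewrite rhsE; apply: measurable_funD => //; exact: measurable_funM.
Qed.

(** On the shell [r0 / 2 < enorm x < r0], [a4] gives [2 * (eps * R0) <= r0 / 2 < enorm x], beyond
    the transition of [chi]. The companion statement for [C1] reads the same inequality in the other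
    shell. *)
Let C2_support x : C2 x != 0 -> [/\ Om x, P (eps^-1 *: x) & chi x = 1].
Proof.
have r20 : 0 < r0 / 2 by rewrite divr_gt0.
move=> /(laplacian_commutator_support sphi r20 r00 phiE1 phiE0)[/(dilsetE _ _
  eps0) Px rx xr].
have ax : 2 * (eps * R0) < enorm x by apply: le_lt_trans rx;
  rewrite ler_pdivlMr//; move: a4; lra.
split => //; last by apply: PhiE1; rewrite rapid_gt// mulrCA.
by apply/(matching_region hG eps0) => //; apply: lt_trans ax;
  rewrite ltr_pMl// ltr1n.
Qed.

Let C1_support x : C1 (eps^-1 *: x) != 0 ->
  [/\ Om x, P (eps^-1 *: x) & phi x = 1].
Proof.
have R20 : 0 < 2 * R0 by rewrite mulr_gt0.
move=> /(laplacian_commutator_support sPhi R00 R20 PhiE0 PhiE1)[].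
have ei0 : 0 < eps^-1 by rewrite invr_gt0.
move=> /(dilsetE _ _ ei0); rewrite invrK scalerA divff// scale1r => Ox.
rewrite rapid_gt// rapid_lt// mulrCA => ax xa.
have xr : enorm x < r0 / 2 by apply: lt_le_trans xa _; rewrite ler_pdivlMr//;
  move: a4; lra.
split => //; last exact: phiE1.
by apply/(matching_region hG eps0) => //; apply: lt_trans xr _;
  rewrite ltr_pdivrMr// ltr_pMr// ltr1n.
Qed.

(** The equation on [Om] is multiplied by [chi] and the dilated equation on [P] by [eps ^- 2 * phi].
    The support statements allow [chi] and [phi] to be inserted in front of the commutators. Where
    only one of the two sets is present, both commutators vanish. *)
Let lap_glued : is_weak_laplacian V w rhs.
Proof.
have := is_weak_laplacianD 1 oV lap_inner lap_outer; rewrite -wE.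
apply: is_weak_laplacian_ae => //.
have eqF' := ae_dil eps0 eqF.
move: eqf eqF'; apply: filterS2 => x /= fx Fx _.
rewrite rhsE !patchE mul1r [dil eps C1 x]/dil.
have k1 : C2 x = chi x * C2 x.
  by have [->|/C2_support[_ _ ->]] := eqVneq (C2 x) 0; rewrite ?mulr0 ?mul1r.
have k2 : C1 (eps^-1 *: x) = phi x * C1 (eps^-1 *: x).
  by have [->|/C1_support[_ _ ->]] := eqVneq (C1 (eps^-1 *: x)) 0;
    rewrite ?mulr0 ?mul1r.
have [/set_mem Ox|] := boolP (x \in Om);
  have [/set_mem /(dilsetE _ _ eps0) Px|] := boolP (x \in dilset eps P).
- rewrite -fx// [dil eps F x]/dil -Fx//= /M_inner_inner /M_inner_outer
    /M_outer_inner /M_outer_outer !mulrDr -k1 -k2 -/(dil eps gP x).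
  by rewrite [RHS]addrACA; congr (_ + _); exact: addrC.
- rewrite notin_setE => nP;
    have nP' : ~ P (eps^-1 *: x) by move=> /(dilsetE _ _ eps0).
  have z1 : C1 (eps^-1 *: x) = 0 by apply/eqP/negPn/negP => /C1_support[].
  have z2 : C2 x = 0 by apply/eqP/negPn/negP => /C2_support[].
  by rewrite -fx// /= /M_inner_inner /M_inner_outer z1 z2 !mulr0 !addr0.
- rewrite notin_setE => nO.
  have z1 : C1 (eps^-1 *: x) = 0 by apply/eqP/negPn/negP => /C1_support[].
  have z2 : C2 x = 0 by apply/eqP/negPn/negP => /C2_support[].
  by rewrite [dil eps F x]/dil -Fx// /= /M_outer_inner /M_outer_outer z1 z2
    mulr0 !addr0 !add0r.
- rewrite !notin_setE => nP nO.
  have z1 : C1 (eps^-1 *: x) = 0 by apply/eqP/negPn/negP => /C1_support[].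
  have z2 : C2 x = 0 by apply/eqP/negPn/negP => /C2_support[].
  by rewrite z1 z2 !mulr0 !addr0.
Qed.

Lemma perturbed_solution_glued :
  perturbed_solution Gam Om P r0 R0 Phi phi eps f F w.
Proof. by split; [exact: H10_glued|exact: lap_glued]. Qed.

End glued_solution.

Lemma perturbed_solution_unique (R : realType) (n : nat)
    (Gam Om P : set 'rV[R]_n) (r0 R0 : R) (Phi phi : 'rV[R]_n -> R) (eps : R)
    (f F v1 v2 : 'rV[R]_n -> R) :
  (0 < n)%N -> generating_triple Gam Om P r0 R0 ->
  0 < eps -> eps <= r0 / R0 / 4 ->
  perturbed_solution Gam Om P r0 R0 Phi phi eps f F v1 ->
  perturbed_solution Gam Om P r0 R0 Phi phi eps f F v2 ->
  ae_eq (lebesgue_rV R n) (perturbed_domain Gam Om P r0 R0 eps) v1 v2.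
Proof.
case: n Gam Om P Phi phi f F v1 v2 => // n Gam Om P Phi phi f F v1 v2 _.
move=> hG eps0 epsle [H1 L1] [H2 L2].
have oV := open_perturbed_domain hG eps0 epsle.
have H := H1_closureD (-1) oV H1 H2.
have L : is_weak_laplacian (perturbed_domain Gam Om P r0 R0 eps)
    (fun x => v1 x + -1 * v2 x) (fun=> 0).
  have := is_weak_laplacianD (-1) oV L1 L2.
  by congr is_weak_laplacian; apply/funext => x; rewrite mulN1r subrr.
have [M [_ OM]] := inner_bounded hG.
(* The perturbed domain lies in the union of the bounded set [Om] and the ball of radius [r0], so
   this bounds its first coordinate. *)
pose d := `|M| + 1 + r0.
have Vd x : perturbed_domain Gam Om P r0 R0 eps x -> `|x ord0 ord0| <= d.
  move=> /(perturbed_domainP hG eps0 epsle)[[Ox _]|[_ xr]]; last first.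
    rewrite (le_trans (coord_le_enorm x ord0))// (le_trans (ltW xr))//.
    by rewrite lerDr addr_ge0.
  have xM : `|x| <= `|M| + 1.
    by apply: OM Ox; rewrite (le_lt_trans (ler_norm M))// ltrDl.
  apply: le_trans (le_trans _ xM) _;
    last by rewrite lerDl ltW// (inner_radius hG).
  rewrite [leRHS]/Num.norm/= mx_normrE.
  by apply/bigmax_geP; right => /=; exists (ord0, ord0).
have := H10_harmonic_eq0 oV Vd H L.
by apply: filterS => x z0 /z0; rewrite mulN1r => /eqP; rewrite subr_eq0 => /eqP.
Qed.

Theorem theorem3p3 (R : realType) (n : nat) (Gam Om P : set 'rV[R]_n)
    (r0 R0 : R) (Phi phi : 'rV[R]_n -> R) (eps : R)
    (f F u U : 'rV[R]_n -> R) :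
  (2 <= n)%N ->
  generating_triple Gam Om P r0 R0 ->
  cutoffs r0 R0 Phi phi ->
  0 < eps -> eps <= r0 / R0 / 4 ->
  F_inner Om r0 f -> F_outer P R0 F ->
  E_inner Om r0 u -> E_outer P R0 U ->
  ae_eq (lebesgue_rV R n) Om (block_operator Om P Phi phi eps (u, U)).1 f ->
  ae_eq (lebesgue_rV R n) P (block_operator Om P Phi phi eps (u, U)).2 F ->
  let Omeps := perturbed_domain Gam Om P r0 R0 eps in
  let is_solution := perturbed_solution Gam Om P r0 R0 Phi phi eps f F in
  let weps := glued_function Om P Phi phi eps (u, U) in
  is_solution weps /\
  forall v, is_solution v -> ae_eq (lebesgue_rV R n) Omeps v weps.
Proof.
move=> n2 hG hc eps0 epsle hf hF hu hU eqf eqF Omeps is_solution weps.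
have sol : is_solution weps by exact: perturbed_solution_glued.
split=> // v solv; apply: perturbed_solution_unique solv sol => //.
exact: ltnW.
Qed.
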